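(* Let $q,p\in\mathbb{C}$ with $|p|<1$ and $n\in\mathbb{N}_0$. Then in the algebra $\mathbb{C}_{q,p}[X,Y,\mathbb{E}_{x,a,b,c;q,p}]$ (defined in the context), $$\big(X+ h_{x;b,a,c;q,p}(0,0)\,Y\big)^n=\sum_{k=0}^n\begin{bmatrix}n \\ k \end{bmatrix}_{x; a,b,c;q,p}\bigg(\prod_{j=0}^{n-k-1} h_{x;b,a,c;q,p}(j,0)\bigg)X^kY^{n-k}.$$
   Context: $\theta(x;p):=\prod_{\ell\ge0}(1-xp^\ell)(1-p^{\ell+1}/x)$, $\theta(x_1,\dots,x_s;p):=\prod_i\theta(x_i;p)$, $(x;q,p)_k:=\prod_{j=0}^{k-1}\theta(xq^j;p)$ (empty product $1$), $(x_1,\dots,x_s;q,p)_k:=\prod_i(x_i;q,p)_k$. Write $q=e^{2\pi\sqrt{-1}\sigma}$, $p=e^{2\pi\sqrt{-1}\tau}$, $\Im\tau>0$; $\mathbb{E}_{x,a,b,c;q,p}$ is the field of functions of $x,a,b,c$ meromorphic in $\log_q x,\log_q a,\log_q b,\log_q c$ and doubly periodic in each with periods $\sigma^{-1}$, $\tau\sigma^{-1}$. Define $$h_{x;a,b,c;q,p}(i,j):=\frac{\theta(bcq^{i+2j},(c/b)q^i,axq^i,(a/x)q^i;p)}{\theta(abq^{i+j},(a/b)q^{i-j},cxq^{i+j},(c/x)q^{i+j};p)},\qquad H_{x;a,b,c;q,p}(i,j):=\frac{h_{x;a,b,c;q,p}(i,j)}{h_{x;a,b,c;q,p}(i,0)},$$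 with $h_{x;b,a,c;q,p}$ obtained by interchanging $a$ and $b$. For $k,\ell\in\mathbb{N}_0$ let $$B(k,\ell)=\frac{\theta((a/b)q^{k-\ell},b/a;p)(bcq^{\ell}; q, p)_k(acq^k, ab, cx, c/x, q^{k+1}; q, p)_{\ell}}{\theta((a/b)q^k,(b/a)q^{\ell};p)(bc;q,p)_k(ac, abq^k, cxq^k, (c/x)q^k, q; q, p)_{\ell}}\, q^{\ell},$$ and $\begin{bmatrix} n \\ k \end{bmatrix}_{x;a,b,c;q,p}:=B(k,n-k)$ for $0\le k\le n$, $:=0$ otherwise. $\mathbb{C}_{q,p}[X,Y,\mathbb{E}_{x,a,b,c;q,p}]$ is the associative unital algebra over $\mathbb{C}$ generated by $X$, $Y$ and the commutative subalgebra $\mathbb{E}_{x,a,b,c;q,p}$, subject to $YX=H_{x;a,b,c;q,p}(0,1)\,XY$, $Xf(x,a,b,c)=f(x,aq,b,cq)X$, $Yf(x,a,b,c)=f(x,a,bq,cq)Y$ for all $f\in\mathbb{E}_{x,a,b,c;q,p}$. *)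

(* Defs.v *)
From HB Require Import structures.
From mathcomp Require Import all_boot all_order all_algebra.
From mathcomp Require Import all_classical all_reals all_analysis.
From mathcomp.real_closed Require Import complex.
Set Implicit Arguments. Unset Strict Implicit. Unset Printing Implicit Defensive.
Import Order.TTheory GRing.Theory Num.Theory.
Import numFieldNormedType.Exports.
Local Open Scope classical_set_scope.
Local Open Scope ring_scope.
Local Open Scope quotient_scope.

(* The complex numbers, with their canonical normed topology: the bundled type
   is what triggers the topological instances, which [R[i]] alone does not. *)
Definition Cplx (R : realType) : numClosedFieldType := R[i].

Definition cexp (R : realType) (z : Cplx R) : Cplx R :=
  Complex (expR (complex.Re z) * cos (complex.Im z))
          (expR (complex.Re z) * sin (complex.Im z)).

(* e^(2 pi i s); thus q = nome sigma, p = nome tau and q^u = nome (sigma * u). *)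
Definition nome (R : realType) (s : Cplx R) : Cplx R :=
  cexp (Complex 0 (2 * pi) * s).

Section Theta.
Context {R : realType}.
Notation C := (Cplx R).
Implicit Types (q p x a b c : C) (xs : seq C).

Definition theta p x : C :=
  lim ((fun N : nat =>
    \prod_(0 <= l < N) ((1 - x * p ^+ l) * (1 - p ^+ l.+1 / x))) @ \oo).

Definition thetas p xs : C := \prod_(x <- xs) theta p x.

Definition poch q p x (k : nat) : C := \prod_(0 <= j < k) theta p (x * q ^+ j).

Definition pochs q p xs (k : nat) : C := \prod_(x <- xs) poch q p x k.

Definition h_fun q p (i j : nat) x a b c : C :=
  thetas p [:: b * c * q ^+ (i + 2 * j); (c / b) * q ^+ i;
               a * x * q ^+ i; (a / x) * q ^+ i] /
  thetas p [:: a * b * q ^+ (i + j); (a / b) * q ^ (i%:Z - j%:Z);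
               c * x * q ^+ (i + j); (c / x) * q ^+ (i + j)].

Definition H_fun q p (i j : nat) x a b c : C :=
  h_fun q p i j x a b c / h_fun q p i 0 x a b c.

Definition B_fun q p (k l : nat) x a b c : C :=
  (thetas p [:: (a / b) * q ^ (k%:Z - l%:Z); b / a] *
   poch q p (b * c * q ^+ l) k *
   pochs q p [:: a * c * q ^+ k; a * b; c * x; c / x; q ^+ k.+1] l) /
  (thetas p [:: (a / b) * q ^+ k; (b / a) * q ^+ l] *
   poch q p (b * c) k *
   pochs q p [:: a * c; a * b * q ^+ k; c * x * q ^+ k; (c / x) * q ^+ k; q] l)
  * q ^+ l.

Definition binom_fun q p (n k : nat) x a b c : C :=
  if (k <= n)%N then B_fun q p k (n - k) x a b c else 0.

End Theta.

(* The coordinates of a point of C^4 are the logarithms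
   (log_q x, log_q a, log_q b, log_q c), in this order. *)
Section Meromorphic.
Context {R : realType}.
Notation C := (Cplx R).
Notation V := 'rV[C]_4.
Implicit Types (f g h : V -> C) (z w v : V).

(* A meromorphic function is only defined off a nowhere dense analytic set, so
   identities between such functions are read on dense open sets. *)
Definition generically (P : set V) : Prop :=
  exists U : set V, [/\ open U, dense U & U `<=` P].

(* Locally a quotient of holomorphic functions whose denominator vanishes on no
   nonempty open set.  The values of f where the denominators vanish are
   irrelevant: they are quotiented out in [ellE] below. *)
Definition meromorphic f : Prop :=
  forall z, exists (U : set V) (g h : V -> C),
    [/\ open U, U z,
        forall w, U w -> differentiable g w /\ differentiable h w,
        U `<=` closure [set w | U w /\ h w != 0] &
        forall w, U w -> h w != 0 -> f w = g w / h w].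

Definition has_period v f : Prop := generically [set z | f (z + v) = f z].

Lemma generically_all (P : set V) : (forall z, P z) -> generically P.
Proof.
move=> PT; exists setT; split=> //; first exact: openT.
by move=> O [z Oz] _; exists z.
Qed.

Lemma genericallyI (P Q S : set V) : generically P -> generically Q ->
  (forall z, P z -> Q z -> S z) -> generically S.
Proof.
move=> [U [oU dU UP]] [W [oW dW WQ]] PQ; exists (U `&` W); split.
- exact: openI.
- move=> O O0 oO; have [z [Oz Uz]] := dU O O0 oO.
  have [] := dW (O `&` U); [by exists z | exact: openI |].
  by move=> w [[Ow Uw] Ww]; exists w.
- by move=> z [/UP Pz /WQ Qz]; exact: PQ.
Qed.

Lemma generically_ex (P : set V) : generically P -> exists z, P z.
Proof.
move=> [U [oU dU UP]]; have [] := dU setT; [by exists 0 | exact: openT |].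
by move=> z [_ /UP]; exists z.
Qed.

Lemma open_translate v (U : set V) : open U -> open [set z | U (z + v)].
Proof.
move=> oU; apply: (@open_comp _ _ (fun z : V => z + v)) => // z _.
by apply: (@continuousD _ _ _ id (fun=> v)); [exact: cvg_id | exact: cst_continuous].
Qed.

Lemma generically_translate v (P : set V) :
  generically P -> generically [set z | P (z + v)].
Proof.
move=> [U [oU dU UP]]; exists [set z | U (z + v)]; split.
- exact: open_translate.
- move=> O [z Oz] oO; have [||w [Ow Uw]] := dU [set w | O (w - v)].
  + by exists (z + v); rewrite /= addrK.
  + exact: (open_translate (v := - v)).
  + by exists (w - v); split=> //=; rewrite subrK.
- by move=> z /UP.
Qed.

Lemma mero_cst (c : C) : meromorphic (fun=> c).
Proof.
move=> z; exists setT, (fun=> c), (fun=> 1); split=> //.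
- exact: openT.
- by move=> w _; apply: subset_closure => /=; rewrite oner_neq0.
- by move=> w _ _; rewrite divr1.
Qed.

Let dense_both (U1 U2 : set V) h1 h2 : open U1 -> open U2 ->
  (forall w, U1 w -> differentiable h1 w) ->
  U1 `<=` closure [set w | U1 w /\ h1 w != 0] ->
  U2 `<=` closure [set w | U2 w /\ h2 w != 0] ->
  U1 `&` U2 `<=` closure [set w | (U1 `&` U2) w /\ h1 w * h2 w != 0].
Proof.
move=> o1 o2 dh1 c1 c2 z [U1z U2z] B; rewrite nbhsE => -[B' [oB' B'z] sB].
have oU : open (B' `&` (U1 `&` U2)) by apply: openI => //; apply: openI.
have n1 : nbhs z (B' `&` (U1 `&` U2)) by apply: open_nbhs_nbhs.
have [w [[U1w h1w] Bw]] := c1 z U1z _ n1.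
have n2 : nbhs w (B' `&` (U1 `&` U2) `&` [set y | h1 y != 0]).
  apply: filterI; first exact: open_nbhs_nbhs.
  have /differentiable_continuous h1c := dh1 w U1w.
  exact: cvgr_neq0 h1c h1w.
have [y [[U2y h2y] [[B'y [U1y _]] h1y]]] := c2 w Bw.2.2 _ n2.
by exists y; split; [split=> //; exact: mulf_neq0 | exact: sB].
Qed.

Lemma mero_sub f1 f2 : meromorphic f1 -> meromorphic f2 ->
  meromorphic (fun z => f1 z - f2 z).
Proof.
move=> m1 m2 z; have [U1 [g1 [h1 [oU1 U1z d1 c1 e1]]]] := m1 z.
have [U2 [g2 [h2 [oU2 U2z d2 c2 e2]]]] := m2 z.
exists (U1 `&` U2), (fun w => g1 w * h2 w - g2 w * h1 w), (fun w => h1 w * h2 w).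
split; [exact: openI | by [] | | |].
- move=> w [/d1 [dg1 dh1] /d2 [dg2 dh2]].
  have dgh1 : differentiable (g1 * h2) w by apply: differentiableM.
  have dgh2 : differentiable (g2 * h1) w by apply: differentiableM.
  have dhh : differentiable (h1 * h2) w by apply: differentiableM.
  have dgh : differentiable (g1 * h2 - g2 * h1) w by apply: differentiableB.
  by split.
- by apply: (dense_both oU1 oU2 _ c1 c2) => w /d1 [].
- move=> w [U1w U2w]; rewrite mulf_eq0 negb_or => /andP[h1w h2w].
  by rewrite e1 // e2 // -mulNr addf_div // mulNr.
Qed.

Lemma mero_mul f1 f2 : meromorphic f1 -> meromorphic f2 ->
  meromorphic (fun z => f1 z * f2 z).
Proof.
move=> m1 m2 z; have [U1 [g1 [h1 [oU1 U1z d1 c1 e1]]]] := m1 z.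
have [U2 [g2 [h2 [oU2 U2z d2 c2 e2]]]] := m2 z.
exists (U1 `&` U2), (fun w => g1 w * g2 w), (fun w => h1 w * h2 w).
split; [exact: openI | by [] | | |].
- move=> w [/d1 [dg1 dh1] /d2 [dg2 dh2]].
  have dgg : differentiable (g1 * g2) w by apply: differentiableM.
  have dhh : differentiable (h1 * h2) w by apply: differentiableM.
  by split.
- by apply: (dense_both oU1 oU2 _ c1 c2) => w /d1 [].
- move=> w [U1w U2w]; rewrite mulf_eq0 negb_or => /andP[h1w h2w].
  by rewrite e1 // e2 // mulf_div.
Qed.

Lemma differentiable_translate v f z :
  differentiable f (z + v) -> differentiable (fun w => f (w + v)) z.
Proof.
move=> df; pose t : V -> V := id + cst v.
have dt : differentiable t z.
  by apply: differentiableD; [exact: ex_diff | exact: ex_diff].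
have tz : z + v = t z by [].
rewrite tz in df; exact: (differentiable_comp dt df).
Qed.

Lemma mero_translate v f : meromorphic f -> meromorphic (fun z => f (z + v)).
Proof.
move=> mf z; have [U [g [h [oU Uz d cl e]]]] := mf (z + v).
exists [set w | U (w + v)], (fun w => g (w + v)), (fun w => h (w + v)).
split=> //.
- exact: open_translate.
- by move=> w /d[dg dh]; split; exact: differentiable_translate.
- move=> w Uw B; rewrite nbhsE => -[B' [oB' B'w] sB].
  have [|y [[Uy hy] B'y]] := cl _ Uw [set y | B' (y - v)].
    by apply: open_nbhs_nbhs; split; [exact: open_translate | rewrite /= addrK].
  by exists (y - v); split; [rewrite /= subrK | exact: sB].
- by move=> w; exact: e.
Qed.

End Meromorphic.

Section Elliptic.
Context {R : realType} (sigma tau : Cplx R).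
Notation C := (Cplx R).
Notation V := 'rV[C]_4.

Definition doubly_periodic (f : V -> C) : Prop :=
  forall i : 'I_4, has_period (sigma^-1 *: delta_mx 0 i) f /\
                   has_period ((tau / sigma) *: delta_mx 0 i) f.

Definition elliptic : {pred V -> C} :=
  fun f => `[< meromorphic f /\ doubly_periodic f >].

Lemma ellipticP (f : V -> C) :
  reflect (meromorphic f /\ doubly_periodic f) (f \in elliptic).
Proof. exact: asboolP. Qed.

Lemma has_period_cst v (c : C) : has_period v (fun=> c).
Proof. exact: generically_all. Qed.

Lemma elliptic_cst (c : C) : (fun=> c) \in elliptic.
Proof.
by apply/ellipticP; split; [exact: mero_cst | split; exact: has_period_cst].
Qed.

Fact elliptic_subring_closed : subring_closed elliptic.
Proof.
split; first exact: (elliptic_cst 1).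
- move=> f g /ellipticP[mf pf] /ellipticP[mg pg]; apply/ellipticP; split.
    exact: mero_sub.
  by move=> i; have [pf1 pf2] := pf i; have [pg1 pg2] := pg i; split;
    [apply: (genericallyI pf1 pg1) | apply: (genericallyI pf2 pg2)];
    move=> z /= fz gz; rewrite !fctE fz gz.
- move=> f g /ellipticP[mf pf] /ellipticP[mg pg]; apply/ellipticP; split.
    exact: mero_mul.
  by move=> i; have [pf1 pf2] := pf i; have [pg1 pg2] := pg i; split;
    [apply: (genericallyI pf1 pg1) | apply: (genericallyI pf2 pg2)];
    move=> z /= fz gz; rewrite !fctE fz gz.
Qed.

HB.instance Definition _ :=
  GRing.isSubringClosed.Build (V -> C) elliptic elliptic_subring_closed.

Record ellfun := EllFun { ellfun_val :> V -> C; _ : ellfun_val \in elliptic }.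
HB.instance Definition _ := [isSub for ellfun_val].
HB.instance Definition _ := [Choice of ellfun by <:].
HB.instance Definition _ := [SubChoice_isSubComNzRing of ellfun by <:].

Definition negligible : {pred ellfun} :=
  fun f : ellfun => `[< generically [set z | f z = 0] >].

Lemma negligibleP (f : ellfun) :
  reflect (generically [set z | f z = 0]) (f \in negligible).
Proof. exact: asboolP. Qed.

Fact negligible_idealr_closed : idealr_closed negligible.
Proof.
split.
- by apply/negligibleP; exact: generically_all.
- by apply/negP => /negligibleP/generically_ex[z /= /eqP]; rewrite oner_eq0.
- move=> e f g /negligibleP nf /negligibleP ng; apply/negligibleP.
  by apply: (genericallyI nf ng) => z /= fz gz; rewrite !fctE fz gz mulr0 addr0.
Qed.

HB.instance Definition _ :=
  isIdealr.Build ellfun negligible negligible_idealr_closed.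

(* The field E_{x,a,b,c;q,p}: elliptic functions up to equality on a dense open
   set.  Only its commutative ring structure is needed below. *)
Definition ellE := {ideal_quot negligible}.
HB.instance Definition _ := GRing.ComNzRing.on ellE.
HB.instance Definition _ := EqQuotient.on ellE.

Definition ell_class (f : ellfun) : ellE := \pi_ellE f.

(* The class in [ellE] of a function of (x, a, b, c), for x = q^(log_q x) etc.
   F is a total function, so it takes junk values at its poles, which are
   generically irrelevant.  By convention an F that does not give an elliptic
   function is sent to 0; the balanced theta quotients below are elliptic. *)
Definition ell (F : C -> C -> C -> C -> C) : ellE :=
  ell_class (insubd 0 (fun z : V =>
    F (nome (sigma * z 0 0)) (nome (sigma * z 0 1))
      (nome (sigma * z 0 2)) (nome (sigma * z 0 3)))).

Definition ell_const (c : C) : ellE := ell_class (EllFun (elliptic_cst c)).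

Fact translate_elliptic v (f : ellfun) : (fun z => f (z + v)) \in elliptic.
Proof.
case: f => f /ellipticP[mf pf] /=; apply/ellipticP; split.
  exact: mero_translate.
by move=> i; have [pf1 pf2] := pf i; split;
  [have := generically_translate v pf1 | have := generically_translate v pf2];
  move=> pfv; apply: (genericallyI pfv pfv) => z /= fz _; rewrite addrAC.
Qed.

Definition translate v (f : ellfun) : ellfun := EllFun (translate_elliptic v f).

(* f(x, a, b, c) |-> f(x, aq, b, cq) and f(x, a, b, c) |-> f(x, a, bq, cq);
   multiplying a variable by q adds 1 to its logarithm. *)
Definition shiftX : ellfun -> ellfun := translate (delta_mx 0 1 + delta_mx 0 3).
Definition shiftY : ellfun -> ellfun := translate (delta_mx 0 2 + delta_mx 0 3).

Notation q := (nome sigma).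
Notation p := (nome tau).

Definition H_ell (i j : nat) : ellE := ell (H_fun q p i j).

(* h_{x;b,a,c;q,p}(i, j), with a and b interchanged. *)
Definition hswap_ell (i j : nat) : ellE :=
  ell (fun x a b c => h_fun q p i j x b a c).

Definition binom_ell (n k : nat) : ellE := ell (binom_fun q p n k).

(* The algebra C_{q,p}[X, Y, E] is built as the quotient of the formal
   expressions in X, Y and the elements of E by the least congruence that
   contains the ring axioms, the ring operations of E and the three families
   of defining relations. *)
Inductive term : Type :=
| TX
| TY
| TCoef of ellE
| TAdd of term & term
| TOpp of term
| TMul of term & term.

Inductive term_eqv : term -> term -> Prop :=
| eqv_refl s : term_eqv s s
| eqv_sym s t : term_eqv s t -> term_eqv t s
| eqv_trans s t u : term_eqv s t -> term_eqv t u -> term_eqv s u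
| eqv_add s s' t t' : term_eqv s s' -> term_eqv t t' ->
    term_eqv (TAdd s t) (TAdd s' t')
| eqv_opp s s' : term_eqv s s' -> term_eqv (TOpp s) (TOpp s')
| eqv_mul s s' t t' : term_eqv s s' -> term_eqv t t' ->
    term_eqv (TMul s t) (TMul s' t')
| eqv_addA s t u : term_eqv (TAdd s (TAdd t u)) (TAdd (TAdd s t) u)
| eqv_addC s t : term_eqv (TAdd s t) (TAdd t s)
| eqv_add0 s : term_eqv (TAdd (TCoef 0) s) s
| eqv_addN s : term_eqv (TAdd (TOpp s) s) (TCoef 0)
| eqv_mulA s t u : term_eqv (TMul s (TMul t u)) (TMul (TMul s t) u)
| eqv_mul1l s : term_eqv (TMul (TCoef 1) s) s
| eqv_mul1r s : term_eqv (TMul s (TCoef 1)) s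
| eqv_mulDl s t u :
    term_eqv (TMul (TAdd s t) u) (TAdd (TMul s u) (TMul t u))
| eqv_mulDr s t u :
    term_eqv (TMul s (TAdd t u)) (TAdd (TMul s t) (TMul s u))
| eqv_coefD (f g : ellE) :
    term_eqv (TCoef (f + g)) (TAdd (TCoef f) (TCoef g))
| eqv_coefM (f g : ellE) :
    term_eqv (TCoef (f * g)) (TMul (TCoef f) (TCoef g))
| eqv_YX : term_eqv (TMul TY TX) (TMul (TCoef (H_ell 0 1)) (TMul TX TY))
| eqv_Xf (f : ellfun) :
    term_eqv (TMul TX (TCoef (ell_class f)))
             (TMul (TCoef (ell_class (shiftX f))) TX)
| eqv_Yf (f : ellfun) :
    term_eqv (TMul TY (TCoef (ell_class f)))
             (TMul (TCoef (ell_class (shiftY f))) TY).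

HB.instance Definition _ := gen_eqMixin term.
HB.instance Definition _ := gen_choiceMixin term.

Definition term_eqvb : rel term := fun s t => `[< term_eqv s t >].

Fact term_eqvb_equiv : equiv_class_of term_eqvb.
Proof.
split=> [s|s t|t s u].
- exact/asboolP/eqv_refl.
- by apply/asboolP/asboolP; exact: eqv_sym.
- by move=> /asboolP st /asboolP tu; apply/asboolP; exact: eqv_trans st tu.
Qed.

Canonical term_equiv : equiv_rel term := EquivRelPack term_eqvb_equiv.

Definition XYalg := {eq_quot term_equiv}.
HB.instance Definition _ := Choice.on XYalg.
HB.instance Definition _ := EqQuotient.on XYalg.

Definition cls (t : term) : XYalg := \pi_XYalg t.

Lemma clsP s t : cls s = cls t <-> term_eqv s t.
Proof. by split=> [/eqmodP/asboolP|st]; [|apply/eqmodP/asboolP]. Qed.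

Lemma repr_eqv t : term_eqv (repr (cls t)) t.
Proof. by apply/clsP; exact: reprK. Qed.

Lemma XYalgW (P : XYalg -> Prop) : (forall t, P (cls t)) -> forall x, P x.
Proof. by move=> Pt x; rewrite -[x]reprK; exact: Pt. Qed.

Definition XYadd (x y : XYalg) : XYalg := cls (TAdd (repr x) (repr y)).
Definition XYopp (x : XYalg) : XYalg := cls (TOpp (repr x)).
Definition XYmul (x y : XYalg) : XYalg := cls (TMul (repr x) (repr y)).

Lemma XYaddE s t : XYadd (cls s) (cls t) = cls (TAdd s t).
Proof. by apply/clsP; apply: eqv_add; exact: repr_eqv. Qed.

Lemma XYoppE s : XYopp (cls s) = cls (TOpp s).
Proof. by apply/clsP; apply: eqv_opp; exact: repr_eqv. Qed.

Lemma XYmulE s t : XYmul (cls s) (cls t) = cls (TMul s t).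
Proof. by apply/clsP; apply: eqv_mul; exact: repr_eqv. Qed.

Fact XYaddA : associative XYadd.
Proof.
elim/XYalgW=> s; elim/XYalgW=> t; elim/XYalgW=> u.
by rewrite !XYaddE; apply/clsP; exact: eqv_addA.
Qed.

Fact XYaddC : commutative XYadd.
Proof.
elim/XYalgW=> s; elim/XYalgW=> t.
by rewrite !XYaddE; apply/clsP; exact: eqv_addC.
Qed.

Fact XYadd0 : left_id (cls (TCoef 0)) XYadd.
Proof. by elim/XYalgW=> s; rewrite XYaddE; apply/clsP; exact: eqv_add0. Qed.

Fact XYaddN : left_inverse (cls (TCoef 0)) XYopp XYadd.
Proof.
by elim/XYalgW=> s; rewrite XYoppE XYaddE; apply/clsP; exact: eqv_addN.
Qed.

HB.instance Definition _ :=
  GRing.isZmodule.Build XYalg XYaddA XYaddC XYadd0 XYaddN.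

Fact XYmulA : associative XYmul.
Proof.
elim/XYalgW=> s; elim/XYalgW=> t; elim/XYalgW=> u.
by rewrite !XYmulE; apply/clsP; exact: eqv_mulA.
Qed.

Fact XYmul1l : left_id (cls (TCoef 1)) XYmul.
Proof. by elim/XYalgW=> s; rewrite XYmulE; apply/clsP; exact: eqv_mul1l. Qed.

Fact XYmul1r : right_id (cls (TCoef 1)) XYmul.
Proof. by elim/XYalgW=> s; rewrite XYmulE; apply/clsP; exact: eqv_mul1r. Qed.

Fact XYmulDl : left_distributive XYmul XYadd.
Proof.
elim/XYalgW=> s; elim/XYalgW=> t; elim/XYalgW=> u.
by rewrite !(XYaddE, XYmulE); apply/clsP; exact: eqv_mulDl.
Qed.

Fact XYmulDr : right_distributive XYmul XYadd.
Proof.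
elim/XYalgW=> s; elim/XYalgW=> t; elim/XYalgW=> u.
by rewrite !(XYaddE, XYmulE); apply/clsP; exact: eqv_mulDr.
Qed.

(* X, Y |-> 0 extends to a retraction of [XYalg] onto [ellE]. *)
Fixpoint term_aug (t : term) : ellE :=
  match t with
  | TX | TY => 0
  | TCoef f => f
  | TAdd s t => term_aug s + term_aug t
  | TOpp s => - term_aug s
  | TMul s t => term_aug s * term_aug t
  end.

Lemma term_aug_eqv s t : term_eqv s t -> term_aug s = term_aug t.
Proof.
elim=> //= *; rewrite ?(mul0r, mulr0, addrA, mulrA, add0r, addNr, mul1r, mulr1,
  mulrDl, mulrDr) //; try congruence.
exact: addrC.
Qed.

Fact XY1_neq0 : cls (TCoef 1) != cls (TCoef 0).
Proof.
by apply/eqP => /clsP/term_aug_eqv/= /eqP; rewrite oner_eq0.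
Qed.

HB.instance Definition _ := GRing.Zmodule_isNzRing.Build XYalg
  XYmulA XYmul1l XYmul1r XYmulDl XYmulDr XY1_neq0.

Definition XYX : XYalg := cls TX.
Definition XYY : XYalg := cls TY.
Definition XYcoef (f : ellE) : XYalg := cls (TCoef f).

Lemma addXYE s t : cls s + cls t = cls (TAdd s t).
Proof. exact: XYaddE. Qed.

Lemma mulXYE s t : cls s * cls t = cls (TMul s t).
Proof. exact: XYmulE. Qed.

Fact XYcoef_nmod_morphism : nmod_morphism XYcoef.
Proof.
split=> // f g; rewrite addXYE; apply/clsP; exact: eqv_coefD.
Qed.

Fact XYcoef_monoid_morphism : monoid_morphism XYcoef.
Proof.
split=> // f g; rewrite mulXYE; apply/clsP; exact: eqv_coefM.
Qed.

HB.instance Definition _ :=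
  GRing.isNmodMorphism.Build ellE XYalg XYcoef XYcoef_nmod_morphism.
HB.instance Definition _ :=
  GRing.isMonoidMorphism.Build ellE XYalg XYcoef XYcoef_monoid_morphism.

Fact ell_const_zmod_morphism : zmod_morphism ell_const.
Proof.
by move=> c d; rewrite /ell_const /ell_class -rmorphB; congr (\pi_ellE _); exact: val_inj.
Qed.

Fact ell_const_monoid_morphism : monoid_morphism ell_const.
Proof.
split=> [|c d]; rewrite /ell_const /ell_class.
  by rewrite -(rmorph1 \pi_ellE); congr (\pi_ellE _); exact: val_inj.
by rewrite -rmorphM; congr (\pi_ellE _); exact: val_inj.
Qed.

HB.instance Definition _ :=
  GRing.isZmodMorphism.Build C ellE ell_const ell_const_zmod_morphism.
HB.instance Definition _ :=
  GRing.isMonoidMorphism.Build C ellE ell_const ell_const_monoid_morphism.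

(* The complex scalars act through the constant functions. *)
Definition XYscale (c : C) (x : XYalg) : XYalg := XYcoef (ell_const c) * x.

Fact XYscaleA c d x : XYscale c (XYscale d x) = XYscale (c * d) x.
Proof. by rewrite /XYscale mulrA -!rmorphM. Qed.

Fact XYscale1 : left_id 1 XYscale.
Proof. by move=> x; rewrite /XYscale !rmorph1 mul1r. Qed.

Fact XYscaleDr : right_distributive XYscale +%R.
Proof. by move=> c x y; rewrite /XYscale mulrDr. Qed.

Fact XYscaleDl x : {morph XYscale^~ x : c d / c + d}.
Proof. by move=> c d; rewrite /XYscale !rmorphD mulrDl. Qed.

HB.instance Definition _ := GRing.Zmodule_isLmodule.Build C XYalg
  XYscaleA XYscale1 XYscaleDr XYscaleDl.

Fact XYscaleAl (c : C) (x y : XYalg) : c *: (x * y) = (c *: x) * y.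
Proof. exact: mulrA. Qed.

HB.instance Definition _ := GRing.Lmodule_isLalgebra.Build C XYalg XYscaleAl.

Lemma XYX_coef (f : ellfun) :
  XYX * XYcoef (ell_class f) = XYcoef (ell_class (shiftX f)) * XYX.
Proof. by rewrite !mulXYE; apply/clsP; exact: eqv_Xf. Qed.

Lemma XYY_coef (f : ellfun) :
  XYY * XYcoef (ell_class f) = XYcoef (ell_class (shiftY f)) * XYY.
Proof. by rewrite !mulXYE; apply/clsP; exact: eqv_Yf. Qed.

Lemma XYYX : XYY * XYX = XYcoef (H_ell 0 1) * (XYX * XYY).
Proof. by rewrite /XYX /XYY /XYcoef !mulXYE; apply/clsP; exact: eqv_YX. Qed.

Lemma XYconst_central c x :
  XYcoef (ell_const c) * x = x * XYcoef (ell_const c).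
Proof.
have shc v : translate v (EllFun (elliptic_cst c)) = EllFun (elliptic_cst c).
  exact: val_inj.
elim/XYalgW: x; elim=> [||f|s IHs t IHt|s IHs|s IHs t IHt].
- by rewrite -/XYX XYX_coef /shiftX shc.
- by rewrite -/XYY XYY_coef /shiftY shc.
- by rewrite -[cls (TCoef f)]/(XYcoef f) -!rmorphM mulrC.
- by rewrite -addXYE mulrDr mulrDl IHs IHt.
- by rewrite -(XYoppE s) (mulrN _ (cls s)) (mulNr (cls s)) IHs.
- by rewrite -mulXYE mulrA IHs -mulrA IHt mulrA.
Qed.

Fact XYscaleAr (c : C) (x y : XYalg) : c *: (x * y) = x * (c *: y).
Proof.
by rewrite /GRing.scale /= /XYscale mulrA XYconst_central mulrA.
Qed.

HB.instance Definition _ := GRing.Lalgebra_isAlgebra.Build C XYalg XYscaleAr.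

End Elliptic.

(* Main.v *)
Require Import Defs.
From HB Require Import structures.
From mathcomp Require Import all_boot all_order all_algebra.
From mathcomp Require Import all_classical all_reals all_analysis.
From mathcomp Require Import ring lra zify.
From mathcomp.real_closed Require Import complex.
Set Implicit Arguments. Unset Strict Implicit. Unset Printing Implicit Defensive.
Import Order.TTheory GRing.Theory Num.Theory.
Import numFieldNormedType.Exports.
Local Open Scope classical_set_scope.
Local Open Scope ring_scope.

(* Since h_{x;a,b,c} and the binomial coefficients are balanced quotients of theta
functions, they are elliptic; moving X and Y past them turns the expansion of
(X + h Y)^(n+1) = (X + h Y) (X + h Y)^n into a Pascal-type recurrence for the
coefficients.  After cancelling common theta factors this recurrence is
Weierstrass' three-term relation.

The three-term relation is a Pluecker relation: by the Jacobi triple product,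
theta(xy) theta(x/y) is a constant times f(x) g(y) - (x/y) g(x) f(y), where
f(x) = sum_i p^(i^2-i) x^(2i) and g(x) = sum_i p^(i^2) x^(2i).  This is obtained
as a dominated limit of the finite triple product, after splitting a double sum
over (m, n) according to the parity of m + n.  Differentiability of theta comes
from bounds on the second divided differences of the partial products. *)

(** * The norm of the complex numbers *)

(** Equality in [ellE] is equality on a dense open set, so identities between coefficients are
    checked at points where finitely many theta values are nonzero. Two facts carry the burden: such
    points are dense, and each quotient really is elliptic, since [ell] sends a non-elliptic
    function to 0. Density rests on the isolated zeros of theta and on the exponential being
    nonconstant along each coordinate; this is what the analytic part supplies.

    Two cancellations bring the recurrence within reach. Products of [H_fun] telescope, so a shifted
    coefficient times such a product is an unshifted coefficient times an explicit weight. And B(k,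
    l) is unchanged when (a, k) and (b, l) are exchanged, so only one of the two weights has to be
    computed; that they add up to 1 is the three-term relation.

    No counting of zeros enters: the Pluecker identity is exact for the truncated series, and only
    limits are taken. The induction on the exponent stops at [n] because theta(q^m) is assumed
    nonzero only for 0 < m <= n, which keeps the factors (q; q, p)_l in the denominators away from
    0. *)

Section ComplexNorm.
Context {R : realType}.
Local Notation C := (Cplx R).
Implicit Types (x y z : C).

(** The norm of [C] takes values in [C] itself; this real-valued copy lets estimates use the order
    and the exponential of [R]. *)
Definition nc (z : C) : R := ComplexField.Normc.normc z.
Arguments nc : simpl never.

Lemma normCE z : `|z| = Complex (nc z) 0.
Proof. by case: z. Qed.

Lemma ncM x y : nc (x * y) = nc x * nc y.
Proof. exact: ComplexField.Normc.normcM. Qed.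

Lemma ncV x : nc x^-1 = (nc x)^-1.
Proof. exact: ComplexField.Normc.normcV. Qed.

Lemma nc0 : nc 0 = 0. Proof. exact: ComplexField.Normc.normc0. Qed.
Lemma nc1 : nc 1 = 1. Proof. exact: ComplexField.Normc.normc1. Qed.

Lemma ncN x : nc (- x) = nc x.
Proof. exact: normcN. Qed.

Lemma ler_ncD x y : nc (x + y) <= nc x + nc y.
Proof. exact: le_normcD. Qed.

Lemma ler_ncB x y : nc (x - y) <= nc x + nc y.
Proof. by rewrite -(ncN y) ler_ncD. Qed.

Lemma nc_ge0 x : 0 <= nc x.
Proof. by case: x => a b; rewrite /nc /= sqrtr_ge0. Qed.

Lemma nc_eq0 x : (nc x == 0) = (x == 0).
Proof.
by apply/eqP/eqP => [/ComplexField.Normc.eq0_normc //|->]; exact: nc0.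
Qed.

Lemma nc_gt0 x : (0 < nc x) = (x != 0).
Proof. by rewrite lt0r nc_eq0 nc_ge0 andbT. Qed.

Lemma ncX x n : nc (x ^+ n) = nc x ^+ n.
Proof. by elim: n => [|n IH]; rewrite ?expr0 ?nc1 // !exprS ncM IH. Qed.

Lemma nc_exprz x (m : int) : nc (x ^ m) = nc x ^ m.
Proof. by case: m => m; rewrite ?NegzE -?exprnN ?exprnP ?ncV -?exprnP ncX. Qed.

Lemma nc_distC x y : nc (x - y) = nc (y - x).
Proof. by rewrite -ncN opprB. Qed.

Lemma nc_real (a : R) : nc (Complex a 0) = `|a|.
Proof. by rewrite /nc /= expr0n addr0 sqrtr_sqr. Qed.

Lemma ler_nc_sum (I : Type) (s : seq I) (P : pred I) (f : I -> C) :
  nc (\sum_(i <- s | P i) f i) <= \sum_(i <- s | P i) nc (f i).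
Proof.
elim/big_rec2: _ => [|i a b _ ab]; first by rewrite nc0.
by apply: le_trans (ler_ncD _ _) _; rewrite lerD2l.
Qed.

Lemma ler_Re_nc x : `|complex.Re x| <= nc x.
Proof.
case: x => a b; rewrite /nc /= -sqrtr_sqr ler_wsqrtr //.
by rewrite lerDl sqr_ge0.
Qed.

Lemma ler_Im_nc x : `|complex.Im x| <= nc x.
Proof.
case: x => a b; rewrite /nc /= -sqrtr_sqr ler_wsqrtr //.
by rewrite lerDr sqr_ge0.
Qed.

Lemma ler_nc_ReIm x : nc x <= `|complex.Re x| + `|complex.Im x|.
Proof.
case: x => a b.
have {1}-> : Complex a b = Complex a 0 + Complex 0 1 * Complex b 0 :> C.
  rewrite -[RHS]/(Complex (a + (0 * b - 1 * 0)) (0 + (0 * 0 + 1 * b))).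
  by rewrite !(mul0r, mulr0, mul1r, subr0, addr0, add0r).
apply: le_trans (ler_ncD _ _) _; rewrite ncM !nc_real /=.
by rewrite /nc /= expr0n add0r expr1n sqrtr1 mul1r.
Qed.

(** A positive element of [C] has imaginary part 0, so complex radii can be traded for real ones. *)
Lemma cvgCP (T : Type) (F : set_system T) (FF : Filter F) (u : T -> C) (l : C) :
  u @ F --> l <->
  forall e : R, 0 < e -> \forall t \near F, nc (l - u t) < e.
Proof.
split=> [/cvgrPdist_lt cu e e0|H].
  have := cu (Complex e 0); rewrite ltcE /= eqxx /= => /(_ e0).
  by apply: filterS => t; rewrite normCE ltcE /= eqxx.
apply/cvgrPdist_lt => -[a b]; rewrite ltcE /= => /andP[/eqP -> a0].
by have := H _ a0; apply: filterS => t; rewrite normCE ltcE /= eqxx.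
Qed.

Lemma nbhsCP (P : set C) (x : C) :
  nbhs x P <-> exists2 e : R, 0 < e & forall y, nc (x - y) < e -> P y.
Proof.
have -> : nbhs x P <-> nbhs_ball x P by rewrite nbhs_ballE.
split=> [[[a b]]|[e e0 H]].
  rewrite /= ltcE /= => /andP[/eqP -> a0] H; exists a => // y xy; apply: H.
  by rewrite -ball_normE /= normCE ltcE /= eqxx.
exists (Complex e 0); first by rewrite /= ltcE /= eqxx.
move=> y; rewrite -ball_normE /= normCE ltcE /= eqxx /=; exact: H.
Qed.

Lemma cvgC_ReIm (u : nat -> C) (a b : R) :
  @complex.Re R \o u @ \oo --> a -> @complex.Im R \o u @ \oo --> b ->
  u @ \oo --> (Complex a b : C).
Proof.
move=> /cvgrPdist_lt cRe /cvgrPdist_lt cIm; apply/cvgCP => e e0.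
have e20 : 0 < e / 2 by rewrite divr_gt0.
have [cr ci] := (cRe _ e20, cIm _ e20).
apply: filterS2 cr ci => t /=; case: (u t) => c d /= H1 H2.
apply: (@le_lt_trans _ _ (`|a - c| + `|b - d|)); first exact: ler_nc_ReIm.
by rewrite [e]splitr ltrD.
Qed.

(* The library does not know that C is complete. *)
Lemma cvgC_geometric (u : nat -> C) (K r : R) : 0 <= r < 1 ->
  (forall n, nc (u n.+1 - u n) <= K * r ^+ n) -> exists l : C, u @ \oo --> l.
Proof.
move=> /andP[r0 r1] H.
have real_case (f : C -> R) : (forall x, `|f x| <= nc x) ->
    (forall x y, f (x - y) = f x - f y) -> exists l : R, f \o u @ \oo --> l.
  move=> fle fB; set v : R^nat := f \o u.
  have cs : cvgn (series (telescope v)).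
    apply: normed_cvg; apply: (series_le_cvg (v_ := geometric K r)).
    - by move=> n; rewrite normr_ge0.
    - by move=> n; apply: le_trans (H n); exact: nc_ge0.
    - by move=> n; rewrite /telescope /= /v /= -fB (le_trans (fle _)) // H.
    - by apply: is_cvg_geometric_series; rewrite ger0_norm.
  exists (v 0%N + lim (series (telescope v) @ \oo)).
  have ev : v = fun n => v 0%N + series (telescope v) n.
    by apply/funext => n; rewrite {1}(eq_sum_telescope v).
  have : v 0%N + series (telescope v) n @[n --> \oo] -->
         v 0%N + lim (series (telescope v) @ \oo).
    by apply: cvgD => //; exact: cvg_cst.
  by rewrite -ev.
have [a ca] := real_case _ ler_Re_nc (fun x y => raddfB (@complex.Re R) x y).
have [b cb] := real_case _ ler_Im_nc (fun x y => raddfB (@complex.Im R) x y).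
by exists (Complex a b); exact: cvgC_ReIm.
Qed.

Lemma nc_cvg_le (u : nat -> C) (l : C) (K : R) : u @ \oo --> l ->
  (forall n, nc (u n) <= K) -> nc l <= K.
Proof.
move=> /cvgCP cu uK; apply/ler_addgt0Pr => e e0.
have [N _ /(_ N (leqnn N)) /= HN] := cu e e0.
rewrite -[l](subrK (u N)) addrC; apply: le_trans (ler_ncD _ _) _.
by rewrite lerD // ltW.
Qed.

End ComplexNorm.
Arguments nc : simpl never.

(** * The Euler product *)

Section EulerProduct.
Context {R : realType}.
Local Notation C := (Cplx R).
Implicit Types (p x y z : C) (r rho B K e : R).

(** Divided by x - y, the remainder is of order |x - y|, so [D] is the derivative. In this form
    differentiability follows from bounds that survive limits of sequences. *)
Lemma quadratic_remainder_differentiable (f : C -> C) y (D : C) K e : 0 < e ->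
  (forall x, nc (x - y) < e ->
     nc (f x - f y - (x - y) * D) <= K * nc (x - y) ^+ 2) ->
  differentiable f y.
Proof.
move=> e0 H; apply/derivable1_diffP.
suff cD : h^-1 *: (f (h *: (1 : C) + y) - f y) @[h --> (0 : C)^'] --> D.
  by apply/cvg_ex; exists D.
apply/cvgCP => eps eps0.
(* [K] has no sign condition and may be 0; |K| + 1 bounds it and can be divided by. *)
have K0 : 0 < `|K| + 1 by rewrite ltr_wpDl.
have d0 : 0 < Num.min e (eps / (`|K| + 1)) by rewrite lt_min e0 divr_gt0.
apply/nbhsCP; exists (Num.min e (eps / (`|K| + 1))) => // h.
rewrite sub0r ncN lt_min => /andP[he hK] h0.
have nh0 : 0 < nc h by rewrite nc_gt0.
have hy : h *: (1 : C) + y - y = h by rewrite addrK /GRing.scale /= mulr1.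
have := H (h *: (1 : C) + y); rewrite hy => /(_ he) Hh.
have -> : D - h^-1 *: (f (h *: (1 : C) + y) - f y) =
    - (h^-1 * (f (h *: (1 : C) + y) - f y - h * D)).
  by rewrite /GRing.scale /=; field.
rewrite ncN ncM ncV mulrC ltr_pdivrMr //; apply: le_lt_trans Hh _.
rewrite expr2 mulrA ltr_pM2r //.
apply: le_lt_trans (_ : (`|K| + 1) * nc h < eps); last first.
  by rewrite mulrC -ltr_pdivlMr.
rewrite ler_pM2r //; apply: le_trans (ler_norm K) _; rewrite lerDl.
exact: ler01.
Qed.

(** By 1 + t <= exp t, the product is at most the exponential of a geometric sum. *)
Lemma prod_geometric_le_expR r rho N : 0 < r < 1 -> 0 <= rho ->
  \prod_(0 <= l < N) (1 + rho * r ^+ l) <= expR (rho / (1 - r)).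
Proof.
move=> /andP[r0 r1] rho0.
apply: (@le_trans _ _ (expR (series (geometric rho r) N))); last first.
  by rewrite ler_expR geometric_le_lim // gtr0_norm.
rewrite /series /= expR_sum; apply: ler_prod => l _.
by rewrite expR_ge1Dx addr_ge0 // mulr_ge0 // exprn_ge0 // ltW.
Qed.

Section Fix_p.
Variable p : C.
Hypothesis p_bound : 0 < nc p < 1.

Lemma p_neq0 : p != 0.
Proof. by rewrite -nc_gt0; case/andP: p_bound. Qed.

Section Recursion.
Variables (x : C) (u v : nat -> C) (rho B : R).
Hypotheses (rho1 : 1 <= rho) (x_rho : nc x <= rho).
Hypothesis uS : forall N, u N.+1 = u N * (1 - x * p ^+ N) - v N * p ^+ N.
Hypothesis vB : forall N, nc (v N) <= B.

(** The recursion covers the partial Euler products ([v] = 0) and, with an already bounded sequence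
    as [v], their divided differences, so one bound independent of [N] serves them all. *)
Lemma rec_bounded N :
  nc (u N) <= (nc (u 0%N) + B) * expR (rho / (1 - nc p)).
Proof.
have B0 : 0 <= B by apply: le_trans (nc_ge0 _) (vB 0%N).
have rho0 : 0 <= rho by apply: le_trans rho1.
have pN0 n : 0 <= nc p ^+ n by rewrite exprn_ge0 // nc_ge0.
(* Adding [B] absorbs the inhomogeneous term: as [rho] >= 1, the sum grows by a factor of at most 1
   + rho |p|^N at each step. *)
apply: (@le_trans _ _ (nc (u N) + B)); first by rewrite lerDl.
apply: le_trans (ler_wpM2l _ (prod_geometric_le_expR N p_bound rho0)).
  elim: N => [|N IH]; first by rewrite big_nil mulr1.
  rewrite big_nat_recr //= mulrA.
  apply: le_trans (ler_wpM2r _ IH); last by rewrite addr_ge0 // mulr_ge0.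
  rewrite uS.
  have H1 : nc (u N * (1 - x * p ^+ N)) <= nc (u N) + nc (u N) * (rho * nc p ^+ N).
    have -> : nc (u N) + nc (u N) * (rho * nc p ^+ N) =
              nc (u N) * (1 + rho * nc p ^+ N) by ring.
    rewrite ncM ler_wpM2l ?nc_ge0 //.
    apply: le_trans (ler_ncB _ _) _; rewrite nc1 lerD2l ncM ncX.
    by rewrite ler_wpM2r.
  have H2 : nc (v N * p ^+ N) <= B * (rho * nc p ^+ N).
    rewrite ncM ncX; apply: ler_pM => //; first exact: nc_ge0.
    by rewrite -[X in X <= _]mul1r ler_wpM2r.
  have := ler_ncB (u N * (1 - x * p ^+ N)) (v N * p ^+ N); lra.
by rewrite addr_ge0 // nc_ge0.
Qed.

Lemma rec_cvg : exists l : C, u @ \oo --> l.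
Proof.
have B0 : 0 <= B by apply: le_trans (nc_ge0 _) (vB 0%N).
set M := (nc (u 0%N) + B) * expR (rho / (1 - nc p)).
apply: (@cvgC_geometric _ _ (M * rho + B) (nc p)).
  by case/andP: p_bound => /ltW -> ->.
move=> n; have -> : u n.+1 - u n = - ((u n * x + v n) * p ^+ n).
  by rewrite uS; ring.
rewrite ncN ncM ncX ler_wpM2r ?exprn_ge0 ?nc_ge0 //.
apply: le_trans (ler_ncD _ _) _; rewrite lerD // ncM.
by apply: ler_pM; rewrite ?nc_ge0 ?rec_bounded.
Qed.
End Recursion.

(** The shifted factorial (x; p)_N; its limit [euler] is (x; p)_oo, and theta(x) = (x; p)_oo (p/x;
    p)_oo. *)
Definition eulerN x N : C := \prod_(0 <= l < N) (1 - x * p ^+ l).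

Definition euler x : C := lim (eulerN x @ \oo).

Lemma eulerN_recr x N : eulerN x N.+1 = eulerN x N * (1 - x * p ^+ N).
Proof. by rewrite /eulerN big_nat_recr. Qed.

Lemma eulerN_recl x N : eulerN x N.+1 = (1 - x) * eulerN (p * x) N.
Proof.
rewrite /eulerN big_nat_recl //= expr0 mulr1; congr (_ * _).
by apply: eq_bigr => l _; rewrite exprS mulrCA mulrA.
Qed.

Lemma eulerN_rec x N :
  eulerN x N.+1 = eulerN x N * (1 - x * p ^+ N) - 0 * p ^+ N.
Proof. by rewrite eulerN_recr mul0r subr0. Qed.

Lemma eulerN_bounded rho x N : 1 <= rho -> nc x <= rho ->
  nc (eulerN x N) <= expR (rho / (1 - nc p)).
Proof.
move=> rho1 xr; have := rec_bounded rho1 xr (eulerN_rec x) (v := fun=> 0) (B := 0).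
rewrite {2}/eulerN big_nil nc1 addr0 mul1r => ->//.
by move=> _; rewrite nc0.
Qed.

Lemma eulerN_cvg x : eulerN x @ \oo --> euler x.
Proof.
have [] := @rec_cvg x (eulerN x) (fun=> 0) (nc x + 1) 0.
- by rewrite lerDr nc_ge0.
- by rewrite lerDl.
- exact: eulerN_rec.
- by move=> _; rewrite nc0.
by move=> l cl; rewrite /euler (cvg_lim (@norm_hausdorff _ _) cl).
Qed.

Lemma euler_unique x (l : C) : eulerN x @ \oo --> l -> euler x = l.
Proof. exact: (cvg_lim (@norm_hausdorff _ _)). Qed.

Lemma eulerE x : euler x = (1 - x) * euler (p * x).
Proof.
apply: euler_unique; rewrite -(cvg_shiftS (eulerN x)) /=.
have -> : (fun n => eulerN x n.+1) = (fun n => (1 - x) * eulerN (p * x) n).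
  by apply/funext => n; rewrite eulerN_recl.
apply: cvgM; [exact: cvg_cst | exact: eulerN_cvg].
Qed.

Lemma euler0 : euler 0 = 1.
Proof.
apply: euler_unique; have -> : eulerN 0 = fun=> 1; last exact: cvg_cst.
by apply/funext => n; rewrite /eulerN big1 // => l _; rewrite mul0r subr0.
Qed.

Lemma euler_split x M : euler x = eulerN x M * euler (p ^+ M * x).
Proof.
elim: M x => [|M IH] x; first by rewrite /eulerN big_nil !mul1r.
by rewrite eulerE IH eulerN_recl exprSr -!mulrA.
Qed.

(** The product rule for the difference of partial products at x and y, divided by x - y: the factor
    1 - x p^N is kept, and its change contributes - v p^N. No division occurs, so x = y is allowed
    and gives the derivative. *)
Fixpoint divided_diff x (v : nat -> C) N : C :=
  if N is N'.+1
  then divided_diff x v N' * (1 - x * p ^+ N') - v N' * p ^+ N' else 0.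

Lemma divided_diffE x y N :
  eulerN x N - eulerN y N = (x - y) * divided_diff x (eulerN y) N.
Proof.
elim: N => [|N IH] /=; first by rewrite /eulerN !big_nil subrr mulr0.
by rewrite mulrBr mulrA -IH !eulerN_recr; ring.
Qed.

(** The recursion has the same shape as that of the partial products, so the second divided
    difference is again a [divided_diff], with the first one as its source. *)
Lemma divided_diff2E x y v N : divided_diff x v N - divided_diff y v N =
  (x - y) * divided_diff x (divided_diff y v) N.
Proof.
elim: N => [|N IH] /=; first by rewrite subrr mulr0.
by rewrite [RHS]mulrBr [X in _ = X - _]mulrA -IH; ring.
Qed.

(** The second divided differences are bounded uniformly in [N] on the unit disc around [y], which
    [rho] covers; hence the quadratic remainder bound passes to the limit. *)
Lemma euler_differentiable y : differentiable euler y.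
Proof.
pose rho := nc y + 1; have rho1 : 1 <= rho by rewrite lerDr nc_ge0.
have y_rho : nc y <= rho by rewrite lerDl.
set E := expR (rho / (1 - nc p)).
(* A sequence starting at 0 with source bounded by B is bounded by B E: this gives E, E^2, E^3 for
   the products and their first two divided differences. *)
have Phi_le x : nc x <= rho -> forall N,
    nc (divided_diff x (eulerN y) N) <= E * E.
  move=> xr N; have := rec_bounded rho1 xr (u := divided_diff x (eulerN y))
    (v := eulerN y) (B := E); rewrite nc0 add0r; apply=> // n.
  exact: eulerN_bounded.
have Psi_le x : nc x <= rho -> forall N,
    nc (divided_diff x (divided_diff y (eulerN y)) N) <= E * E * E.
  move=> xr N; have := rec_bounded rho1 xr
    (u := divided_diff x (divided_diff y (eulerN y)))
    (v := divided_diff y (eulerN y)) (B := E * E); rewrite nc0 add0r.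
  by apply=> // n; exact: Phi_le.
have [D cD] : exists D : C, divided_diff y (eulerN y) @ \oo --> D.
  apply: (rec_cvg rho1 y_rho (v := eulerN y) (B := E)) => // n.
  exact: eulerN_bounded.
apply: (@quadratic_remainder_differentiable _ _ D (E * E * E) 1) => // x xy.
have xr : nc x <= rho.
  rewrite -[x](subrK y) addrC; apply: le_trans (ler_ncD _ _) _.
  by rewrite lerD2l ltW.
apply: (@nc_cvg_le _ (fun N => eulerN x N - eulerN y N -
    (x - y) * divided_diff y (eulerN y) N)).
  apply: cvgB; first by apply: cvgB; exact: eulerN_cvg.
  by apply: cvgM; [exact: cvg_cst | exact: cD].
move=> N; rewrite divided_diffE -mulrBr divided_diff2E !ncM mulrA -expr2 mulrC.
by rewrite ler_wpM2r ?exprn_ge0 ?nc_ge0 // Psi_le.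
Qed.

Lemma euler_continuous : continuous euler.
Proof. by move=> x; exact/differentiable_continuous/euler_differentiable. Qed.

Lemma exprn_cvg0 x : p ^+ M * x @[M --> \oo] --> (0 : C).
Proof.
apply/cvgCP => e e0; have /andP[r0 r1] := p_bound.
have := @cvg_geometric R (nc x) (nc p); rewrite gtr0_norm // => /(_ r1).
move=> /cvgrPdist_lt/(_ e e0); apply: filterS => n.
rewrite !sub0r normrN ncN /geometric /= ncM ncX mulrC ger0_norm //.
by rewrite mulr_ge0 ?exprn_ge0 ?nc_ge0.
Qed.

Lemma euler_tail_neq0 x : exists M, euler (p ^+ M * x) != 0.
Proof.
have : euler (p ^+ M * x) @[M --> \oo] --> euler 0.
  exact: cvg_comp (exprn_cvg0 x) (@euler_continuous 0).
rewrite euler0 => /cvgCP/(_ 1 ltr01)[N _ /(_ N (leqnn N))] /= HN.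
by exists N; apply: contraTneq HN => ->; rewrite subr0 nc1 ltxx.
Qed.

Lemma euler_neq0 x : (forall l, x * p ^+ l != 1) -> euler x != 0.
Proof.
move=> H; have [M HM] := euler_tail_neq0 x.
rewrite (euler_split x M) mulf_neq0 // /eulerN prodf_seq_neq0.
by apply/allP => l _ /=; rewrite subr_eq0 eq_sym H.
Qed.

(** The tail from some [M] on does not vanish near [y], and each of the first [M] factors is affine,
    with a single zero. *)
Lemma euler_isolated_zeros y :
  \forall x \near y, x != y -> euler x != 0.
Proof.
have [M HM] := euler_tail_neq0 y.
have tail : \forall x \near y, euler (p ^+ M * x) != 0.
  have ct : euler (p ^+ M * x) @[x --> y] --> euler (p ^+ M * y).
    exact: (@continuous_comp _ _ _ ( *%R (p ^+ M)) euler y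
      (@mulrl_continuous _ _ y) (@euler_continuous _)).
  exact: (cvgr_neq0 _ ct HM).
suff fin N : \forall x \near y, x != y -> eulerN x N != 0.
  have := fin M; apply: filterS2 tail => x tx fx xy.
  by rewrite (euler_split x M) mulf_neq0 // fx.
elim: N => [|N IH].
  by apply: (@filterE _ _ (nbhs_filter y)) => x _; rewrite /eulerN big_nil oner_neq0.
have step : \forall x \near y, x != y -> 1 - x * p ^+ N != 0.
  have [y1|y1] := eqVneq (1 - y * p ^+ N) 0.
    apply: (@filterE _ _ (nbhs_filter y)) => x; apply: contra_neq => x1.
    have pN0 : p ^+ N != 0 by rewrite expf_neq0 // p_neq0.
    apply: (mulIf pN0).
    by rewrite -[LHS](subKr 1) -[RHS](subKr 1) x1 y1.
  have c1 : 1 - x * p ^+ N @[x --> y] --> 1 - y * p ^+ N.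
    by apply: (@cvgB _ _ _ _ (nbhs_filter y)); [exact: cvg_cst |
      exact: mulrr_continuous].
  have := cvgr_neq0 _ c1 y1 => /(_ (nbhs_filter y)).
  by apply: (@filterS _ _ (nbhs_filter y)) => x nx _; exact: nx.
by apply: filterS2 IH step => x H1 H2 xy; rewrite eulerN_recr mulf_neq0 ?H1 ?H2.
Qed.

End Fix_p.
End EulerProduct.

(** * Theta functions *)

Section Theta.
Context {R : realType}.
Local Notation C := (Cplx R).
Variable p : C.
Hypothesis p_bound : 0 < nc p < 1.
Implicit Types x y : C.

Let p0 : p != 0 := p_neq0 p_bound.

Lemma theta_partial x N :
  \prod_(0 <= l < N) ((1 - x * p ^+ l) * (1 - p ^+ l.+1 / x)) =
  eulerN p x N * eulerN p (p / x) N.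
Proof.
rewrite /eulerN -big_split /=; apply: eq_bigr => l _.
by rewrite exprS mulrAC.
Qed.

Lemma theta_cvg x :
  eulerN p x N * eulerN p (p / x) N @[N --> \oo] --> theta p x.
Proof.
have cv : eulerN p x N * eulerN p (p / x) N @[N --> \oo] -->
    euler p x * euler p (p / x) by apply: cvgM; exact: eulerN_cvg.
suff -> : theta p x = euler p x * euler p (p / x) by [].
rewrite /theta; under eq_fun do rewrite theta_partial.
exact: (cvg_lim (@norm_hausdorff _ _) cv).
Qed.

Lemma thetaE x : theta p x = euler p x * euler p (p / x).
Proof.
apply: (cvg_unique (@norm_hausdorff _ _) (theta_cvg (x := x))).
by apply: cvgM; exact: eulerN_cvg.
Qed.

(** After the factors 1 - 1/x and 1 - x are split off, both sides contain the same two Euler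
    products, and 1 - 1/x = -(1 - x)/x. *)
Lemma theta_inv x : x != 0 -> theta p x^-1 = - x^-1 * theta p x.
Proof.
move=> x0; rewrite !thetaE invrK (eulerE p_bound x^-1) (eulerE p_bound x).
by field.
Qed.

Lemma theta_mulp x : x != 0 -> theta p (p * x) = - x^-1 * theta p x.
Proof.
move=> x0; rewrite -theta_inv // !thetaE invrK mulrC; congr (euler _ _ * _).
by rewrite invfM mulrA divff // mul1r.
Qed.

Lemma theta_divp x : x != 0 -> theta p (x / p) = - (x / p) * theta p x.
Proof.
move=> x0; have xp0 : x / p != 0 by rewrite mulf_neq0 // invr_eq0.
have e : x = p * (x / p) by rewrite mulrC divfK.
rewrite [X in _ = _ * theta p X]e theta_mulp //.
by field; rewrite p0 x0.
Qed.

Lemma theta_differentiable x : x != 0 -> differentiable (theta p) x.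
Proof.
move=> x0; have -> : theta p = euler p * (euler p \o (fun y => p * y^-1)).
  by apply/funext => y; rewrite thetaE.
apply: differentiableM; first exact: euler_differentiable.
apply: differentiable_comp; last exact: euler_differentiable.
apply: (@differentiableM _ _ (cst p) (fun y : C => y^-1)).
  exact: differentiable_cst.
by apply: differentiableV => //; exact: differentiable_id.
Qed.

Lemma theta_isolated_zeros y : y != 0 ->
  \forall x \near y, x != y -> theta p x != 0.
Proof.
move=> y0; have H1 := euler_isolated_zeros p_bound y.
have cV : p / x @[x --> y] --> p / y.
  apply: (@differentiable_continuous _ _ _ y (cst p * (fun x : C => x^-1))).
  by apply: differentiableM => //; exact: differentiableV.
have H2 := cV _ (euler_isolated_zeros p_bound (p / y)).
apply: filterS2 H1 H2 => x /= H1 H2 xy.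
rewrite thetaE mulf_neq0 ?H1 ?H2 //; apply: contra_neq xy => /(mulfI p0).
exact: invr_inj.
Qed.

End Theta.

(** * Sums over symmetric windows and dominated convergence *)

(** Listing i and -i - 1 side by side turns two-sided sums into sums over [nat], at the price of the
    asymmetric range -K <= m < K. *)
Definition window K : seq int := map Posz (iota 0 K) ++ map Negz (iota 0 K).

Lemma mem_window K (m : int) : (m \in window K) = (- K%:Z <= m < K%:Z).
Proof.
rewrite mem_cat; apply/orP/idP; first by move=> [] H;
  case/mapP: H => i; rewrite mem_iota ?NegzE => Hi ->; lia.
case: m => i Hi; [left | right]; apply: map_f; rewrite mem_iota; lia.
Qed.

Lemma window_uniq K : uniq (window K).
Proof.
rewrite cat_uniq !map_inj_uniq ?iota_uniq /= ?andbT.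
- by apply/hasPn => _ /mapP[i _ ->]; apply/negP => /mapP[].
- by move=> i j [].
- by move=> i j [].
Qed.

Lemma big_window (V : nmodType) K (f : int -> V) :
  \sum_(m <- window K) f m = \sum_(0 <= i < K) (f (Posz i) + f (Negz i)).
Proof. by rewrite big_cat !big_map big_split /index_iota subn0. Qed.

Lemma big_window_pred1 (V : nmodType) K (a : int) (c : V) : a \in window K ->
  \sum_(m <- window K) (if m == a then c else 0) = c.
Proof.
move=> aK; rewrite (bigD1_seq a) ?window_uniq //= eqxx big1 ?addr0 //.
by move=> i /negPf ->.
Qed.

Lemma big_window2_pred1 (V : nmodType) K (a b : int) (c : V) :
  a \in window K -> b \in window K ->
  \sum_(i <- window K) \sum_(j <- window K)
     (if (i == a) && (j == b) then c else 0) = c.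
Proof.
move=> aK bK; rewrite -[RHS](big_window_pred1 c aK); apply: eq_bigr => i _.
have [_|_] := eqVneq i a; first exact: big_window_pred1.
by rewrite big1.
Qed.

(* A pair (m, n) with m + n even is (i + j, i - j); with m + n odd it is
   (i + j, i - j + 1). *)
Lemma big_window_parity (V : nmodType) K (f : int -> int -> V) :
  (forall m n, f m n <> 0 -> (`|m| < K)%N /\ (`|n| < K)%N) ->
  \sum_(m <- window K) \sum_(n <- window K) f m n =
  \sum_(i <- window K) \sum_(j <- window K) f (i + j) (i - j) +
  \sum_(i <- window K) \sum_(j <- window K) f (i + j) (i - j + 1).
Proof.
move=> f_supp.
(* Each term is spread over all pairs (m, n) by an indicator, so that both reindexed sums are
   compared with the original one pair at a time. *)
have expand (g : int -> int -> int) :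
    \sum_(i <- window K) \sum_(j <- window K) f (i + j) (g i j) =
    \sum_(m <- window K) \sum_(n <- window K) \sum_(i <- window K)
      \sum_(j <- window K)
        (if (m == i + j) && (n == g i j) then f m n else 0).
  have swap (h : int -> int -> int -> int -> V) :
      \sum_(m <- window K) \sum_(n <- window K) \sum_(i <- window K)
        \sum_(j <- window K) h i j m n =
      \sum_(i <- window K) \sum_(j <- window K) \sum_(m <- window K)
        \sum_(n <- window K) h i j m n.
    under eq_bigr do rewrite exchange_big /=.
    rewrite exchange_big /=; apply: eq_bigr => i _.
    under eq_bigr do rewrite exchange_big /=.
    by rewrite exchange_big.
  rewrite swap; apply: eq_bigr => i _; apply: eq_bigr => j _.
  have [f0|f0] := pselect (f (i + j) (g i j) = 0).
    rewrite f0 big1 // => m _; rewrite big1 // => n _.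
    by case: ifP => // /andP[/eqP -> /eqP ->].
  have [Hm Hn] := f_supp _ _ f0.
  rewrite -[LHS](@big_window2_pred1 _ K (i + j) (g i j)) ?mem_window; [|lia..].
  apply: eq_bigr => m _; apply: eq_bigr => n _.
  by case: ifP => // /andP[/eqP -> /eqP ->].
rewrite (expand (fun i j => i - j)) (expand (fun i j => i - j + 1)).
rewrite -big_split; apply: eq_bigr => m _; rewrite -big_split.
apply: eq_bigr => n _ /=.
have [f0|f0] := pselect (f m n = 0).
  rewrite f0 big1 ?add0r => [|i _]; last by rewrite big1 // => j _; case: ifP.
  by rewrite big1 // => i _; rewrite big1 // => j _; case: ifP.
have [Hm Hn] := f_supp _ _ f0.
(* [d] is half of m - n, rounded up; it is the index j in both parity classes. *)
have [d [] Hd] : exists d : int, m - n = 2 * d - 1 \/ m - n = 2 * d.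
  exists ((m - n + 1) %/ 2)%Z; have := divz_eq (m - n + 1) 2.
  have := modz_ge0 (m - n + 1) (isT : 2 != 0 :> int).
  have := ltz_pmod (m - n + 1) (isT : 0 < 2 :> int); lia.
  rewrite [X in X + _]big1 => [|i _]; last first.
    rewrite big1 // => j _; case: ifP => // /andP[/eqP H1 /eqP H2]; lia.
  rewrite add0r -[LHS](@big_window2_pred1 _ K (n + d - 1) d) ?mem_window; [|lia..].
  apply: eq_bigr => i _; apply: eq_bigr => j _; congr (if _ then _ else _).
  by apply/andP/andP => -[/eqP H1 /eqP H2]; split; apply/eqP; lia.
rewrite [X in _ + X]big1 => [|i _]; last first.
  rewrite big1 // => j _; case: ifP => // /andP[/eqP H1 /eqP H2]; lia.
rewrite addr0 -[LHS](@big_window2_pred1 _ K (n + d) d) ?mem_window; [|lia..].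
apply: eq_bigr => i _; apply: eq_bigr => j _; congr (if _ then _ else _).
by apply/andP/andP => -[/eqP H1 /eqP H2]; split; apply/eqP; lia.
Qed.

Section Tannery.
Context {R : realType}.
Implicit Types (M V e : R).

(** The tail of the series of [v] is small uniformly in [n] because [c] is bounded by [M]; the head
    is a finite sum of null sequences. *)
Lemma tannery_nat (v : nat -> R) (c : nat -> nat -> R) V M :
  (forall k, 0 <= v k) -> (forall n, \sum_(0 <= k < n) v k <= V) ->
  (forall n k, 0 <= c n k <= M) -> (forall k, c n k @[n --> \oo] --> 0) ->
  \sum_(0 <= k < n) v k * c n k @[n --> \oo] --> 0.
Proof.
move=> v0 vV cM c0.
have M0 : 0 <= M by have /andP[] := cM 0%N 0%N; exact: le_trans.
have M1 : 0 < M + 1 by rewrite ltr_wpDl.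
have ndv : nondecreasing_seq (series v).
  by apply: (nondecreasing_series (P := xpredT)) => n _ _; exact: v0.
have sv : cvgn (series v).
  by apply: nondecreasing_is_cvgn => //; exists V => _ [n _ <-]; exact: vV.
apply/cvgrPdist_lt => e e0.
have e20 : 0 < e / 2 / (M + 1) by rewrite !divr_gt0.
have /cvgrPdist_lt/(_ _ e20)[K _ HK] := sv.
have tail n : (K <= n)%N -> \sum_(K <= k < n) v k < e / 2 / (M + 1).
  move=> Kn; have := HK K (leqnn K) => /=; apply: le_lt_trans.
  rewrite ger0_norm ?subr_ge0; last exact: nondecreasing_cvgn_le.
  rewrite lerBrDl /series /= -big_cat_nat //=.
  exact: (nondecreasing_cvgn_le ndv sv n).
have head : \sum_(0 <= k < K) v k * c n k @[n --> \oo] --> 0.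
  elim: (K) => [|k IH].
    have -> : (fun n => \sum_(0 <= j < 0) v j * c n j) = fun=> 0.
      by apply/funext => n; rewrite big_nil.
    exact: cvg_cst.
  have -> : (fun n => \sum_(0 <= j < k.+1) v j * c n j) =
            fun n => \sum_(0 <= j < k) v j * c n j + v k * c n k.
    by apply/funext => n; rewrite big_nat_recr.
  rewrite -[X in _ --> X](addr0 0); apply: cvgD => //.
  rewrite -[X in _ --> X](mulr0 (v k)); apply: cvgM; last exact: c0.
  exact: cvg_cst.
have e2 : 0 < e / 2 by rewrite divr_gt0.
move/cvgrPdist_lt: head => /(_ _ e2) head.
near=> n.
have Kn : (K <= n)%N by near: n; exact: nbhs_infty_ge.
have Hh : `|0 - \sum_(0 <= k < K) v k * c n k| < e / 2 by near: n.
rewrite (big_cat_nat _ Kn) //= opprD addrA.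
apply: le_lt_trans (ler_normB _ _) _; rewrite [e]splitr ltrD //.
rewrite ger0_norm; last first.
  by apply: sumr_ge0 => k _; rewrite mulr_ge0 //; have /andP[] := cM n k.
apply: (@le_lt_trans _ _ ((\sum_(K <= k < n) v k) * (M + 1))).
  rewrite mulr_suml; apply: ler_sum => k _; rewrite ler_wpM2l //.
  by have /andP[_ H] := cM n k; rewrite (le_trans H) // lerDl.
by rewrite -ltr_pdivlMr // tail.
Unshelve. all: by end_near.
Qed.

(** For nonnegative numbers, w c + w' c' <= (w + w') (c + c'); pairing k with -k - 1 reduces the
    claim to the one-sided case, with bound 2 M. *)
Lemma tannery (w : int -> R) (c : nat -> int -> R) V M :
  (forall k, 0 <= w k) -> (forall n, \sum_(k <- window n) w k <= V) ->
  (forall n k, 0 <= c n k <= M) -> (forall k, c n k @[n --> \oo] --> 0) ->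
  \sum_(k <- window n) w k * c n k @[n --> \oo] --> 0.
Proof.
move=> w0 wV cM c0.
pose v k := w (Posz k) + w (Negz k); pose d n k := c n (Posz k) + c n (Negz k).
have v0 k : 0 <= v k by rewrite addr_ge0.
have d_bound n k : 0 <= d n k <= M + M.
  have /andP[? ?] := cM n (Posz k); have /andP[? ?] := cM n (Negz k).
  by rewrite addr_ge0 //= lerD.
have := @tannery_nat v d V (M + M) v0 _ d_bound.
have vV n : \sum_(0 <= k < n) v k <= V by rewrite -big_window.
have d0 k : d n k @[n --> \oo] --> 0.
  by rewrite -[X in _ --> X](addr0 0); apply: cvgD; exact: c0.
move=> /(_ vV d0) H.
apply: (squeeze_cvgr _ (cvg_cst 0) H); apply: nearW => n; apply/andP; split.
  by apply: sumr_ge0 => k _; rewrite mulr_ge0 //; have /andP[] := cM n k.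
rewrite big_window; apply: ler_sum => k _; rewrite /v /d.
have /andP[? _] := cM n (Posz k); have /andP[? _] := cM n (Negz k).
have ? := w0 (Posz k); have ? := w0 (Negz k); nra.
Qed.

Lemma tannery2 (w1 w2 : int -> R) (c : nat -> int -> int -> R) V1 V2 M :
  (forall k, 0 <= w1 k) -> (forall n, \sum_(k <- window n) w1 k <= V1) ->
  (forall k, 0 <= w2 k) -> (forall n, \sum_(k <- window n) w2 k <= V2) ->
  (forall n i j, 0 <= c n i j <= M) ->
  (forall i j, c n i j @[n --> \oo] --> 0) ->
  \sum_(i <- window n) \sum_(j <- window n) w1 i * w2 j * c n i j
    @[n --> \oo] --> 0.
Proof.
move=> w10 w1V w20 w2V cM c0.
pose s n i := \sum_(j <- window n) w2 j * c n i j.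
have -> : (fun n => \sum_(i <- window n) \sum_(j <- window n)
    w1 i * w2 j * c n i j) = fun n => \sum_(i <- window n) w1 i * s n i.
  apply/funext => n; apply: eq_bigr => i _; rewrite /s mulr_sumr.
  by apply: eq_bigr => j _; rewrite mulrA.
apply: (@tannery _ _ V1 (V2 * M)) => // [n i|i]; last exact: (@tannery _ _ V2 M).
rewrite sumr_ge0 /= => [|j _]; last first.
  by rewrite mulr_ge0 //; have /andP[] := cM n i j.
have M0 : 0 <= M by have /andP[] := cM 0%N 0 0; exact: le_trans.
apply: le_trans (ler_wpM2r M0 (w2V n)); rewrite mulr_suml; apply: ler_sum => j _.
by rewrite ler_wpM2l //; have /andP[] := cM n i j.
Qed.

End Tannery.

(** * The finite Jacobi triple product *)

(** The Gaussian binomial coefficient, defined by its Pascal rule and hence without division. *)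
Fixpoint qbinom (A : pzRingType) (p : A) n k : A :=
  match n, k with
  | _, 0 => 1
  | 0, _.+1 => 0
  | n'.+1, k'.+1 => p ^+ k * qbinom p n' k + qbinom p n' k'
  end.

Lemma qbinomn0 (A : pzRingType) (p : A) n : qbinom p n 0 = 1.
Proof. by case: n. Qed.

Lemma qbinom_small (A : pzRingType) (p : A) n k : (n < k)%N -> qbinom p n k = 0.
Proof.
elim: n k => [|n IH] [|k] //= nk.
by rewrite !IH ?mulr0 ?addr0 // ltnW.
Qed.

(** Trades p^(k(k-1)/2) for an integer power of a square root of p, a form that extends to negative
    indices. *)
Lemma expr_bin2 (F : fieldType) (a : F) k : a != 0 ->
  (a ^+ 2) ^+ 'C(k, 2) = a ^ (k%:Z * (k%:Z - 1)).
Proof.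
move=> a0; elim: k => [|k IH]; first by rewrite bin0n mul0r.
rewrite binS bin1 exprD IH -exprM exprnP -expfzDr //.
by congr (a ^ _); rewrite PoszM; ring.
Qed.

Section FiniteJacobi.
Context {R : realType}.
Local Notation C := (Cplx R).
Variable p : C.
Hypothesis p_bound : 0 < nc p < 1.
Implicit Types x y z : C.

(** The q-binomial theorem: with (z; p)_(n+1) = (1 - z) (pz; p)_n, comparing coefficients gives the
    Pascal rule of [qbinom]. *)
Lemma eulerN_qbinom z n : eulerN p z n =
  \sum_(0 <= k < n.+1) qbinom p n k * (-1) ^+ k * p ^+ 'C(k, 2) * z ^+ k.
Proof.
elim: n z => [|n IH] z.
  by rewrite /eulerN big_nil big_nat1 /= !expr0 !mulr1.
pose t n k z := qbinom p n k * (-1) ^+ k * p ^+ 'C(k, 2) * z ^+ k.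
rewrite eulerN_recl IH -/(t n _ _).
rewrite (eq_bigr (fun k => t n k (p * z))) // [RHS]big_nat_recl //.
have -> : \sum_(0 <= k < n.+1) qbinom p n.+1 k.+1 * (-1) ^+ k.+1 *
    p ^+ 'C(k.+1, 2) * z ^+ k.+1 =
    \sum_(0 <= k < n.+1) (t n k.+1 (p * z) - z * t n k (p * z)).
  apply: eq_bigr => k _; rewrite /t /= binS bin1 !exprD !exprMn !exprS; ring.
rewrite sumrB -mulr_sumr.
have -> : \sum_(0 <= k < n.+1) t n k.+1 (p * z) =
    \sum_(0 <= k < n.+1) t n k (p * z) - t n 0%N (p * z).
  have <- : \sum_(0 <= k < n.+2) t n k (p * z) =
      \sum_(0 <= k < n.+1) t n k (p * z).
    by rewrite big_nat_recr //= {2}/t qbinom_small // !mul0r addr0.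
  by rewrite [in RHS]big_nat_recl // addrC addKr.
by rewrite /t !qbinomn0 (_ : 'C(0, 2) = 0%N) // !expr0; ring.
Qed.

Local Notation G := (eulerN p p).

Lemma eulerN_pp_neq0 n : G n != 0.
Proof.
rewrite /eulerN prodf_seq_neq0; apply/allP => l _ /=.
rewrite -exprS subr_eq0 eq_sym; apply/eqP => /(congr1 nc).
rewrite ncX nc1 => /eqP; apply/negP; rewrite lt_eqF //.
have /andP[/ltW r0 r1] := p_bound; exact: exprn_ilt1.
Qed.

Lemma euler_pp_neq0 : euler p p != 0.
Proof.
apply: euler_neq0 => // l; rewrite -exprS; apply/eqP => /(congr1 nc).
rewrite ncX nc1 => /eqP; apply/negP; rewrite lt_eqF //.
have /andP[/ltW r0 r1] := p_bound; exact: exprn_ilt1.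
Qed.

Lemma qbinomE n k : (k <= n)%N -> qbinom p n k = G n / (G k * G (n - k)).
Proof.
move=> kn; apply: (mulIf (mulf_neq0 (eulerN_pp_neq0 k) (eulerN_pp_neq0 (n - k)))).
rewrite divfK ?mulf_neq0 ?eulerN_pp_neq0 //.
have G0 : G 0%N = 1 by rewrite /eulerN big_nil.
elim: n k kn => [|n IH] [|k] // kn; rewrite ?qbinomn0 ?subn0 ?G0 ?mul1r //=.
rewrite subSS !eulerN_recr -!exprS.
move: kn; rewrite ltnS leq_eqVlt => /orP[/eqP ->|kn].
  have := IH n (leqnn n); rewrite subnn G0 (@qbinom_small _ _ n n.+1) // => h.
  by rewrite -[in RHS]h; ring.
have IH2 := IH k.+1 kn; have IH1 := IH k (ltnW kn).
have e : (n - k)%N = (n - k.+1).+1 by rewrite subnSK.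
move: IH1 IH2; rewrite e !eulerN_recr -!exprS => IH1 IH2.
have -> : p ^+ n.+1 = p ^+ k.+1 * p ^+ (n - k.+1).+1.
  by rewrite -exprD; congr (p ^+ _); lia.
move: (p ^+ (n - k.+1).+1) IH1 IH2 => w IH1 IH2.
rewrite mulrBr mulr1 -{1}IH1.
(* With w = p^(n-k), the splitting 1 - p^(k+1) w = p^(k+1) (1 - w) + (1 - p^(k+1)) matches the two
   terms of the Pascal rule. *)
transitivity (p ^+ k.+1 * (1 - w) *
    (qbinom p n k.+1 * (G k * (1 - p ^+ k.+1) * G (n - k.+1))) +
  (1 - p ^+ k.+1) * (qbinom p n k * (G k * (G (n - k.+1) * (1 - w))))).
  by ring.
by rewrite IH2 IH1; ring.
Qed.

(** The Gaussian binomial coefficient of 2N over N + m, recentred so that it is even in [m]. For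
    fixed [m] it tends to 1/(p; p)_oo. *)
Definition jacobi_coef N (m : int) : C :=
  if (`|m| <= N)%N then G (N + N) / (G (N + `|m|) * G (N - `|m|)) else 0.

Lemma jacobi_coef_cvg m :
  jacobi_coef N m @[N --> \oo] --> (euler p p)^-1.
Proof.
have G_cvg k (f : nat -> nat) : (forall N, N <= f N + k)%N ->
    G (f N) @[N --> \oo] --> euler p p.
  move=> fk; apply: (cvg_comp f (eulerN p p)); last exact: eulerN_cvg.
  by move=> A [n _ An]; exists (n + k)%N => // m' /= nm; apply: An => /=;
    have := fk m'; lia.
have k0 := euler_pp_neq0.
have : G (N + N) / (G (N + `|m|) * G (N - `|m|)) @[N --> \oo] -->
    euler p p / (euler p p * euler p p).
  apply: cvgM; first by apply: (G_cvg 0%N (fun N => N + N)%N) => N; lia.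
  apply: cvgV; first by rewrite mulf_neq0.
  apply: cvgM; first by apply: (G_cvg 0%N (fun N => N + `|m|)%N) => N; lia.
  by apply: (G_cvg `|m|%N (fun N => N - `|m|)%N) => N; lia.
have -> : euler p p / (euler p p * euler p p) = (euler p p)^-1 by field.
move=> /cvgCP H; apply/cvgCP => e /H; apply: (filterS2 _ _ (nbhs_infty_ge `|m|%N)).
by move=> N /= mN; rewrite /jacobi_coef mN.
Qed.

Lemma cvg_nc_bounded (u : nat -> C) (l : C) : u @ \oo --> l ->
  exists M : R, forall n, nc (u n) <= M.
Proof.
move=> /cvgCP/(_ 1 ltr01)[N _ HN].
exists (nc l + 1 + \sum_(0 <= k < N) nc (u k)) => n.
have s0 m : 0 <= \sum_(0 <= k < m) nc (u k).
  by apply: sumr_ge0 => k _; exact: nc_ge0.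
have [nN|Nn] := ltnP n N.
  rewrite (bigD1_seq n) ?iota_uniq ?mem_index_iota //= addrCA lerDl.
  rewrite addr_ge0 ?addr_ge0 ?nc_ge0 //.
  by apply: sumr_ge0 => k _; exact: nc_ge0.
apply: (@le_trans _ _ (nc l + 1)); last by rewrite lerDl.
rewrite -[u n](subKr l); apply: le_trans (ler_ncB _ _) _.
by rewrite lerD2l ltW // HN.
Qed.

(** Both (p; p)_N and its inverse converge, the limit being nonzero, so both are bounded. The
    uniformity in [N] and [m] is what dominated convergence needs. *)
Lemma jacobi_coef_bounded : exists M : R, forall N m, nc (jacobi_coef N m) <= M.
Proof.
have [M1 H1] := cvg_nc_bounded (@eulerN_cvg R p p_bound p).
have [M2 H2] := cvg_nc_bounded
  (cvgV euler_pp_neq0 (@eulerN_cvg R p p_bound p)).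
have M10 : 0 <= M1 by apply: le_trans (H1 0%N); exact: nc_ge0.
have M20 : 0 <= M2 by apply: le_trans (H2 0%N); exact: nc_ge0.
exists (M1 * (M2 * M2)) => N m; rewrite /jacobi_coef; case: ifP => _.
  rewrite ncM invfM ncM; apply: ler_pM; rewrite ?mulr_ge0 ?nc_ge0 //.
  by apply: ler_pM; rewrite ?nc_ge0 //; exact: H2.
by rewrite nc0 !mulr_ge0.
Qed.

Variable r : C.
Hypothesis r2 : r ^+ 2 = p.

Let r0 : r != 0.
Proof. by apply: contraTneq (p_neq0 p_bound) => r0; rewrite -r2 r0 expr0n eqxx. Qed.

Definition jacobi_term N x (m : int) : C :=
  (-1) ^+ `|m| * r ^ (m * (m - 1)) * jacobi_coef N m * x ^ m.

(** Each factor is reversed by 1 - x p^(-j) = -x p^(-j) (1 - p^j / x), for 1 <= j <= N; the powers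
    of p collect to r^(-N(N+1)). *)
Lemma eulerN_shift x N : x != 0 -> eulerN p (x / p ^+ N) N =
  (- x) ^+ N / r ^ (N%:Z * (N%:Z + 1)) * eulerN p (p / x) N.
Proof.
move=> x0; have p0 := p_neq0 p_bound.
elim: N => [|N IH]; first by rewrite /eulerN !big_nil mul0r expr0 expr0z divr1 mulr1.
rewrite eulerN_recl.
have -> : p * (x / p ^+ N.+1) = x / p ^+ N.
  by rewrite exprS; field; rewrite expf_neq0 // p0.
rewrite IH eulerN_recr.
have -> : r ^ (N.+1%:Z * (N.+1%:Z + 1)) = r ^ (N%:Z * (N%:Z + 1)) * p ^+ N.+1.
  rewrite -r2 -exprM exprnP -expfzDr //; congr (r ^ _).
  by rewrite PoszM; lia.
rewrite (exprS (- x)) (exprS p).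
by field; rewrite x0 p0 expfz_neq0 // expf_neq0.
Qed.

Lemma eulerN_cat z M N : eulerN p z (M + N) = eulerN p z M * eulerN p (p ^+ M * z) N.
Proof.
elim: M z => [|M IH] z; first by rewrite /eulerN big_nil !mul1r.
by rewrite addSn !eulerN_recl IH exprSr -!mulrA.
Qed.

(** Up to the factor from [eulerN_shift], the left side is the single product (x p^(-N); p)_(2N).
    The q-binomial theorem expands it, and k = N + m centres the sum. *)
Lemma finite_jacobi x N : x != 0 ->
  eulerN p x N * eulerN p (p / x) N =
  \sum_(m <- window N.+1) jacobi_term N x m.
Proof.
move=> x0; have p0 := p_neq0 p_bound.
have pN0 : p ^+ N != 0 by rewrite expf_neq0.
have rz0 m : r ^ m != 0 by rewrite expfz_neq0.
have xN0 : (- x) ^+ N != 0 by rewrite expf_neq0 // oppr_eq0.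
have -> : eulerN p x N * eulerN p (p / x) N =
    r ^ (N%:Z * (N%:Z + 1)) / (- x) ^+ N * eulerN p (x / p ^+ N) (N + N).
  rewrite eulerN_cat eulerN_shift // mulrC (mulrC (p ^+ N)) divfK //.
  by field; rewrite rz0 xN0.
rewrite eulerN_qbinom big_window.
pose h k := r ^ (N%:Z * (N%:Z + 1)) / (- x) ^+ N *
  (qbinom p (N + N) k * (-1) ^+ k * p ^+ 'C(k, 2) * (x / p ^+ N) ^+ k).
have hE k (m : int) : k%:Z = N%:Z + m -> (k <= N + N)%N -> h k = jacobi_term N x m.
  move=> km kN; rewrite /h /jacobi_term.
  have mN : (`|m| <= N)%N by lia.
  have -> : qbinom p (N + N) k = jacobi_coef N m.
    rewrite qbinomE // /jacobi_coef mN; congr (_ / _).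
    have [m0|m0] := leP 0 m.
      by congr (G _ * G _); lia.
    by rewrite mulrC; congr (G _ * G _); lia.
  have -> : p ^+ 'C(k, 2) = r ^ (k%:Z * (k%:Z - 1)) by rewrite -r2 expr_bin2.
  have -> : (-1) ^+ `|m| = (-1) ^+ k * (-1) ^+ N :> C.
    rewrite -exprD -signr_odd -[RHS]signr_odd; congr (_ ^+ _).
    by congr nat_of_bool; lia.
  have -> : x ^ m = x ^+ k / x ^+ N.
    have -> : m = k%:Z - N%:Z by lia.
    by rewrite expfzDr // exprnP exprnN.
  have -> : r ^ (m * (m - 1)) = r ^ (N%:Z * (N%:Z + 1)) *
      r ^ (k%:Z * (k%:Z - 1)) / (p ^+ N) ^+ k.
    rewrite -r2 -!exprM exprnN -!expfzDr //; congr (r ^ _).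
    have -> : m = k%:Z - N%:Z by lia.
    by rewrite !PoszM; ring.
  rewrite exprMn exprVn (exprNn x).
  by rewrite invfM invr_sign; ring.
rewrite big_distrr /= -/(h _).
rewrite (eq_bigr h) // (@big_cat_nat _ _ _ N) //=; last by lia.
rewrite big_split /= addrC; congr (_ + _).
  have -> : (N + N).+1 = (N.+1 + N)%N by lia.
  rewrite -{1}[N]add0n big_addn addnK; apply: eq_big_nat => k /andP[_ kN].
  by apply: hE; lia.
(* The window also contains m = -N - 1, where the coefficient is 0. *)
rewrite [RHS]big_nat_recr //= [X in _ + X](_ : _ = 0); last first.
  by rewrite /jacobi_term /jacobi_coef /= ltnn mulr0 mul0r.
rewrite addr0 big_nat_rev; apply: eq_big_nat => k /andP[_ kN].
by apply: hE; rewrite ?NegzE; lia.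
Qed.

End FiniteJacobi.

(** * Weierstrass' three-term relation *)

(** Expanding the product of the 1 + t s^i and choosing t s^i for i < k yields s^(k(k-1)/2) t^k; all
    other terms are nonnegative. *)
Lemma gauss_sum_le (R : realType) (s t : R) n : 0 < s < 1 -> 0 <= t ->
  \sum_(0 <= k < n) s ^+ 'C(k, 2) * t ^+ k <= expR (t / (1 - s)).
Proof.
move=> s01 t0; have /andP[/ltW s0 _] := s01.
apply: le_trans (prod_geometric_le_expR n s01 t0).
elim: n t t0 => [|n IH] t t0; first by rewrite !big_nil ler01.
rewrite !big_nat_recl //= (_ : 'C(0, 2) = 0%N) // !expr0 !mulr1.
have st0 : 0 <= s * t by rewrite mulr_ge0.
have -> : \prod_(0 <= i < n) (1 + t * s ^+ i.+1) =
          \prod_(0 <= i < n) (1 + s * t * s ^+ i).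
  by apply: eq_bigr => i _; rewrite exprS mulrA (mulrC t).
have -> : \sum_(0 <= i < n) s ^+ 'C(i.+1, 2) * t ^+ i.+1 =
          t * \sum_(0 <= i < n) s ^+ 'C(i, 2) * (s * t) ^+ i.
  rewrite mulr_sumr; apply: eq_bigr => i _.
  by rewrite binS bin1 exprD exprMn exprS; ring.
have H1 : 1 <= \prod_(0 <= i < n) (1 + s * t * s ^+ i).
  elim/big_ind: _ => // [a b|i _]; first exact: mulr_ege1.
  by rewrite lerDl mulr_ge0 // exprn_ge0.
by have := IH _ st0; nra.
Qed.

Lemma gauss_window_bounded (R : realType) (w : int -> R) (s c1 t1 c2 t2 : R) :
  0 < s < 1 -> 0 <= c1 -> 0 <= t1 -> 0 <= c2 -> 0 <= t2 ->
  (forall k : nat, w (Posz k) = c1 * (s ^+ 'C(k, 2) * t1 ^+ k)) ->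
  (forall k : nat, w (Negz k) = c2 * (s ^+ 'C(k, 2) * t2 ^+ k)) ->
  exists V, forall n, \sum_(k <- window n) w k <= V.
Proof.
move=> s01 c10 t10 c20 t20 w1 w2.
exists (c1 * expR (t1 / (1 - s)) + c2 * expR (t2 / (1 - s))) => n.
rewrite big_window big_split /=.
rewrite (eq_bigr _ (fun k _ => w1 k)) -mulr_sumr.
rewrite [X in _ + X](eq_bigr _ (fun k _ => w2 k)) -mulr_sumr.
by apply: lerD; apply: ler_wpM2l => //; exact: gauss_sum_le.
Qed.

Lemma exprz_expn (F : fieldType) (a : F) (m : int) (k : nat) :
  (a ^ m) ^+ k = a ^ (m * k%:Z).
Proof. by rewrite exprnP exprz_exp. Qed.

Section Weierstrass.
Context {R : realType}.
Local Notation C := (Cplx R).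
Variable p : C.
Hypothesis p_bound : 0 < nc p < 1.
Implicit Types x y u v : C.

Variable r : C.
Hypothesis r2 : r ^+ 2 = p.

Let r_neq0 : r != 0.
Proof. by apply: contraTneq (p_neq0 p_bound) => r0; rewrite -r2 r0 expr0n eqxx. Qed.

Let nr_neq0 : nc r != 0. Proof. by rewrite nc_eq0. Qed.

Let s_bound : 0 < nc r ^+ 2 ^+ 2 < 1.
Proof.
have /andP[h0 h1] := p_bound; rewrite -[nc r ^+ 2]ncX r2 exprn_gt0 //=.
by rewrite exprn_ilt1 // ltW.
Qed.

(** [even_term] and [odd_term] are the terms of the series f and g; they are attached to x in the
    classes m + n even and m + n odd respectively. *)
Let even_term x (i : int) : C := r ^ (2 * i * (i - 1)) * x ^ (2 * i).
Let odd_term x (i : int) : C := r ^ (2 * i * i) * x ^ (2 * i).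

Let nc_term x (a b : int) :
  nc (r ^ a * x ^ b) = nc r ^ a * nc x ^ b.
Proof. by rewrite ncM !nc_exprz. Qed.

Let nc_gauss (k : nat) :
  nc r ^+ 2 ^+ 2 ^+ 'C(k, 2) = nc r ^ (2 * (k%:Z * (k%:Z - 1))).
Proof. by rewrite expr_bin2 ?expf_neq0 // exprnP exprz_exp. Qed.

Let regroup (a b c d e : R) : a * b * (c * (d * e)) = (a * c * d) * (b * e).
Proof. ring. Qed.

Lemma even_term_bounded x : x != 0 ->
  exists V, forall n, \sum_(i <- window n) nc (even_term x i) <= V.
Proof.
move=> x0; have X0 : nc x != 0 by rewrite nc_eq0.
have c_ge0 a b : 0 <= nc r ^ a * nc x ^ b by rewrite mulr_ge0 // exprz_ge0 // nc_ge0.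
(* The base is |p|^2 = |r|^4. For i = -k - 1 the exponent 2i(i-1) equals 2k(k-1) + 8k + 4, whence
   the powers 8 and 4 of |r|. *)
apply: (@gauss_window_bounded _ _ (nc r ^+ 2 ^+ 2) 1 (nc r ^ 0 * nc x ^ 2)
  (nc r ^ 4 * nc x ^ (-2)) (nc r ^ 8 * nc x ^ (-2)));
  [exact: s_bound | exact: ler01 | exact: c_ge0 | exact: c_ge0 | exact: c_ge0 | |].
  move=> k; rewrite mul1r nc_gauss exprMn !exprz_expn nc_term [RHS]mulrA -expfzDr //.
  by congr (_ ^ _ * _ ^ _); ring.
move=> k; rewrite nc_gauss exprMn !exprz_expn nc_term regroup -!expfzDr //.
by rewrite NegzE; congr (_ ^ _ * _ ^ _); lia.
Qed.

Lemma odd_term_bounded x : x != 0 ->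
  exists V, forall n, \sum_(i <- window n) nc (odd_term x i) <= V.
Proof.
move=> x0; have X0 : nc x != 0 by rewrite nc_eq0.
have c_ge0 a b : 0 <= nc r ^ a * nc x ^ b by rewrite mulr_ge0 // exprz_ge0 // nc_ge0.
(* Here 2i^2 is 2k(k-1) + 2k for i = k and 2k(k-1) + 6k + 2 for i = -k - 1. *)
apply: (@gauss_window_bounded _ _ (nc r ^+ 2 ^+ 2) 1 (nc r ^ 2 * nc x ^ 2)
  (nc r ^ 2 * nc x ^ (-2)) (nc r ^ 6 * nc x ^ (-2)));
  [exact: s_bound | exact: ler01 | exact: c_ge0 | exact: c_ge0 | exact: c_ge0 | |].
  move=> k; rewrite mul1r nc_gauss exprMn !exprz_expn nc_term [RHS]mulrA -expfzDr //.
  by congr (_ ^ _ * _ ^ _); ring.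
move=> k; rewrite nc_gauss exprMn !exprz_expn nc_term regroup -!expfzDr //.
by rewrite NegzE; congr (_ ^ _ * _ ^ _); lia.
Qed.

Let A x n : C := \sum_(i <- window n) even_term x i.
Let B x n : C := \sum_(i <- window n) odd_term x i.
Let c0 : C := (euler p p)^-1.

Lemma double_sum_cvg0 (f g : int -> C) (V1 V2 : R) (h : int -> int -> int) :
  (forall n, \sum_(i <- window n) nc (f i) <= V1) ->
  (forall n, \sum_(i <- window n) nc (g i) <= V2) ->
  \sum_(i <- window n.+1) \sum_(j <- window n.+1) f i * g j *
    (jacobi_coef p n (i + j) * jacobi_coef p n (h i j) - c0 ^+ 2)
    @[n --> \oo] --> (0 : C).
Proof.
move=> fV gV; have [M HM] := jacobi_coef_bounded p_bound.
(* The predecessor aligns the window n + 1 with coefficients of level n, whereas [tannery2] uses one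
   index for both. *)
pose e n i j := jacobi_coef p n.-1 (i + j) * jacobi_coef p n.-1 (h i j) - c0 ^+ 2.
have M0 : 0 <= M by apply: le_trans (HM 0%N 0); exact: nc_ge0.
have eM n i j : 0 <= nc (e n i j) <= M * M + nc c0 ^+ 2.
  rewrite nc_ge0 /=; apply: le_trans (ler_ncB _ _) _; rewrite ncX lerD2r ncM.
  by apply: ler_pM; rewrite ?nc_ge0.
have e0 i j : nc (e n i j) @[n --> \oo] --> 0.
  have H : jacobi_coef p n (i + j) * jacobi_coef p n (h i j) @[n --> \oo] -->
      c0 ^+ 2.
    by rewrite expr2; apply: cvgM; exact: jacobi_coef_cvg.
  rewrite -(cvg_shiftS (fun n => nc (e n i j))) /=.
  move/cvgCP: H => H; apply/cvgrPdist_lt => eps /H; apply: filterS => n.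
  by rewrite sub0r normrN ger0_norm ?nc_ge0 // nc_distC.
have := tannery2 (fun k => nc_ge0 (f k)) fV (fun k => nc_ge0 (g k)) gV eM e0.
rewrite -cvg_shiftS /= => /cvgrPdist_lt H.
apply/cvgCP => eps /H; apply: filterS => n; rewrite !sub0r normrN ncN.
apply: le_lt_trans; apply: le_trans (ler_norm _).
apply: le_trans (ler_nc_sum _ _ _) _; apply: ler_sum => i _.
apply: le_trans (ler_nc_sum _ _ _) _; apply: ler_sum => j _.
by rewrite !ncM.
Qed.

Let jacobi_term_mul N x y (m n : int) (k l s : int) : x != 0 -> y != 0 ->
  m * (m - 1) + n * (n - 1) = s -> m + n = k -> m - n = l ->
  jacobi_term p r N (x * y) m * jacobi_term p r N (x / y) n =
  (-1) ^+ `|l| * r ^ s * x ^ k * y ^ l * (jacobi_coef p N m * jacobi_coef p N n).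
Proof.
move=> x0 y0 <- <- <-; rewrite /jacobi_term !expfzMl exprz_inv.
have -> : (-1) ^+ `|m - n| = (-1) ^+ `|m| * (-1) ^+ `|n| :> C.
  rewrite -exprD -signr_odd -[RHS]signr_odd; congr (_ ^+ _).
  by congr nat_of_bool; lia.
rewrite !expfzDr //; move: (jacobi_coef p N m) (jacobi_coef p N n) => c d.
move: ((-1) ^+ `|m|) ((-1) ^+ `|n|) (r ^ _) (r ^ _) (x ^ m) (x ^ n) (y ^ m) (y ^ (- n)).
by move=> *; ring.
Qed.

(** The product of the expansions at x y and x / y carries x^(m+n) y^(m-n) and the sign of m - n.
    Hence the even class gives the first product and the odd class, with the extra factor -x/y, the
    second. *)
Lemma theta_product_cvg x y : x != 0 -> y != 0 ->
  c0 ^+ 2 * (A x n.+1 * B y n.+1 - x / y * (B x n.+1 * A y n.+1))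
    @[n --> \oo] --> theta p (x * y) * theta p (x / y).
Proof.
move=> x0 y0.
pose P z N : C := eulerN p z N * eulerN p (p / z) N.
have P_cvg : P (x * y) N * P (x / y) N @[N --> \oo] -->
    theta p (x * y) * theta p (x / y) by apply: cvgM; exact: theta_cvg.
have [V1 HV1] := even_term_bounded x0; have [V2 HV2] := odd_term_bounded x0.
have [V3 HV3] := even_term_bounded y0; have [V4 HV4] := odd_term_bounded y0.
have H1 := double_sum_cvg0 (fun i j => i - j) HV1 HV4.
have H2 := double_sum_cvg0 (fun i j => i - j + 1) HV2 HV3.
have xy0 : x * y != 0 by rewrite mulf_neq0.
have xVy0 : x / y != 0 by rewrite mulf_neq0 // invr_eq0.
have PP N : P (x * y) N * P (x / y) N =
    \sum_(i <- window N.+1) \sum_(j <- window N.+1) even_term x i * odd_term y j *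
      (jacobi_coef p N (i + j) * jacobi_coef p N (i - j)) -
    x / y * \sum_(i <- window N.+1) \sum_(j <- window N.+1)
      odd_term x i * even_term y j *
      (jacobi_coef p N (i + j) * jacobi_coef p N (i - j + 1)).
  rewrite /P !(finite_jacobi p_bound r2) // mulr_suml.
  under eq_bigr do rewrite mulr_sumr.
  rewrite (@big_window_parity _ N.+1
    (fun m n => jacobi_term p r N (x * y) m * jacobi_term p r N (x / y) n)).
    congr (_ + _).
      apply: eq_bigr => i _; apply: eq_bigr => j _.
      rewrite (@jacobi_term_mul N x y (i + j) (i - j) (2 * i) (2 * j)
        (2 * i * (i - 1) + 2 * j * j)) //; [|ring|ring|ring].
      rewrite -signr_odd (_ : odd _ = false) ?mul1r; last lia.
      by rewrite expfzDr // /even_term /odd_term; ring.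
    rewrite mulr_sumr -sumrN; apply: eq_bigr => i _.
    rewrite mulr_sumr -sumrN; apply: eq_bigr => j _.
    rewrite (@jacobi_term_mul N x y (i + j) (i - j + 1) (2 * i + 1) (2 * j + -1)
      (2 * i * i + 2 * j * (j - 1))) //; [|ring|ring|ring].
    rewrite -signr_odd (_ : odd _ = true); last lia.
    by rewrite !expfzDr // expr1z exprN1 /even_term /odd_term; ring.
  move=> m n; rewrite /jacobi_term /jacobi_coef.
  case: ifP => Hm; last by rewrite mulr0 mul0r mul0r.
  by case: ifP => Hn; last by rewrite mulr0 mul0r mulr0.
have AB (f g : int -> C) N :
    (\sum_(i <- window N) f i) * (\sum_(j <- window N) g j) =
    \sum_(i <- window N) \sum_(j <- window N) f i * g j.
  by rewrite mulr_suml; apply: eq_bigr => i _; rewrite mulr_sumr.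
(* The truncated expression is the exact finite product minus the errors made in replacing
   coefficient products by their limit [c0 ^+ 2]. *)
have -> : (fun n => c0 ^+ 2 * (A x n.+1 * B y n.+1 - x / y * (B x n.+1 * A y n.+1)))
  = fun N => P (x * y) N * P (x / y) N -
  (\sum_(i <- window N.+1) \sum_(j <- window N.+1) even_term x i * odd_term y j *
     (jacobi_coef p N (i + j) * jacobi_coef p N (i - j) - c0 ^+ 2) -
   x / y * \sum_(i <- window N.+1) \sum_(j <- window N.+1)
     odd_term x i * even_term y j *
     (jacobi_coef p N (i + j) * jacobi_coef p N (i - j + 1) - c0 ^+ 2)).
  apply/funext => N; rewrite PP.
  have split_sum (f : int -> int -> C) (g : int -> int -> C) :
      \sum_(i <- window N.+1) \sum_(j <- window N.+1) f i j * (g i j - c0 ^+ 2) =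
      \sum_(i <- window N.+1) \sum_(j <- window N.+1) f i j * g i j -
      c0 ^+ 2 * \sum_(i <- window N.+1) \sum_(j <- window N.+1) f i j.
    rewrite mulr_sumr -sumrB; apply: eq_bigr => i _.
    by rewrite mulr_sumr -sumrB; apply: eq_bigr => j _; ring.
  by rewrite !split_sum /A /B !AB; ring.
rewrite -[X in _ --> X]subr0; apply: cvgB; first exact: P_cvg.
rewrite -[X in _ --> X](subr0 0); apply: cvgB; first exact: H1.
rewrite -[X in _ --> X](mulr0 (x / y)); by apply: cvgM; [exact: cvg_cst | exact: H2].
Qed.

(** Each bracket is, up to division by its second point, a 2 x 2 minor of vectors such as (a, x b).
    This is the Pluecker relation of four such vectors; u/y compensates for the different
    divisors. *)
Let plucker (c a a1 a2 a3 b b1 b2 b3 x y u v : C) : y != 0 -> u != 0 -> v != 0 ->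
  c * (a * b1 - x / y * (b * a1)) * (c * (a2 * b3 - u / v * (b2 * a3))) -
  c * (a * b3 - x / v * (b * a3)) * (c * (a2 * b1 - u / y * (b2 * a1))) =
  u / y * (c * (a1 * b3 - y / v * (b1 * a3)) * (c * (a * b2 - x / u * (b * a2)))).
Proof. by move=> y0 u0 v0; field; rewrite y0 u0 v0. Qed.

Lemma weierstrass_aux x y u v : x != 0 -> y != 0 -> u != 0 -> v != 0 ->
  theta p (x * y) * theta p (x / y) * (theta p (u * v) * theta p (u / v)) -
  theta p (x * v) * theta p (x / v) * (theta p (u * y) * theta p (u / y)) =
  u / y * (theta p (y * v) * theta p (y / v) * (theta p (x * u) * theta p (x / u))).
Proof.
move=> x0 y0 u0 v0.
pose D a b n : C := c0 ^+ 2 * (A a n.+1 * B b n.+1 - a / b * (B a n.+1 * A b n.+1)).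
have D_cvg a b : a != 0 -> b != 0 ->
    D a b @ \oo --> theta p (a * b) * theta p (a / b) by exact: theta_product_cvg.
have L : D x y n * D u v n - D x v n * D u y n @[n --> \oo] -->
  theta p (x * y) * theta p (x / y) * (theta p (u * v) * theta p (u / v)) -
  theta p (x * v) * theta p (x / v) * (theta p (u * y) * theta p (u / y)).
  by apply: cvgB; apply: cvgM; exact: D_cvg.
apply: (cvg_unique (@norm_hausdorff _ _) L).
have -> : (fun n => D x y n * D u v n - D x v n * D u y n) =
    fun n => u / y * (D y v n * D x u n).
  by apply/funext => n; exact: plucker.
apply: cvgM; first exact: cvg_cst.
by apply: cvgM; exact: D_cvg.
Qed.

End Weierstrass.

(** * The complex exponential *)

Section RealBounds.
Context {R : realType}.
Implicit Types u v c : R.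

Lemma mvt_from0 (f df : R -> R) v : (forall c, is_derive c 1 f (df c)) ->
  0 <= v -> exists2 c, 0 <= c <= v & f v - f 0 = df c * v.
Proof.
move=> fd v0; have cf : {within `[0, v], continuous f}.
  apply: continuous_subspaceT => c; apply: differentiable_continuous.
  by apply/derivable1_diffP; have [] := fd c.
have [c cv ->] := MVT_segment v0 (fun c _ => fd c) cf.
by exists c; rewrite ?subr0 //; move: cv; rewrite in_itv.
Qed.

Lemma norm_sin_le v : `|sin v| <= `|v|.
Proof.
wlog v0 : v / 0 <= v => [H|].
  have [/H //|/ltW v0] := leP 0 v.
  by rewrite -normrN -sinN -(normrN v) H // oppr_ge0.
have [c _] := mvt_from0 (@is_derive_sin R) v0.
rewrite sin0 subr0 => ->; rewrite normrM -[leRHS]mul1r.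
by rewrite ler_wpM2r // cos_max.
Qed.

Lemma norm_cosB1_le v : `|cos v - 1| <= v ^+ 2.
Proof.
wlog v0 : v / 0 <= v => [H|].
  have [/H //|/ltW v0] := leP 0 v.
  by rewrite -cosN -sqrrN H // oppr_ge0.
have [c /andP[c0 cv]] := mvt_from0 (@is_derive_cos R) v0.
rewrite cos0 => ->; rewrite normrM normrN (ger0_norm v0) expr2 ler_wpM2r //.
by apply: le_trans (norm_sin_le c) _; rewrite ger0_norm.
Qed.

Lemma norm_sinBid_le v : `|v| <= 1 -> `|sin v - v| <= v ^+ 2.
Proof.
wlog v0 : v / 0 <= v => [H v1|].
  have [/H -> //|/ltW v0] := leP 0 v.
  by have := H (- v); rewrite oppr_ge0 normrN sinN sqrrN -opprD normrN; apply.
rewrite ger0_norm // => v1.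
have fd c : is_derive c 1 (fun t : R => sin t - t) (cos c - 1).
  by apply: is_deriveB.
have [c /andP[c0 cv]] := mvt_from0 fd v0.
rewrite sin0 !subr0 => ->; rewrite normrM (ger0_norm v0) expr2 ler_wpM2r //.
apply: le_trans (norm_cosB1_le c) _; nra.
Qed.

(** From 1 - u <= exp(-u) follows exp(u) (1 - u) <= 1, while (1 + u + 2 u^2) (1 - u) = 1 + u^2 (1 -
    2u) >= 1. *)
Lemma expR_remainder u : `|u| <= 2^-1 -> 0 <= expR u - 1 - u <= 2 * u ^+ 2.
Proof.
move=> /ler_normlP[u1 u2].
have e1 := expR_ge1Dx u; have e2 := expR_ge1Dx (- u).
have e3 : expR u * expR (- u) = 1 by rewrite -expRD subrr expR0.
apply/andP; split; first lra.
have : expR u * (1 - u) <= expR u * expR (- u) by rewrite ler_wpM2l ?expR_ge0.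
rewrite e3.
nra.
Qed.

End RealBounds.

Section ComplexExp.
Context {R : realType}.
Local Notation C := (Cplx R).
Implicit Types x y z w s : C.

Lemma cexpD z w : cexp (z + w) = cexp z * cexp w.
Proof.
case: z w => [a b] [c d]; rewrite /cexp /=.
rewrite [RHS]/GRing.mul /= expRD cosD sinD.
by congr Complex; ring.
Qed.

Lemma cexp0 : cexp 0 = 1 :> C.
Proof. by rewrite /cexp /= expR0 cos0 sin0 mulr1 mulr0. Qed.

Lemma cexp_remainder z : nc z <= 2^-1 -> nc (cexp z - 1 - z) <= 7 * nc z ^+ 2.
Proof.
move=> z12; have := ler_Re_nc z; have := ler_Im_nc z.
case: z z12 => u v z12 /= hv hu; set d := nc _ in z12 hv hu *.
have d0 : 0 <= d := nc_ge0 _.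
have /andP[E1 E2] := expR_remainder (le_trans hu z12).
have C1 := norm_cosB1_le v; have S1 := norm_sin_le v.
have v1 : `|v| <= 1 by apply: le_trans hv _; lra.
have S2 := norm_sinBid_le v1; have C2 := cos_max v.
have u2 : u ^+ 2 <= d ^+ 2 by rewrite -[u ^+ 2]real_normK ?num_real // ler_sqr ?nnegrE.
have v2 : v ^+ 2 <= d ^+ 2 by rewrite -[v ^+ 2]real_normK ?num_real // ler_sqr ?nnegrE.
apply: le_trans (ler_nc_ReIm _) _.
rewrite -[X in `|X| + _]/(expR u * cos v - 1 - u).
rewrite -[X in _ + `|X|]/(expR u * sin v - 0 - v) subr0.
have -> : expR u * cos v - 1 - u =
  (expR u - 1 - u) * cos v + (1 + u) * (cos v - 1) by ring.
have -> : expR u * sin v - v =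
  (expR u - 1 - u) * sin v + u * sin v + (sin v - v) by ring.
(* The constant 7 is 2 + 2 for the real part (T1, T2) plus 1 + 1 + 1 for the imaginary part (T3 to
   T5). *)
have T1 : `|(expR u - 1 - u) * cos v| <= 2 * d ^+ 2.
  rewrite normrM (ger0_norm E1); apply: (@le_trans _ _ (expR u - 1 - u)).
    by rewrite -[leRHS]mulr1 ler_wpM2l.
  by apply: le_trans E2 _; rewrite ler_wpM2l.
have T2 : `|(1 + u) * (cos v - 1)| <= 2 * d ^+ 2.
  rewrite normrM; apply: ler_pM => //; last exact: le_trans v2.
  by apply: le_trans (ler_normD _ _) _; rewrite normr1; lra.
have T3 : `|(expR u - 1 - u) * sin v| <= d ^+ 2.
  rewrite normrM (ger0_norm E1) [d ^+ 2](_ : _ = 2 * d ^+ 2 * 2^-1); last by field.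
  apply: ler_pM => //; first by apply: le_trans E2 _; rewrite ler_wpM2l.
  by apply: le_trans S1 _; exact: le_trans z12.
have T4 : `|u * sin v| <= d ^+ 2.
  by rewrite normrM expr2; apply: ler_pM => //; exact: le_trans hv.
have T5 : `|sin v - v| <= d ^+ 2 by exact: le_trans v2.
have := ler_normD ((expR u - 1 - u) * cos v) ((1 + u) * (cos v - 1)).
have := ler_normD ((expR u - 1 - u) * sin v + u * sin v) (sin v - v).
have := ler_normD ((expR u - 1 - u) * sin v) (u * sin v).
lra.
Qed.

Lemma cexp_neq0 z : cexp z != 0.
Proof.
apply/eqP => z0; have := cexpD z (- z); rewrite z0 mul0r subrr cexp0 => /eqP.
by rewrite oner_eq0.
Qed.

Lemma cexp_differentiable z : differentiable (@cexp R) z.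
Proof.
apply: (@quadratic_remainder_differentiable _ _ _ (cexp z) (7 * nc (cexp z)) 2^-1).
  by rewrite invr_gt0.
move=> x xz; have -> : cexp x - cexp z - (x - z) * cexp z =
    cexp z * (cexp (x - z) - 1 - (x - z)).
  have {1}-> : x = z + (x - z) by rewrite addrC subrK.
  by rewrite cexpD; ring.
by rewrite ncM mulrAC mulrC ler_wpM2r ?nc_ge0 // cexp_remainder // ltW.
Qed.

(** The value 1 would give |z| <= 7 |z|^2, which is impossible in this range. *)
Lemma cexp_near0_neq1 z : 0 < nc z < 8^-1 -> cexp z != 1.
Proof.
move=> /andP[z0 z8]; apply/eqP => z1.
have : nc (cexp z - 1 - z) <= 7 * nc z ^+ 2 by apply: cexp_remainder; lra.
by rewrite z1 subrr sub0r ncN; nra.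
Qed.

Let twopii : C := Complex 0 (2 * pi).

Lemma nomeD s t : nome (s + t) = nome s * nome t :> C.
Proof. by rewrite /nome mulrDr cexpD. Qed.

Lemma nome0 : nome 0 = 1 :> C.
Proof. by rewrite /nome mulr0 cexp0. Qed.

Lemma nome_neq0 s : nome s != 0.
Proof. exact: cexp_neq0. Qed.

Lemma nome1 : nome 1 = 1 :> C.
Proof.
rewrite /nome mulr1 /cexp /= expR0 !mul1r mulr_natl.
by rewrite cos2pi sin2pi.
Qed.

Lemma nc_nome s : nc (nome s) = expR (- (2 * pi * complex.Im s)).
Proof.
case: s => a b; rewrite /nome /cexp /=.
rewrite mul0r sub0r; set e := expR _; set t := _ + _.
rewrite /nc /= !exprMn -mulrDr cos2Dsin2 mulr1 sqrtr_sqr ger0_norm //.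
exact: expR_ge0.
Qed.

Lemma nome_differentiable s : differentiable (@nome R) s.
Proof.
apply: (@differentiable_comp _ _ _ _ ( *%R twopii) (@cexp R)).
  apply: (@differentiableM _ _ (cst twopii) id); last exact: ex_diff.
  exact: differentiable_cst.
exact: cexp_differentiable.
Qed.

Lemma nome_near0_neq1 : exists2 d : R, 0 < d &
  forall s, s != 0 -> nc s < d -> nome s != 1.
Proof.
have t0 : 0 < nc twopii.
  rewrite nc_gt0; apply/eqP => /(congr1 (@complex.Im R)) /= /eqP.
  by rewrite mulf_eq0 pnatr_eq0 /= gt_eqF // pi_gt0.
exists (8^-1 / nc twopii) => [|s s0 sd]; first by rewrite divr_gt0 // invr_gt0.
apply: cexp_near0_neq1; rewrite ncM mulr_gt0 ?nc_gt0 //=; last by rewrite -nc_gt0.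
by rewrite mulrC -ltr_pdivlMr.
Qed.

End ComplexExp.

(** * Elliptic functions as ratios of holomorphic functions *)

Lemma ord4_neq :
    ((0 == 1 :> 'I_4) = false) *
    ((0 == 2 :> 'I_4) = false) *
    ((0 == 3 :> 'I_4) = false) *
    ((1 == 0 :> 'I_4) = false) *
    ((1 == 2 :> 'I_4) = false) *
    ((1 == 3 :> 'I_4) = false) *
    ((2 == 0 :> 'I_4) = false) *
    ((2 == 1 :> 'I_4) = false) *
    ((2 == 3 :> 'I_4) = false) *
    ((3 == 0 :> 'I_4) = false) *
    ((3 == 1 :> 'I_4) = false) *
    ((3 == 2 :> 'I_4) = false).
Proof. by do !split. Qed.

Lemma ord4_cases (i : 'I_4) : i = 0 \/ i = 1 \/ i = 2 \/ i = 3.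
Proof.
case: i => [[|[|[|[|//]]]] Hi]; [left | right; left | right; right; left |
  right; right; right]; exact: val_inj.
Qed.

Section EllipticFunctions.
Context {R : realType}.
Local Notation C := (Cplx R).
Local Notation V := 'rV[C]_4.
Implicit Types (f g h : V -> C) (z w : V).

Definition hol f : Prop := forall z, differentiable f z.

Lemma hol_cst (c : C) : hol (fun=> c).
Proof. by move=> z; exact: differentiable_cst. Qed.

Lemma hol_mul f g : hol f -> hol g -> hol (fun z => f z * g z).
Proof. by move=> hf hg z; exact: (differentiableM (hf z) (hg z)). Qed.

Lemma generically_neq0_mul f g : generically [set z | f z != 0] ->
  generically [set z | g z != 0] -> generically [set z | f z * g z != 0].
Proof.
by move=> gf gg; apply: (genericallyI gf gg) => z fz gz; exact: mulf_neq0.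
Qed.

(** Stronger than [meromorphic]: the quotient is global, and the numerator too is generically
    nonzero, which makes the class closed under inversion. *)
Definition hol_ratio f : Prop := exists g h,
  [/\ hol g, hol h, generically [set z | g z != 0],
      generically [set z | h z != 0] & forall z, f z = g z / h z].

Lemma hol_ratio_neq0 f : hol_ratio f -> generically [set z | f z != 0].
Proof.
move=> [g [h [_ _ gg gh E]]]; apply: (genericallyI gg gh) => z gz hz.
by rewrite /= E mulf_neq0 // invr_eq0.
Qed.

Lemma hol_ratio_cst (c : C) : c != 0 -> hol_ratio (fun=> c).
Proof.
move=> c0; exists (fun=> c), (fun=> 1); split; try exact: hol_cst.
- exact: generically_all.
- by apply: generically_all => z /=; exact: oner_neq0.
- by move=> z; rewrite divr1.
Qed.

Lemma hol_ratio_mul f g : hol_ratio f -> hol_ratio g ->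
  hol_ratio (fun z => f z * g z).
Proof.
move=> [f1 [f2 [hf1 hf2 nf1 nf2 Ef]]] [g1 [g2 [hg1 hg2 ng1 ng2 Eg]]].
exists (fun z => f1 z * g1 z), (fun z => f2 z * g2 z).
split; [exact: hol_mul | exact: hol_mul | exact: generically_neq0_mul |
  exact: generically_neq0_mul |].
by move=> z; rewrite Ef Eg mulf_div.
Qed.

Lemma hol_ratio_inv f : hol_ratio f -> hol_ratio (fun z => (f z)^-1).
Proof.
move=> [g [h [hg hh ng nh E]]]; exists h, g; split=> // z.
by rewrite E invf_div.
Qed.

Lemma hol_ratio_div f g : hol_ratio f -> hol_ratio g ->
  hol_ratio (fun z => f z / g z).
Proof. by move=> hf hg; apply: hol_ratio_mul => //; exact: hol_ratio_inv. Qed.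

Lemma hol_ratio_prod (I : Type) (s : seq I) (F : I -> V -> C) :
  (forall i, hol_ratio (F i)) -> hol_ratio (fun z => \prod_(i <- s) F i z).
Proof.
move=> HF; elim: s => [|i s IH].
  have -> : (fun z => \prod_(i <- [::]) F i z) = fun=> 1.
    by apply/funext => z; rewrite big_nil.
  by apply: hol_ratio_cst; exact: oner_neq0.
have -> : (fun z => \prod_(j <- i :: s) F j z) =
    fun z => F i z * \prod_(j <- s) F j z.
  by apply/funext => z; rewrite big_cons.
exact: hol_ratio_mul.
Qed.

Lemma hol_ratio_meromorphic f : hol_ratio f -> meromorphic f.
Proof.
move=> [g [h [hg hh _ nh E]]] z; exists setT, g, h; split=> //; first exact: openT.
move=> w _ B; rewrite nbhsE => -[W [oW Ww] WB].
have [U [oU dU UP]] := nh.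
have [|y [Wy Uy]] := dU W _ oW; first by exists w.
by exists y; split; [split=> //; exact: UP | exact: WB].
Qed.

Section Coordinates.
Variables sigma tau : C.
Hypothesis sigma_neq0 : sigma != 0.
Hypothesis p_bound : 0 < nc (nome tau) < 1.
Local Notation q := (nome sigma).
Local Notation p := (nome tau).

Definition coordq (i : 'I_4) z : C := nome (sigma * z 0 i).

Lemma coordq_neq0 i z : coordq i z != 0.
Proof. exact: nome_neq0. Qed.

Lemma coordq_hol i : hol (coordq i).
Proof.
move=> z; apply: (@differentiable_comp _ _ _ _
  (fun z : V => sigma * z 0 i) (@nome R)); last exact: nome_differentiable.
apply: (@differentiableM _ _ (cst sigma) (fun z : V => z 0 i)).
  exact: differentiable_cst.
exact: differentiable_coord.
Qed.

Lemma coordqD i z w : coordq i (z + w) = coordq i z * nome (sigma * w 0 i).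
Proof. by rewrite /coordq mxE mulrDr nomeD. Qed.

Lemma coordq_delta i j z (t : C) :
  coordq j (z + t *: delta_mx 0 i) =
  if j == i then nome (sigma * t) * coordq j z else coordq j z.
Proof.
rewrite coordqD !mxE eqxx /=; case: eqP => _; first by rewrite mulr1 mulrC.
by rewrite !mulr0 nome0 mulr1.
Qed.

(** At a zero, a small step along coordinate [i] multiplies [t] by a number close to but different
    from 1; as the zeros of theta are isolated, the new value is nonzero. This gives density. *)
Lemma theta_comp_neq0 (t : V -> C) (i : 'I_4) : hol t ->
  (forall z, t z != 0) ->
  (forall z (s : C), t (z + s *: delta_mx 0 i) = t z * nome (sigma * s)) ->
  generically [set z | theta p (t z) != 0].
Proof.
move=> ht t0 t_delta.
have hth : hol (fun z => theta p (t z)).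
  by move=> z; apply: (differentiable_comp (ht z)); exact: theta_differentiable.
exists [set z | theta p (t z) != 0]; split=> //.
  rewrite openE => z /= thz; rewrite /interior.
  exact: (cvgr_neq0 _ (differentiable_continuous (hth z)) thz).
move=> O [z Oz] oO.
have [thz|thz] := eqVneq (theta p (t z)) 0; last by exists z.
pose path (s : C) : V := z + s *: delta_mx 0 i.
have path_cvg : path s @[s --> (0 : C)] --> z.
  rewrite -[X in _ --> X]addr0; apply: (@cvgD _ _ _ _ (nbhs_filter (0 : C))).
    exact: cvg_cst.
  rewrite -[X in _ --> X](scale0r (delta_mx 0 i)).
  exact: (@scalel_continuous _ _ (delta_mx 0 i : V) 0).
have near_O : nbhs (0 : C) [set s | O (path s)].
  by apply: path_cvg; apply: open_nbhs_nbhs.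
have near_th : nbhs (0 : C) [set s | t (path s) != t z -> theta p (t (path s)) != 0].
  have ct : t (path s) @[s --> (0 : C)] --> t z.
    exact: (cvg_comp _ _ path_cvg (differentiable_continuous (ht z))).
  exact: (ct _ (theta_isolated_zeros p_bound (t0 z))).
move/nbhsCP: near_O => [e1 e10 HO]; move/nbhsCP: near_th => [e2 e20 Hth].
have [d d0 Hd] := @nome_near0_neq1 R.
(* The three thresholds keep the point in [O], make the zero of theta isolated, and force
   [nome (sigma * m)] to differ from 1; halving makes the inequalities strict. *)
pose m := Num.min (Num.min e1 e2) (d / nc sigma) / 2.
have ns0 : 0 < nc sigma by rewrite nc_gt0.
have m0 : 0 < m by rewrite divr_gt0 // !lt_min e10 e20 divr_gt0.
have m_lt : m < Num.min (Num.min e1 e2) (d / nc sigma).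
  by rewrite ltr_pdivrMr // mulr2n mulrDr mulr1 ltrDl; move: m0; rewrite pmulr_lgt0 // invr_gt0.
have nm : nc (Complex m 0 : C) = m by rewrite nc_real gtr0_norm.
have m_neq0 : (Complex m 0 : C) != 0 by rewrite -nc_gt0 nm.
move: m_lt; rewrite !lt_min => /andP[/andP[me1 me2] md].
exists (path (Complex m 0)); split.
  by apply: HO; rewrite sub0r ncN nm.
apply: Hth; first by rewrite sub0r ncN nm.
rewrite /path t_delta -[X in _ != X]mulr1 (inj_eq (mulfI (t0 z))).
by apply: Hd; rewrite ?mulf_neq0 // ncM nm mulrC -ltr_pdivlMr.
Qed.

Lemma hol_ratio_theta (c : C) (i j : 'I_4) (b : bool) : c != 0 -> i != j ->
  hol_ratio (fun z => theta p (c * coordq i z *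
    (if b then coordq j z else (coordq j z)^-1))).
Proof.
move=> c0 ij; pose t z := c * coordq i z * (if b then coordq j z else (coordq j z)^-1).
have t0 z : t z != 0.
  rewrite !mulf_neq0 ?coordq_neq0 //; case: b {t} => //; rewrite ?invr_eq0 coordq_neq0 //.
have ht : hol t.
  apply: hol_mul; first by apply: hol_mul; [exact: hol_cst | exact: coordq_hol].
  case: b {t t0} => z; first exact: coordq_hol.
  by apply: differentiableV; [exact: coordq_hol | exact: coordq_neq0].
exists (fun z => theta p (t z)), (fun=> 1); split.
- by move=> z; apply: (differentiable_comp (ht z)); exact: theta_differentiable.
- exact: hol_cst.
- apply: (@theta_comp_neq0 _ i) => // z s.
  rewrite /t !coordq_delta eqxx eq_sym (negPf ij); case: b {t t0 ht}; ring.
- by apply: generically_all => z /=; exact: oner_neq0.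
- by move=> z; rewrite divr1.
Qed.

Definition pullback (F : C -> C -> C -> C -> C) : V -> C := fun z =>
  F (nome (sigma * z 0 0)) (nome (sigma * z 0 1))
    (nome (sigma * z 0 2)) (nome (sigma * z 0 3)).

(** Translating a logarithm by tau/sigma multiplies the variable by p; translating it by 1/sigma
    multiplies it by [nome 1] = 1, so that period is automatic. *)
Definition p_invariant (F : C -> C -> C -> C -> C) : Prop :=
  forall x a b c, x != 0 -> a != 0 -> b != 0 -> c != 0 ->
  [/\ F (p * x) a b c = F x a b c, F x (p * a) b c = F x a b c,
      F x a (p * b) c = F x a b c & F x a b (p * c) = F x a b c].

Lemma pull_elliptic F : hol_ratio (pullback F) -> p_invariant F ->
  pullback F \in elliptic sigma tau.
Proof.
move=> hF Fp; apply/ellipticP; split; first exact: hol_ratio_meromorphic.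
have pullE z : pullback F z = F (coordq 0 z) (coordq 1 z) (coordq 2 z) (coordq 3 z) by [].
move=> i; split; apply: generically_all => z /=; rewrite !pullE !coordq_delta.
  by rewrite mulfV // nome1 !mul1r !if_same.
rewrite mulrCA mulfV // mulr1.
have := Fp _ _ _ _ (coordq_neq0 0 z) (coordq_neq0 1 z) (coordq_neq0 2 z)
  (coordq_neq0 3 z).
move: (coordq 0 z) (coordq 1 z) (coordq 2 z) (coordq 3 z) => x a b c [F1 F2 F3 F4].
by have [->|[->|[->|->]]] := ord4_cases i; rewrite !ord4_neq eqxx.
Qed.

End Coordinates.
End EllipticFunctions.

(** * Pointwise recurrence of the elliptic binomial coefficients *)

Section Pointwise.
Context {R : realType}.
Local Notation C := (Cplx R).
Variables p q : C.
Hypothesis p_bound : 0 < nc p < 1.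
Hypothesis q_neq0 : q != 0.
Implicit Types x y a b c A L : C.
Local Notation th := (theta p).
Local Notation po := (poch q p).

Lemma weierstrass_three_term a b c A L :
  a != 0 -> b != 0 -> c != 0 -> A != 0 -> L != 0 ->
  th (b * c * L) * th (a * c * A) * th (A * L) * th (a / b) =
  th (b * c * (A * L)) * th (a * c) * th L * th (a / b * A) -
  a / b * (th (b / a * L) * th (b * c) * th (a * c * (A * L)) * th A).
Proof.
move=> a0 b0 c0 A0 L0.
(* [weierstrass_aux] is applied at x, bcL/x, acAL/x, bcAL/x. This x^2 turns every product and
   quotient of two of these points into a monomial of the statement, or into 1/A. *)
pose x := sqrtC (a * b * c ^+ 2 * A * L).
have x2 : x ^+ 2 = a * b * c ^+ 2 * A * L by rewrite sqrtCK.
have x0 : x != 0 by rewrite -sqrf_eq0 x2 !mulf_neq0 // expf_neq0.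
have xE w : x * (w / x) = w by rewrite mulrCA mulfV // mulr1.
have div_x w v : w != 0 -> a * b * c ^+ 2 * A * L = v * w -> x / (w / x) = v.
  by move=> w0 e; rewrite invf_div mulrA -expr2 x2 e mulfK.
have div_div w w' v : w' != 0 -> w = v * w' -> w / x / (w' / x) = v.
  by move=> w0 ->; field; rewrite x0 w0.
have mul_mul w w' v : w * w' = v * (a * b * c ^+ 2 * A * L) -> w / x * (w' / x) = v.
  by rewrite -x2 => e; rewrite mulf_div e -expr2 mulfK // expf_neq0.
have nz w : w != 0 -> w / x != 0 by move=> w0; rewrite mulf_neq0 // invr_eq0.
have y0 : b * c * L != 0 by rewrite !mulf_neq0.
have u0 : a * c * (A * L) != 0 by rewrite !mulf_neq0.
have v0 : b * c * (A * L) != 0 by rewrite !mulf_neq0.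
have := @weierstrass_aux R p p_bound (sqrtC p) (sqrtCK p) x
  (b * c * L / x) (a * c * (A * L) / x) (b * c * (A * L) / x)
  x0 (nz _ y0) (nz _ u0) (nz _ v0).
rewrite !xE (div_x _ (a * c * A) y0); last by ring.
rewrite (mul_mul _ (b * c * (A * L)) (A * L)); last by ring.
rewrite (div_div _ _ (a / b) v0); last by field.
rewrite (div_x _ (a * c) v0); last by ring.
rewrite (mul_mul _ (b * c * L) L); last by ring.
rewrite (div_div _ _ (a / b * A) y0); last by field.
rewrite (mul_mul _ (b * c * (A * L)) (b / a * L)); last by field.
rewrite (div_div _ _ A^-1 v0); last by field.
rewrite (div_x _ (b * c) u0); last by ring.
rewrite theta_inv // => H.
rewrite [LHS](_ : _ = th (b * c * L) * th (a * c * A) * (th (A * L) * th (a / b)));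
  last by ring.
move/eqP: H; rewrite subr_eq => /eqP ->.
by field; rewrite b0 A0.
Qed.

Lemma pochS y k : po y k.+1 = po y k * th (y * q ^+ k).
Proof. by rewrite /poch big_nat_recr. Qed.

Lemma poch0 y : po y 0 = 1. Proof. by rewrite /poch big_nil. Qed.

Lemma pochSl y k : po y k.+1 = th y * po (y * q) k.
Proof.
rewrite /poch big_nat_recl // expr0 mulr1; congr (_ * _).
by apply: eq_bigr => j _; rewrite exprS mulrA.
Qed.

Lemma poch_add y k l : po y (k + l) = po y k * po (y * q ^+ k) l.
Proof.
elim: l => [|l IH]; first by rewrite addn0 poch0 mulr1.
by rewrite addnS !pochS IH -mulrA exprD (mulrA y).
Qed.

Lemma poch_neq0 y k : (forall m, (m < k)%N -> th (y * q ^+ m) != 0) -> po y k != 0.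
Proof.
move=> H; rewrite /poch prodf_seq_neq0; apply/allP => j.
by rewrite mem_index_iota => /andP[_ jk] /=; exact: H.
Qed.

(** A theta analogue of the binomial coefficient, symmetric in [k] and [l]. *)
Definition poch_binom y k l := po y (k + l) / (po y k * po y l).

Lemma poch_binomC y k l : poch_binom y k l = poch_binom y l k.
Proof. by rewrite /poch_binom addnC (mulrC (po y k)). Qed.

Lemma poch_binom0 y l : po y l != 0 -> poch_binom y 0 l = 1.
Proof. by move=> yl; rewrite /poch_binom poch0 mul1r add0n divff. Qed.

Lemma poch_binom_neq0 y k l : po y (k + l) != 0 -> poch_binom y k l != 0.
Proof.
move=> H; rewrite /poch_binom mulf_neq0 // invr_eq0 mulf_neq0 //.
  by move: H; rewrite poch_add mulf_eq0 negb_or => /andP[].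
by move: H; rewrite addnC poch_add mulf_eq0 negb_or => /andP[].
Qed.

Lemma poch_binom_shift y k l : po y (k.+1 + l) != 0 -> th (y * q ^+ l) != 0 ->
  poch_binom (y * q) k l = poch_binom y k.+1 l * th y / th (y * q ^+ l).
Proof.
move=> H tl; have t0 : th y != 0.
  by move: H; rewrite pochSl mulf_eq0 negb_or => /andP[].
have pk : po y k.+1 != 0 by move: H; rewrite poch_add mulf_eq0 negb_or => /andP[].
have pl : po y l != 0.
  by move: H; rewrite addnC poch_add mulf_eq0 negb_or => /andP[].
have E m : po (y * q) m = po y m.+1 / th y by rewrite pochSl mulrAC mulfV // mul1r.
rewrite /poch_binom !E addSn (pochS y l).
by field; rewrite t0 pl tl pk.
Qed.

Lemma poch_binomS y k l : po y k.+1 != 0 -> po y l != 0 ->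
  poch_binom y k.+1 l = poch_binom y k l * th (y * q ^+ (k + l)) / th (y * q ^+ k).
Proof.
rewrite /poch_binom addSn !pochS mulf_eq0 negb_or => /andP[pk tk] pl.
by field; rewrite pk tk pl.
Qed.

Definition front k l x := th (x * q ^ (k%:Z - l%:Z)) * th x^-1 /
  (th (x * q ^+ k) * th (x^-1 * q ^+ l)) * q ^+ l.

(** Writing (y q^i; q, p)_j as (y; q, p)_(i+j) / (y; q, p)_i exposes the symmetry under (a, k) <->
    (b, l) of everything except [front]. *)
Lemma B_funE k l x a b c :
  po (b * c) l != 0 -> po (a * c) k != 0 -> po (a * b) k != 0 ->
  po (c * x) k != 0 -> po (c / x) k != 0 -> po q k != 0 ->
  B_fun q p k l x a b c = front k l (a / b) *
    (poch_binom (b * c) k l * poch_binom (a * c) k l * poch_binom q k l /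
     (poch_binom (a * b) k l * poch_binom (c * x) k l * poch_binom (c / x) k l)).
Proof.
move=> bc ac ab cx cx' qk.
have E y i j : po y i != 0 -> po (y * q ^+ i) j = po y (i + j) / po y i.
  by move=> yi; rewrite poch_add mulrAC mulfV // mul1r.
rewrite /B_fun /thetas /pochs !big_cons !big_nil !mulr1 exprS !E //.
rewrite /front /poch_binom (addnC l k) invf_div !invfM !invrK.
move: (po (b * c) (k + l)) (po (b * c) l) (po (a * c) (k + l)) => *.
by ring.
Qed.

Lemma H_fun1E i x a b c :
  th (c / b * q ^+ i) != 0 -> th (a * x * q ^+ i) != 0 -> th (a / x * q ^+ i) != 0 ->
  H_fun q p i 1 x a b c =
  th (b * c * q ^+ i.+2) * th (a * b * q ^+ i) * th (a / b * q ^+ i) *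
    th (c * x * q ^+ i) * th (c / x * q ^+ i) /
  (th (b * c * q ^+ i) * th (a * b * q ^+ i.+1) * th (a / b * q ^ (i%:Z - 1)) *
    th (c * x * q ^+ i.+1) * th (c / x * q ^+ i.+1)).
Proof.
move=> n1 n2 n3.
rewrite /H_fun /h_fun /thetas !big_cons !big_nil !mulr1 muln1 muln0 !addn0.
rewrite addn1 addn2 subr0 -exprnP.
move: (th (c / b * q ^+ i)) (th (a * x * q ^+ i)) (th (a / x * q ^+ i)) n1 n2 n3
  => t1 t2 t3 n1 n2 n3.
rewrite !invfM !invrK.
have e1 := mulfV n1; have e2 := mulfV n2; have e3 := mulfV n3.
move: t1^-1 t2^-1 t3^-1 e1 e2 e3 => s1 s2 s3 e1 e2 e3.
rewrite [LHS](_ : _ = th (b * c * q ^+ i.+2) * th (a * b * q ^+ i) *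
  th (a / b * q ^+ i) * th (c * x * q ^+ i) * th (c / x * q ^+ i) *
  ((th (b * c * q ^+ i))^-1 * (th (a * b * q ^+ i.+1))^-1 *
   (th (a / b * q ^ (i%:Z - 1)))^-1 *
    (th (c * x * q ^+ i.+1))^-1 * (th (c / x * q ^+ i.+1))^-1) *
  ((t1 * s1) * (t2 * s2) * (t3 * s3))); last by ring.
by rewrite e1 e2 e3; ring.
Qed.

(** Up to powers of q, these are the variable-dependent arguments of the thetas in the denominators
    of [H_fun] and [B_fun], together with their images under a <-> b. *)
Definition good_args x a b c : seq C :=
  [:: b * c; a * c; a * b; c * x; c / x; a / b; b / a;
      c / b; a * x; a / x; c / a; b * x; b / x].

Definition good_point K x a b c : Prop :=
  [/\ x != 0, a != 0, b != 0 & c != 0] /\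
  forall y, y \in good_args x a b c ->
  forall m : int, (`|m| <= K)%N -> th (y * q ^ m) != 0.

Lemma good_pointC K x a b c : good_point K x a b c -> good_point K x b a c.
Proof.
move=> [[x0 a0 b0 c0] H]; split=> // y yi m; apply: H.
by move: yi; rewrite !inE (mulrC b a); do !(case/orP=> [->|]; rewrite ?orbT //);
  move=> ->; rewrite !orbT.
Qed.

(** The product telescopes by [H_fun1E]. The factors in bc advance by q^2 at each step, so two of
    them survive at either end. *)
Lemma H_prodE k K x a b c : good_point K x a b c -> (k < K)%N ->
  \prod_(0 <= i < k) H_fun q p i 1 x a b c =
  th (b * c * q ^+ k) * th (b * c * q ^+ k.+1) * th (a * b) *
    th (a / b * q ^ (k%:Z - 1)) * th (c * x) * th (c / x) /
  (th (b * c) * th (b * c * q) * th (a * b * q ^+ k) * th (a / b * q ^ (-1)) *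
    th (c * x * q ^+ k) * th (c / x * q ^+ k)).
Proof.
move=> [_ H] kK.
have Hn y m : y \in good_args x a b c -> (m <= K)%N -> th (y * q ^+ m) != 0.
  by move=> yi mK; exact: (H y yi m%:Z).
have H0 y : y \in good_args x a b c -> th y != 0.
  by move=> yi; rewrite -[y]mulr1 -(expr0 q) Hn.
elim: k kK => [|k IH] kK.
  rewrite big_nil !expr0 !mulr1 expr1 sub0r.
  have n1 : th (b * c) != 0 by rewrite H0 // !inE eqxx ?orbT.
  have n2 : th (b * c * q) != 0 by rewrite -[q]expr1 Hn ?inE ?eqxx ?orbT // ltnW.
  have n3 : th (a * b) != 0 by rewrite H0 // !inE eqxx ?orbT.
  have n4 : th (a / b * q ^ (-1)) != 0 by rewrite H ?inE ?eqxx ?orbT // ltnW.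
  have n5 : th (c * x) != 0 by rewrite H0 // !inE eqxx ?orbT.
  have n6 : th (c / x) != 0 by rewrite H0 // !inE eqxx ?orbT.
  by field; rewrite n1 n2 n3 n4 n5 n6.
rewrite big_nat_recr //= IH; last exact: ltnW.
have kK' : (k <= K)%N by lia.
rewrite H_fun1E; try by rewrite Hn // !inE eqxx ?orbT.
rewrite (_ : k.+1%:Z - 1 = k%:Z); last by lia.
rewrite -(exprnP q k).
have m1 : th (b * c * q ^+ k) != 0 by rewrite Hn // !inE eqxx ?orbT.
have m2 : th (a * b * q ^+ k) != 0 by rewrite Hn // !inE eqxx ?orbT.
have m3 : th (a / b * q ^ (k%:Z - 1)) != 0.
  by rewrite H ?inE ?eqxx ?orbT //; lia.
have m4 : th (c * x * q ^+ k) != 0 by rewrite Hn // !inE eqxx ?orbT.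
have m5 : th (c / x * q ^+ k) != 0 by rewrite Hn // !inE eqxx ?orbT.
rewrite !invfM.
have e1 := mulfV m1; have e2 := mulfV m2; have e3 := mulfV m3.
have e4 := mulfV m4; have e5 := mulfV m5.
move: (th (b * c * q ^+ k)) (th (a * b * q ^+ k)) (th (a / b * q ^ (k%:Z - 1)))
  (th (c * x * q ^+ k)) (th (c / x * q ^+ k)) e1 e2 e3 e4 e5 {m1 m2 m3 m4 m5 Hn H0 H IH}
  => t1 t2 t3 t4 t5.
move: t1^-1 t2^-1 t3^-1 t4^-1 t5^-1 => s1 s2 s3 s4 s5 e1 e2 e3 e4 e5.
move: (th (b * c))^-1 (th (b * c * q))^-1 (th (a * b * q ^+ k.+1))^-1
  (th (a / b * q ^ (-1)))^-1 (th (c * x * q ^+ k.+1))^-1 (th (c / x * q ^+ k.+1))^-1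
  (th (b * c * q ^+ k.+1)) (th (b * c * q ^+ k.+2)) (th (a * b))
  (th (a / b * q ^+ k)) (th (c * x)) (th (c / x)) =>
  u1 u2 u3 u4 u5 u6 v1 v2 v3 v4 v5 v6.
rewrite [LHS](_ : _ = (v1 * v2 * v3 * v4 * v5 * v6 * (u1 * u2 * u3 * u4 * u5 * u6)) *
  ((t1 * s1) * (t2 * s2) * (t3 * s3) * (t4 * s4) * (t5 * s5))); last by ring.
by rewrite e1 e2 e3 e4 e5; ring.
Qed.

End Pointwise.

Ltac lia_from H := clear - H; lia.

(** * The Pascal-type recurrence at a good point *)

Section Recurrence.
Context {R : realType}.
Local Notation C := (Cplx R).
Variables p q : C.
Hypothesis p_bound : 0 < nc p < 1.
Hypothesis q_neq0 : q != 0.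
Implicit Types x y a b c : C.
Local Notation th := (theta p).
Local Notation po := (poch q p).

Section AtGoodPoint.
Variables (K : nat) (x a b c : C).
Hypothesis Hgood : good_point p q K x a b c.

Lemma good_theta y m : y \in good_args x a b c -> (m <= K)%N ->
  th (y * q ^+ m) != 0.
Proof. by case: Hgood => _ H yi mK; exact: (H y yi m%:Z). Qed.

Lemma good_theta0 y : y \in good_args x a b c -> th y != 0.
Proof. by move=> yi; rewrite -[y]mulr1 -(expr0 q) good_theta. Qed.

Lemma good_poch y m : y \in good_args x a b c -> (m <= K.+1)%N -> po y m != 0.
Proof.
move=> yi mK; apply: poch_neq0 => j jm; apply: good_theta => //.
by rewrite -ltnS (leq_trans jm).
Qed.

Lemma good_poch1 y m : y \in good_args x a b c -> (m <= K)%N -> po (y * q) m != 0.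
Proof.
move=> yi mK; have := good_poch yi (mK : (m.+1 <= K.+1)%N).
by rewrite pochSl mulf_eq0 negb_or => /andP[].
Qed.

Lemma good_poch2 y m : y \in good_args x a b c -> (m < K)%N ->
  po (y * q * q) m != 0.
Proof.
move=> yi mK; have := good_poch1 yi (mK : (m.+1 <= K)%N).
by rewrite pochSl mulf_eq0 negb_or => /andP[].
Qed.

Lemma front_shift k l :
  front p q k l (a * q / b) =
  th (a / b * q ^ (k.+1%:Z - l%:Z)) * th (b / a * q ^ (-1)) /
  (th (a / b * q ^+ k.+1) * th (b / a * q ^ (l%:Z - 1))) * q ^+ l.
Proof.
have [[x0 a0 b0 c0] _] := Hgood.
rewrite /front; have -> : (a * q / b)^-1 = b / a * q ^ (-1).
  by rewrite exprN1; field; rewrite a0 b0 q_neq0.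
have -> : b / a * q ^ (-1) * q ^+ l = b / a * q ^ (l%:Z - 1).
  by rewrite -mulrA [l%:Z - 1]addrC expfzDr.
have -> : a * q / b * q ^+ k = a / b * q ^+ k.+1 by rewrite exprS; ring.
have -> : a * q / b * q ^ (k%:Z - l%:Z) = a / b * q ^ (k.+1%:Z - l%:Z).
  have -> : k.+1%:Z - l%:Z = 1 + (k%:Z - l%:Z) by lia.
  by rewrite [in RHS]expfzDr // expr1z; ring.
by [].
Qed.

(** This is the contribution of multiplying by X on the left: the shift comes from moving the
    coefficient past X, the product of [H_fun] from moving the factors h. On each [poch_binom] the
    shift changes only boundary thetas, most of which the telescoped product cancels. *)
Lemma B_shift k l : (k.+1 + l < K)%N ->
  (forall m, (0 < m <= k.+1 + l)%N -> th (q ^+ m) != 0) ->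
  B_fun q p k l x (a * q) b (c * q) * \prod_(0 <= j < l) H_fun q p j 1 x b a c =
  B_fun q p k.+1 l x a b c *
  (th (b / a * q ^+ l) * th (b * c) * th (a * c * q ^+ (k.+1 + l)) * th (q ^+ k.+1) /
   (th (b / a) * th (b * c * q ^+ l) * th (a * c * q ^+ k.+1) *
    th (q ^+ (k.+1 + l)))).
Proof.
move=> klK qn; have [[x0 a0 b0 c0] HK] := Hgood.
have i_bc : b * c \in good_args x a b c by rewrite !inE eqxx ?orbT.
have i_ac : a * c \in good_args x a b c by rewrite !inE eqxx ?orbT.
have i_ab : a * b \in good_args x a b c by rewrite !inE eqxx ?orbT.
have i_cx : c * x \in good_args x a b c by rewrite !inE eqxx ?orbT.
have i_cVx : c / x \in good_args x a b c by rewrite !inE eqxx ?orbT.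
have i_aVb : a / b \in good_args x a b c by rewrite !inE eqxx ?orbT.
have i_bVa : b / a \in good_args x a b c by rewrite !inE eqxx ?orbT.
have qpo m : (m <= k.+1 + l)%N -> po q m != 0.
  move=> mk; apply: poch_neq0 => j jm; rewrite -exprS qn //=.
  exact: leq_trans jm mk.
have s1 : b * (c * q) = b * c * q by ring.
have s2 : a * q * (c * q) = a * c * q * q by ring.
have s3 : a * q * b = a * b * q by ring.
have s4 : c * q * x = c * x * q by ring.
have s5 : c * q / x = c / x * q by ring.
rewrite B_funE; [|rewrite s1 good_poch1 //; lia_from klK |rewrite s2 good_poch2 //; lia_from klK
  |rewrite s3 good_poch1 //; lia_from klK |rewrite s4 good_poch1 //; lia_from klK
  |rewrite s5 good_poch1 //; lia_from klK | rewrite qpo //; lia_from klK].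
rewrite s1 s2 s3 s4 s5 front_shift.
rewrite B_funE; [|by rewrite good_poch //; lia_from klK ..|by rewrite qpo //; lia_from klK].
rewrite /front invf_div.
rewrite (H_prodE p_bound q_neq0 (good_pointC Hgood)); last by lia_from klK.
have acq m : th (a * c * q * q ^+ m) = th (a * c * q ^+ m.+1).
  by rewrite -mulrA -exprS.
rewrite (@poch_binom_shift _ p q (a * c * q)); last 2 first.
- by rewrite good_poch1 //; lia_from klK.
- by rewrite acq good_theta //; lia_from klK.
rewrite (@poch_binom_shift _ p q (a * c) k.+1); last 2 first.
- by rewrite good_poch //; lia_from klK.
- by rewrite good_theta //; lia_from klK.
rewrite (@poch_binomS _ p q (a * c) k.+1); last 2 first.
- by rewrite good_poch //; lia_from klK.
- by rewrite good_poch //; lia_from klK.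
do 4 (rewrite poch_binom_shift; last 2 first; [by rewrite good_poch //; lia_from klK
  | by rewrite good_theta //; lia_from klK |]).
rewrite (@poch_binomS _ p q q k l); last 2 first.
- by rewrite qpo //; lia_from klK.
- by rewrite qpo //; lia_from klK.
rewrite acq -!exprS -addSn (mulrC b a).
have n1 : th (b / a) != 0 by exact: good_theta0.
have n2 : th (b * c * q ^+ l) != 0 by rewrite good_theta //; lia_from klK.
have n3 : th (a * c * q ^+ k.+1) != 0 by rewrite good_theta //; lia_from klK.
have n4 : th (q ^+ (k.+1 + l)) != 0 by rewrite qn //; lia_from klK.
have n5 : th (q ^+ k.+1) != 0 by rewrite qn //; lia_from klK.
have n6 : th (b / a * q ^ (-1)) != 0 by rewrite HK //; lia_from klK.
have n7 : th (a / b * q ^+ k.+1) != 0 by rewrite good_theta //; lia_from klK.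
have n8 : th (b / a * q ^ (l%:Z - 1)) != 0 by rewrite HK //; lia_from klK.
have n9 : th (b / a * q ^+ l) != 0 by rewrite good_theta //; lia_from klK.
have n10 : th (a * c) != 0 by exact: good_theta0.
have n11 : th (a * c * q) != 0 by rewrite -[q]expr1 good_theta //; lia_from klK.
have n12 : th (a * c * q ^+ l) != 0 by rewrite good_theta //; lia_from klK.
have n13 : th (a * c * q ^+ l.+1) != 0 by rewrite good_theta //; lia_from klK.
have n14 : th (a * b) != 0 by exact: good_theta0.
have n15 : th (a * b * q ^+ l) != 0 by rewrite good_theta //; lia_from klK.
have n16 : th (c * x) != 0 by exact: good_theta0.
have n17 : th (c * x * q ^+ l) != 0 by rewrite good_theta //; lia_from klK.
have n18 : th (c / x) != 0 by exact: good_theta0.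
have n19 : th (c / x * q ^+ l) != 0 by rewrite good_theta //; lia_from klK.
have r1 : poch_binom p q (a * b) k.+1 l != 0.
  by apply: poch_binom_neq0; rewrite good_poch //; lia_from klK.
have r2 : poch_binom p q (c * x) k.+1 l != 0.
  by apply: poch_binom_neq0; rewrite good_poch //; lia_from klK.
have r3 : poch_binom p q (c / x) k.+1 l != 0.
  by apply: poch_binom_neq0; rewrite good_poch //; lia_from klK.
move: n1 n2 n3 n4 n5 n6 n7 n8 n9 n10 n11 n12 n13 n14 n15 n16 n17 n18 n19 r1 r2 r3.
move: (th (b / a)) (th (b * c * q ^+ l)) (th (a * c * q ^+ k.+1))
  (th (q ^+ (k.+1 + l))) (th (q ^+ k.+1)) (th (b / a * q ^ (-1)))
  (th (a / b * q ^+ k.+1)) (th (b / a * q ^ (l%:Z - 1))) (th (b / a * q ^+ l))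
  (th (a * c)) (th (a * c * q)) (th (a * c * q ^+ l)) (th (a * c * q ^+ l.+1))
  (th (a * b)) (th (a * b * q ^+ l)) (th (c * x)) (th (c * x * q ^+ l))
  (th (c / x)) (th (c / x * q ^+ l)) (poch_binom p q (a * b) k.+1 l)
  (poch_binom p q (c * x) k.+1 l) (poch_binom p q (c / x) k.+1 l)
  => t1 t2 t3 t4 t5 t6 t7 t8 t9 t10 t11 t12 t13 t14 t15 t16 t17 t18 t19 u1 u2 u3.
move: (th (a / b * _)) (poch_binom _ _ (b * c) _ _) (poch_binom _ _ (a * c) _ _)
  (poch_binom _ _ q _ _) (th (b * c)) (th (a * c * _)) (q ^+ l) => *.
by field; do !(apply/andP; split).
Qed.

(* The three-term relation, divided by theta(a/b). *)
Lemma B_weights k l : (k + l < K)%N ->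
  (forall m, (0 < m <= k + l)%N -> th (q ^+ m) != 0) -> (0 < k + l)%N ->
  th (b / a * q ^+ l) * th (b * c) * th (a * c * q ^+ (k + l)) * th (q ^+ k) /
   (th (b / a) * th (b * c * q ^+ l) * th (a * c * q ^+ k) * th (q ^+ (k + l))) +
  th (a / b * q ^+ k) * th (a * c) * th (b * c * q ^+ (k + l)) * th (q ^+ l) /
   (th (a / b) * th (a * c * q ^+ k) * th (b * c * q ^+ l) * th (q ^+ (k + l))) = 1.
Proof.
move=> klK qn kl0; have [[x0 a0 b0 c0] HK] := Hgood.
have := @weierstrass_three_term _ _ p_bound a b c (q ^+ k) (q ^+ l) a0 b0 c0
  (expf_neq0 _ q_neq0) (expf_neq0 _ q_neq0).
rewrite -!exprD.
have -> : th (b / a) = - (b / a) * th (a / b).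
  by have := @theta_inv _ _ p_bound (a / b); rewrite invf_div => ->; rewrite ?mulf_neq0 ?invr_eq0.
have n1 : th (a / b) != 0 by apply: good_theta0; rewrite !inE eqxx ?orbT.
have n2 : th (b * c * q ^+ l) != 0.
  by rewrite good_theta ?inE ?eqxx ?orbT //; lia_from klK.
have n3 : th (a * c * q ^+ k) != 0.
  by rewrite good_theta ?inE ?eqxx ?orbT //; lia_from klK.
have n4 : th (q ^+ (k + l)) != 0 by rewrite qn // kl0 leqnn.
move: n1 n2 n3 n4.
move: (th (a / b)) (th (b * c * q ^+ l)) (th (a * c * q ^+ k)) (th (q ^+ (k + l)))
  => t1 t2 t3 t4 n1 n2 n3 n4 E.
apply: (mulIf (mulf_neq0 (mulf_neq0 n2 n3) (mulf_neq0 n4 n1))).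
rewrite mul1r [RHS]mulrA E.
move: (th (b / a * _)) (th (b * c)) (th (a * c * _)) (th (q ^+ k)) (th (a / b * _))
  (th (a * c)) (th (b * c * _)) (th (q ^+ l)) => *.
by field; rewrite n1 n2 n3 n4 a0 b0.
Qed.

End AtGoodPoint.

(** Inverting the arguments of two thetas yields the factor q^(l-k); this is exactly compensated by
    the power q^l in [front] becoming q^k. *)
Lemma frontC k l y : y != 0 -> front p q k l y = front p q l k y^-1.
Proof.
move=> y0; rewrite /front invrK.
have -> : y^-1 * q ^ (l%:Z - k%:Z) = (y * q ^ (k%:Z - l%:Z))^-1.
  by rewrite invfM invr_expz opprB.
have z0 : y * q ^ (k%:Z - l%:Z) != 0 by rewrite mulf_neq0 // expfz_neq0.
have y1 := theta_inv p_bound y0; have z1 := theta_inv p_bound z0.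
rewrite y1 z1.
have -> : (y * q ^ (k%:Z - l%:Z))^-1 = y^-1 * q ^+ l / q ^+ k.
  by rewrite expfzDr // -exprnN -exprnP; field; rewrite y0 !expf_neq0.
rewrite [th (y^-1 * q ^+ l) * _]mulrC !invfM.
move: (th _)^-1 (th _)^-1 (th (y * _)) (th y) => t1 t2 t3 t4.
by field; rewrite y0 !expf_neq0.
Qed.

Lemma B_funC K k l x a b c : good_point p q K x a b c -> (k <= K)%N -> (l <= K)%N ->
  po q k != 0 -> po q l != 0 -> B_fun q p k l x a b c = B_fun q p l k x b a c.
Proof.
move=> Hg kK lK qk ql; have [[x0 a0 b0 c0] _] := Hg; have Hg' := good_pointC Hg.
rewrite !B_funE //;
  try by [rewrite (good_poch Hg) ?inE ?eqxx ?orbT // ltnW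
         |rewrite (good_poch Hg') ?inE ?eqxx ?orbT // ltnW].
rewrite frontC ?mulf_neq0 ?invr_eq0 // invf_div (mulrC b a).
rewrite !(poch_binomC _ _ _ k l) (mulrC (poch_binom _ _ (b * c) _ _)).
by [].
Qed.

(** Every argument is multiplied by q^e with |e| <= 2, the extreme case being bc; hence the loss of
    2 in the bound. *)
Lemma good_shift K x a b c : good_point p q K.+2 x a b c ->
  good_point p q K x a (b * q) (c * q).
Proof.
move=> [[x0 a0 b0 c0] H]; split; first by split; rewrite ?mulf_neq0.
suff args y : y \in good_args x a (b * q) (c * q) ->
    exists2 z, z \in good_args x a b c & exists2 e : int, (`|e| <= 2)%N & y = z * q ^ e.
  move=> y /args[z zi [e e2 ->]] m mK; rewrite -mulrA -expfzDr //; apply: H => //.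
  by move: e2 mK; clear; lia.
have q1 : q ^ 1 = q := expr1z q.
have q2 : q ^ 2 = q * q := erefl.
rewrite !inE; do !case/orP; move/eqP ->.
- by exists (b * c); [rewrite !inE eqxx ?orbT | exists 2 => //; rewrite q2; ring].
- by exists (a * c); [rewrite !inE eqxx ?orbT | exists 1 => //; rewrite q1; ring].
- by exists (a * b); [rewrite !inE eqxx ?orbT | exists 1 => //; rewrite q1; ring].
- by exists (c * x); [rewrite !inE eqxx ?orbT | exists 1 => //; rewrite q1; ring].
- by exists (c / x); [rewrite !inE eqxx ?orbT | exists 1 => //; rewrite q1; ring].
- exists (a / b); [by rewrite !inE eqxx ?orbT | exists (-1) => //].
  by rewrite exprN1 invfM mulrA.
- by exists (b / a); [rewrite !inE eqxx ?orbT | exists 1 => //; rewrite q1; ring].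
- exists (c / b); [by rewrite !inE eqxx ?orbT | exists 0 => //].
  by rewrite expr0z; field; rewrite b0 q_neq0.
- by exists (a * x); [rewrite !inE eqxx ?orbT | exists 0 => //; rewrite expr0z mulr1].
- by exists (a / x); [rewrite !inE eqxx ?orbT | exists 0 => //; rewrite expr0z mulr1].
- by exists (c / a); [rewrite !inE eqxx ?orbT | exists 1 => //; rewrite q1; ring].
- by exists (b * x); [rewrite !inE eqxx ?orbT | exists 1 => //; rewrite q1; ring].
- by exists (b / x); [rewrite !inE eqxx ?orbT | exists 1 => //; rewrite q1; ring].
Qed.

(** Both terms are multiples of B(k+1, l+1) by [B_shift], the second one after exchanging (a, k) and
    (b, l); the weights add up to 1 by [B_weights]. *)
Lemma B_recurrence K k l x a b c : good_point p q K x a b c ->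
  (k.+1 + l.+1 < K)%N ->
  (forall m, (0 < m <= k.+1 + l.+1)%N -> th (q ^+ m) != 0) ->
  B_fun q p k.+1 l.+1 x a b c =
  B_fun q p k l.+1 x (a * q) b (c * q) *
    \prod_(0 <= j < l.+1) H_fun q p j 1 x b a c +
  B_fun q p k.+1 l x a (b * q) (c * q) *
    \prod_(0 <= j < k.+1) H_fun q p j 1 x a b c.
Proof.
move=> Hg klK qn; have Hg' := good_pointC Hg.
have qpo m : (m <= k.+1 + l.+1)%N -> po q m != 0.
  move=> mk; apply: poch_neq0 => j jm; rewrite -exprS qn //=.
  exact: leq_trans jm mk.
rewrite (B_shift Hg) //.
have -> : B_fun q p k.+1 l x a (b * q) (c * q) = B_fun q p l k.+1 x (b * q) a (c * q).
  have Hs : good_point p q K.-2 x a (b * q) (c * q).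
    by apply: good_shift; rewrite (_ : K.-2.+2 = K) //; lia_from klK.
  apply: (B_funC Hs); try (by lia_from klK); by apply: qpo; lia_from klK.
rewrite (B_shift Hg'); [|by rewrite addnC|by rewrite addnC].
rewrite -(B_funC Hg); try (by lia_from klK); try (by apply: qpo; lia_from klK).
by rewrite -mulrDr (addnC l.+1 k.+1) (B_weights Hg) ?mulr1.
Qed.

Lemma B_fun0l K l x a b c : good_point p q K x a b c -> (l <= K)%N ->
  po q l != 0 -> B_fun q p 0 l x a b c = 1.
Proof.
move=> Hg lK ql; have [[x0 a0 b0 c0] _] := Hg.
have gp y m : y \in good_args x a b c -> (m <= K)%N -> po y m != 0.
  by move=> yi mK; apply: (good_poch Hg) => //; exact: ltnW.
rewrite B_funE ?poch0 ?oner_neq0 //; last by rewrite gp // !inE eqxx ?orbT.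
rewrite frontC ?mulf_neq0 ?invr_eq0 // invf_div.
rewrite !poch_binom0 //; try by rewrite gp // !inE eqxx ?orbT.
rewrite !mulr1 divr1 mulr1 /front expr0 !mulr1 subr0 -exprnP divff //.
rewrite invf_div mulf_neq0 //.
  by apply: (good_theta Hg) => //; rewrite !inE eqxx ?orbT.
by apply: (good_theta0 Hg); rewrite !inE eqxx ?orbT.
Qed.

End Recurrence.

(** * Ellipticity of the theta quotients *)

Section Invariance.
Context {R : realType}.
Local Notation C := (Cplx R).
Variables sigma tau : C.
Hypothesis p_bound : 0 < nc (nome tau) < 1.
Local Notation q := (nome sigma).
Local Notation p := (nome tau).
Local Notation th := (theta p).
Implicit Types x y z a b c : C.

Let q0 : q != 0 := nome_neq0 sigma.
Let p0 : p != 0 := nome_neq0 tau.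

Let qX0 m : q ^+ m != 0. Proof. exact: expf_neq0. Qed.
Let qz0 (m : int) : q ^ m != 0. Proof. exact: expfz_neq0. Qed.

Let theta_mul y z : y != 0 -> z = p * y -> th z = - y^-1 * th y.
Proof. by move=> y0 ->; exact: theta_mulp. Qed.

Let theta_div y z : y != 0 -> z = y / p -> th z = - (y / p) * th y.
Proof. by move=> y0 ->; exact: theta_divp. Qed.

Let ratio_eq (m N N' D D' : C) : m != 0 -> N' = m * N -> D' = m * D -> N' / D' = N / D.
Proof. by move=> m0 -> ->; rewrite -mulf_div divff // mul1r. Qed.

Lemma h_funE i j x a b c : h_fun q p i j x a b c =
  th (b * c * (q ^+ i * q ^+ j * q ^+ j)) * th (c / b * q ^+ i) *
  th (a * x * q ^+ i) * th (a / x * q ^+ i) /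
  (th (a * b * (q ^+ i * q ^+ j)) * th (a / b * (q ^+ i / q ^+ j)) *
   th (c * x * (q ^+ i * q ^+ j)) * th (c / x * (q ^+ i * q ^+ j))).
Proof.
rewrite /h_fun /thetas !big_cons !big_nil !mulr1 mul2n -addnn !exprD.
by rewrite expfzDr // -exprnN -exprnP !mulrA.
Qed.

(** The quotient is balanced: when one variable is multiplied by p, the numerator and the
    denominator acquire the same monomial, supplied to [ratio_eq] in each case. *)
Lemma h_fun_p_invariant i j : p_invariant tau (h_fun q p i j).
Proof.
move=> x a b c x0 a0 b0 c0; rewrite !h_funE.
have := qX0 i; have := qX0 j; move: (q ^+ i) (q ^+ j) => I J J0 I0.
split.
- rewrite (@theta_mul (a * x * I) (a * (p * x) * I)) ?mulf_neq0 //; last by ring.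
  rewrite (@theta_div (a / x * I) (a / (p * x) * I)) ?mulf_neq0 ?invr_eq0 //;
    last by field; rewrite x0 p0.
  rewrite (@theta_mul (c * x * (I * J)) (c * (p * x) * (I * J))) ?mulf_neq0 //;
    last by ring.
  rewrite (@theta_div (c / x * (I * J)) (c / (p * x) * (I * J))) ?mulf_neq0 ?invr_eq0 //;
    last by field; rewrite x0 p0.
  move: (th _) (th _) (th _) (th _) (th _) (th _) (th _) (th _) => *.
  apply: (@ratio_eq (p * x ^+ 2)^-1); first by rewrite invr_eq0 mulf_neq0 // expf_neq0.
    by field; rewrite x0 p0 a0 I0.
  by field; rewrite x0 p0 c0 I0 J0.
- rewrite (@theta_mul (a * x * I) (p * a * x * I)) ?mulf_neq0 //; last by ring.
  rewrite (@theta_mul (a / x * I) (p * a / x * I)) ?mulf_neq0 ?invr_eq0 //;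
    last by ring.
  rewrite (@theta_mul (a * b * (I * J)) (p * a * b * (I * J))) ?mulf_neq0 //;
    last by ring.
  rewrite (@theta_mul (a / b * (I / J)) (p * a / b * (I / J))) ?mulf_neq0 ?invr_eq0 //;
    last by ring.
  move: (th _) (th _) (th _) (th _) (th _) (th _) (th _) (th _) => *.
  apply: (@ratio_eq (a ^+ 2 * I ^+ 2)^-1);
    first by rewrite invr_eq0 mulf_neq0 // expf_neq0.
    by field; rewrite a0 x0 I0.
  by field; rewrite a0 b0 I0 J0.
- rewrite (@theta_mul (b * c * (I * J * J)) (p * b * c * (I * J * J))) ?mulf_neq0 //;
    last by ring.
  rewrite (@theta_div (c / b * I) (c / (p * b) * I)) ?mulf_neq0 ?invr_eq0 //;
    last by field; rewrite b0 p0.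
  rewrite (@theta_mul (a * b * (I * J)) (a * (p * b) * (I * J))) ?mulf_neq0 //;
    last by ring.
  rewrite (@theta_div (a / b * (I / J)) (a / (p * b) * (I / J))) ?mulf_neq0 ?invr_eq0 //;
    last by field; rewrite b0 p0 J0.
  move: (th _) (th _) (th _) (th _) (th _) (th _) (th _) (th _) => *.
  apply: (@ratio_eq (p * b ^+ 2 * J ^+ 2)^-1);
    first by rewrite invr_eq0 !mulf_neq0 // expf_neq0.
    by field; rewrite b0 c0 p0 I0 J0.
  by field; rewrite a0 b0 p0 I0 J0.
- rewrite (@theta_mul (b * c * (I * J * J)) (b * (p * c) * (I * J * J))) ?mulf_neq0 //;
    last by ring.
  rewrite (@theta_mul (c / b * I) (p * c / b * I)) ?mulf_neq0 ?invr_eq0 //;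
    last by ring.
  rewrite (@theta_mul (c * x * (I * J)) (p * c * x * (I * J))) ?mulf_neq0 //;
    last by ring.
  rewrite (@theta_mul (c / x * (I * J)) (p * c / x * (I * J))) ?mulf_neq0 ?invr_eq0 //;
    last by ring.
  move: (th _) (th _) (th _) (th _) (th _) (th _) (th _) (th _) => *.
  apply: (@ratio_eq (c ^+ 2 * I ^+ 2 * J ^+ 2)^-1);
    first by rewrite invr_eq0 !mulf_neq0 // expf_neq0.
    by field; rewrite b0 c0 I0 J0.
  by field; rewrite x0 c0 I0 J0.
Qed.

Lemma p_invariant_swap (F : C -> C -> C -> C -> C) : p_invariant tau F ->
  p_invariant tau (fun x a b c => F x b a c).
Proof. by move=> HF x a b c x0 a0 b0 c0; have [] := HF x b a c x0 b0 a0 c0. Qed.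

Lemma p_invariant_div (F G : C -> C -> C -> C -> C) : p_invariant tau F ->
  p_invariant tau G -> p_invariant tau (fun x a b c => F x a b c / G x a b c).
Proof.
move=> HF HG x a b c x0 a0 b0 c0.
have [-> -> -> ->] := HF x a b c x0 a0 b0 c0.
by have [-> -> -> ->] := HG x a b c x0 a0 b0 c0.
Qed.

Let front_mulp k l y : y != 0 -> front p q k l (p * y) = front p q k l y.
Proof.
move=> y0; rewrite /front; congr (_ * _).
rewrite (@theta_mul (y * q ^ (k%:Z - l%:Z)) (p * y * q ^ (k%:Z - l%:Z))) ?mulf_neq0 //;
  last by rewrite mulrA.
rewrite (@theta_div y^-1 (p * y)^-1) ?invr_eq0 //; last by field; rewrite y0 p0.
rewrite (@theta_mul (y * q ^+ k) (p * y * q ^+ k)) ?mulf_neq0 //; last by rewrite mulrA.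
rewrite (@theta_div (y^-1 * q ^+ l) ((p * y)^-1 * q ^+ l)) ?mulf_neq0 ?invr_eq0 //;
  last by field; rewrite y0 p0.
move: (th _) (th _) (th _) (th _) => *.
have := qX0 k; have := qX0 l; rewrite expfzDr // -exprnN -exprnP => l0 k0.
apply: (@ratio_eq (q ^+ l / (q ^+ k * y ^+ 2 * p))).
- by rewrite mulf_neq0 // invr_eq0 !mulf_neq0 // expf_neq0.
- by field; rewrite y0 p0 k0 l0.
- by field; rewrite y0 p0 k0.
Qed.

Let front_divp k l y : y != 0 -> front p q k l (y / p) = front p q k l y.
Proof.
move=> y0; rewrite -[in RHS](mulfVK p0 y) [_ / p * p]mulrC front_mulp //.
by rewrite mulf_neq0 ?invr_eq0.
Qed.

(** Under y -> p y this is multiplied by q^(-kl), whatever y is. Invariance of [B_fun] thus becomes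
    a count of factors above and below. *)
Definition poch_ratio y k l : C := poch q p (y * q ^+ k) l / poch q p y l.

Let poch_mulp y l : y != 0 -> poch q p (p * y) l =
  (\prod_(0 <= j < l) - (y * q ^+ j)^-1) * poch q p y l.
Proof.
move=> y0; rewrite /poch -big_split /=; apply: eq_bigr => j _.
by rewrite -mulrA theta_mulp // mulf_neq0.
Qed.

Let poch_ratio_mulp y k l : y != 0 ->
  poch_ratio (p * y) k l = (q ^+ (k * l))^-1 * poch_ratio y k l.
Proof.
move=> y0; rewrite /poch_ratio -mulrA !poch_mulp ?mulf_neq0 //.
have -> : \prod_(0 <= j < l) - (y * q ^+ k * q ^+ j)^-1 =
    (q ^+ (k * l))^-1 * \prod_(0 <= j < l) - (y * q ^+ j)^-1.
  rewrite exprM; elim: (l) => [|m IH]; first by rewrite !big_nil expr0 invr1 mulr1.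
  rewrite !big_nat_recr //= IH exprSr.
  by move: (\prod_(0 <= j < m) _) => w; field; rewrite y0 !expf_neq0.
have M0 : \prod_(0 <= j < l) - (y * q ^+ j)^-1 != 0.
  rewrite prodf_seq_neq0; apply/allP => j _ /=.
  by rewrite oppr_eq0 invr_eq0 mulf_neq0.
move: (\prod_(0 <= j < l) _) (poch _ _ _ _) (poch _ _ _ _) M0 => M P P' M0.
by rewrite [RHS]mulrA; apply: (@ratio_eq M) => //; ring.
Qed.

Let poch_ratio_divp y k l : y != 0 ->
  poch_ratio (y / p) k l = q ^+ (k * l) * poch_ratio y k l.
Proof.
move=> y0; rewrite -[in RHS](mulfVK p0 y) [_ / p * p]mulrC poch_ratio_mulp.
  by rewrite mulVKf // expf_neq0.
by rewrite mulf_neq0 ?invr_eq0.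
Qed.

Lemma B_fun_ratioE k l x a b c : B_fun q p k l x a b c =
  front p q k l (a / b) *
  (poch_ratio (b * c) l k * poch_ratio (a * c) k l * poch_ratio q k l /
   (poch_ratio (a * b) k l * poch_ratio (c * x) k l * poch_ratio (c / x) k l)).
Proof.
rewrite /B_fun /thetas /pochs !big_cons !big_nil !mulr1 exprS.
rewrite /front /poch_ratio invf_div !invfM !invrK.
move: (poch _ _ (c / x) _) (poch _ _ (c * x) _) (poch _ _ (a * b) _) => *.
by ring.
Qed.

Lemma B_fun_p_invariant k l : p_invariant tau (B_fun q p k l).
Proof.
move=> x a b c x0 a0 b0 c0; rewrite !B_fun_ratioE.
have w0 : q ^+ (k * l) != 0 := qX0 _.
split.
- have -> : c * (p * x) = p * (c * x) by ring.
  have -> : c / (p * x) = c / x / p by field; rewrite x0 p0.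
  rewrite poch_ratio_mulp ?mulf_neq0 // poch_ratio_divp ?mulf_neq0 ?invr_eq0 //.
  congr (_ * (_ / _)); move: (poch_ratio _ _ _) (poch_ratio _ _ _) (poch_ratio _ _ _) => *.
  by field.
- rewrite -!(mulrA p) front_mulp ?mulf_neq0 ?invr_eq0 //; congr (_ * _).
  rewrite !poch_ratio_mulp ?mulf_neq0 //.
  move: (poch_ratio _ _ _) (poch_ratio _ _ _) (poch_ratio _ _ _) (poch_ratio _ _ _)
    (poch_ratio _ _ _) (poch_ratio _ _ _) => *.
  by apply: (@ratio_eq (q ^+ (k * l))^-1); rewrite ?invr_eq0 //; ring.
- have -> : a / (p * b) = a / b / p by field; rewrite b0 p0.
  have -> : a * (p * b) = p * (a * b) by ring.
  rewrite -!(mulrA p) front_divp ?mulf_neq0 ?invr_eq0 //; congr (_ * _).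
  rewrite !poch_ratio_mulp ?mulf_neq0 // (mulnC l k).
  move: (poch_ratio _ _ _) (poch_ratio _ _ _) (poch_ratio _ _ _) (poch_ratio _ _ _)
    (poch_ratio _ _ _) (poch_ratio _ _ _) => *.
  by apply: (@ratio_eq (q ^+ (k * l))^-1); rewrite ?invr_eq0 //; ring.
- have -> : a * (p * c) = p * (a * c) by ring.
  have -> : b * (p * c) = p * (b * c) by ring.
  rewrite -!(mulrA p); congr (_ * _).
  rewrite !poch_ratio_mulp ?mulf_neq0 ?invr_eq0 // (mulnC l k).
  move: (poch_ratio _ _ _) (poch_ratio _ _ _) (poch_ratio _ _ _) (poch_ratio _ _ _)
    (poch_ratio _ _ _) (poch_ratio _ _ _) => *.
  by apply: (@ratio_eq ((q ^+ (k * l))^-1 ^+ 2)); rewrite ?expf_neq0 ?invr_eq0 //; ring.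
Qed.

Lemma h_fun_shift i j x a b c :
  h_fun q p i j x (a * q) b (c * q) = h_fun q p i.+1 j x a b c.
Proof.
have ext (u v w z s t r m u' v' w' z' s' t' r' m' : C) : u = u' -> v = v' -> w = w' -> z = z' -> s = s' ->
  t = t' -> r = r' -> m = m' -> th u * th v * th w * th z / (th s * th t * th r * th m) =
  th u' * th v' * th w' * th z' / (th s' * th t' * th r' * th m').
  by move=> -> -> -> -> -> -> -> ->.
by rewrite !h_funE exprS; move: (q ^+ i) (q ^+ j) => *; apply: ext; ring.
Qed.

(** The shift of b, c raises the second index of h, whereas that of a, c in [h_fun_shift] raises the
    first. This is where the factors [H_fun] at second index 1 come from. *)
Lemma h_fun_shift0 i x a b c : b != 0 ->
  h_fun q p i 0 x a (b * q) (c * q) = h_fun q p i 1 x a b c.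
Proof.
move=> b0; rewrite !h_funE expr0 expr1 !divr1 !mulr1.
have -> : b * q * (c * q) * q ^+ i = b * c * (q ^+ i * q * q) by ring.
have -> : c * q / (b * q) = c / b by field; rewrite b0.
have -> : a * (b * q) * q ^+ i = a * b * (q ^+ i * q) by ring.
have -> : a / (b * q) * q ^+ i = a / b * (q ^+ i / q) by field; rewrite ?b0 ?q0.
have -> : c * q * x * q ^+ i = c * x * (q ^+ i * q) by ring.
by have -> : c * q / x * q ^+ i = c / x * (q ^+ i * q) by ring.
Qed.

Lemma H_fun_shift i x a b c :
  H_fun q p i 1 x (a * q) b (c * q) = H_fun q p i.+1 1 x a b c.
Proof. by rewrite /H_fun !h_fun_shift. Qed.

End Invariance.

(** * Density of the good points and ellipticity of h and of the binomial coefficients *)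

Section Instances.
Context {R : realType}.
Local Notation C := (Cplx R).
Local Notation V := 'rV[C]_4.
Variables sigma tau : C.
Hypothesis sigma_neq0 : sigma != 0.
Hypothesis p_bound : 0 < nc (nome tau) < 1.
Local Notation q := (nome sigma).
Local Notation p := (nome tau).
Local Notation th := (theta p).
Local Notation crd := (coordq sigma).
Local Notation pull := (pullback sigma).

Let q0 : q != 0 := nome_neq0 sigma.

(** The condition i != j makes a step along coordinate [i] rescale [t], as [theta_comp_neq0]
    requires; the Boolean selects product or quotient. *)
Definition monomial (t : V -> C) : Prop := exists (c : C) (i j : 'I_4) (b : bool),
  [/\ c != 0, i != j &
      forall z, t z = c * crd i z * (if b then crd j z else (crd j z)^-1)].

Lemma monomial_mul i j : i != j -> monomial (fun z => crd i z * crd j z).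
Proof.
by move=> ij; exists 1, i, j, true; split; [exact: oner_neq0 | | move=> z; rewrite mul1r].
Qed.

Lemma monomial_div i j : i != j -> monomial (fun z => crd i z / crd j z).
Proof.
by move=> ij; exists 1, i, j, false; split; [exact: oner_neq0 | | move=> z; rewrite mul1r].
Qed.

Lemma monomial_scale t (c : C) : c != 0 -> monomial t -> monomial (fun z => t z * c).
Proof.
move=> c0 [d [i [j [b [d0 ij E]]]]]; exists (d * c), i, j, b.
by split; [exact: mulf_neq0 | | move=> z; rewrite E; ring].
Qed.

Lemma hol_ratio_monomial t : monomial t -> hol_ratio (fun z => th (t z)).
Proof.
move=> [c [i [j [b [c0 ij E]]]]].
have -> : (fun z => th (t z)) =
    fun z => th (c * crd i z * (if b then crd j z else (crd j z)^-1)).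
  by apply/funext => z; rewrite E.
exact: hol_ratio_theta.
Qed.

Lemma hol_ratio_poch t k : monomial t -> hol_ratio (fun z => poch q p (t z) k).
Proof.
move=> mt; apply: hol_ratio_prod => j; apply: hol_ratio_monomial.
by apply: monomial_scale => //; rewrite expf_neq0.
Qed.

Definition mono (t : 'I_4 * 'I_4 * bool) z : C :=
  if t.2 then crd t.1.1 z * crd t.1.2 z else crd t.1.1 z / crd t.1.2 z.

(** [good_args] as index data, with 0, 1, 2, 3 standing for x, a, b, c. *)
Definition good_monos : seq ('I_4 * 'I_4 * bool) :=
  [:: (2, 3, true); (1, 3, true); (1, 2, true); (3, 0, true); (3, 0, false);
      (1, 2, false); (2, 1, false); (3, 2, false); (1, 0, true); (1, 0, false);
      (3, 1, false); (2, 0, true); (2, 0, false)].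

Lemma good_argsE z : good_args (crd 0 z) (crd 1 z) (crd 2 z) (crd 3 z) =
  [seq mono t z | t <- good_monos].
Proof. by []. Qed.

Lemma good_monos_neq t : t \in good_monos -> t.1.1 != t.1.2.
Proof. by move: t; apply/allP. Qed.

Lemma generically_all_seq (I : eqType) (s : seq I) (P : I -> set V) :
  (forall i, i \in s -> generically (P i)) ->
  generically [set z | forall i, i \in s -> P i z].
Proof.
elim: s => [|i s IH] H; first exact: generically_all.
have Hs : generically [set z | forall j, j \in s -> P j z].
  by apply: IH => j js; apply: H; rewrite inE js orbT.
have Hi := H i (mem_head _ _).
apply: (genericallyI Hi Hs) => z Piz Psz j; rewrite inE => /orP[/eqP -> //|].
exact: Psz.
Qed.

Lemma generically_good K :
  generically [set z | good_point p q K (crd 0 z) (crd 1 z) (crd 2 z) (crd 3 z)].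
Proof.
have H : generically [set z | forall t, t \in good_monos ->
    forall m, m \in window K.+1 -> th (mono t z * q ^ m) != 0].
  apply: generically_all_seq => -[[i j] b] /good_monos_neq /= ij.
  apply: generically_all_seq => m _; apply: hol_ratio_neq0.
  apply: hol_ratio_monomial; apply: monomial_scale; first by rewrite expfz_neq0.
  by rewrite /mono; case: b; [exact: monomial_mul | exact: monomial_div].
apply: (genericallyI H H) => z Hz _; split; first by split; exact: coordq_neq0.
move=> y; rewrite good_argsE => /mapP[t ti ->] m mK; apply: Hz => //.
by rewrite mem_window; lia.
Qed.

Ltac theta_ratio :=
  repeat first [ apply: hol_ratio_cst | apply: hol_ratio_div | apply: hol_ratio_mul
    | apply: hol_ratio_monomial | apply: hol_ratio_poch
    | apply: monomial_scale | apply: monomial_mul | apply: monomial_div ].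

Lemma h_fun_hol_ratio i j : hol_ratio (pull (h_fun q p i j)).
Proof.
have -> : pull (h_fun q p i j) = fun z =>
  th (crd 2 z * crd 3 z * (q ^+ i * q ^+ j * q ^+ j)) *
  th (crd 3 z / crd 2 z * q ^+ i) *
  th (crd 1 z * crd 0 z * q ^+ i) * th (crd 1 z / crd 0 z * q ^+ i) /
  (th (crd 1 z * crd 2 z * (q ^+ i * q ^+ j)) *
   th (crd 1 z / crd 2 z * (q ^+ i / q ^+ j)) *
   th (crd 3 z * crd 0 z * (q ^+ i * q ^+ j)) *
   th (crd 3 z / crd 0 z * (q ^+ i * q ^+ j))).
  by apply/funext => z; rewrite /pullback h_funE.
have qi : q ^+ i != 0 by rewrite expf_neq0.
have qj : q ^+ j != 0 by rewrite expf_neq0.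
by theta_ratio; rewrite ?mulf_neq0 ?invr_eq0.
Qed.

Lemma h_swap_hol_ratio i j : hol_ratio (pull (fun x a b c => h_fun q p i j x b a c)).
Proof.
have -> : pull (fun x a b c => h_fun q p i j x b a c) = fun z =>
  th (crd 1 z * crd 3 z * (q ^+ i * q ^+ j * q ^+ j)) *
  th (crd 3 z / crd 1 z * q ^+ i) *
  th (crd 2 z * crd 0 z * q ^+ i) * th (crd 2 z / crd 0 z * q ^+ i) /
  (th (crd 2 z * crd 1 z * (q ^+ i * q ^+ j)) *
   th (crd 2 z / crd 1 z * (q ^+ i / q ^+ j)) *
   th (crd 3 z * crd 0 z * (q ^+ i * q ^+ j)) *
   th (crd 3 z / crd 0 z * (q ^+ i * q ^+ j))).
  by apply/funext => z; rewrite /pullback h_funE.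
have qi : q ^+ i != 0 by rewrite expf_neq0.
have qj : q ^+ j != 0 by rewrite expf_neq0.
by theta_ratio; rewrite ?mulf_neq0 ?invr_eq0.
Qed.

(** The factors (q; q, p)_l and (q^(k+1); q, p)_l are constants, so the hypothesis has to exclude
    their vanishing; all other thetas are generically nonzero. *)
Lemma B_fun_hol_ratio k l :
  (forall m, (0 < m <= k + l)%N -> th (q ^+ m) != 0) ->
  hol_ratio (pull (B_fun q p k l)).
Proof.
move=> qn.
have -> : pull (B_fun q p k l) = fun z =>
  th (crd 1 z / crd 2 z * q ^ (k%:Z - l%:Z)) * (th (crd 2 z / crd 1 z) * 1) *
  poch q p (crd 2 z * crd 3 z * q ^+ l) k *
  (poch q p (crd 1 z * crd 3 z * q ^+ k) l * (poch q p (crd 1 z * crd 2 z) l *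
   (poch q p (crd 3 z * crd 0 z) l * (poch q p (crd 3 z / crd 0 z) l *
   (poch q p (q ^+ k.+1) l * 1))))) /
  (th (crd 1 z / crd 2 z * q ^+ k) * (th (crd 2 z / crd 1 z * q ^+ l) * 1) *
   poch q p (crd 2 z * crd 3 z) k *
   (poch q p (crd 1 z * crd 3 z) l * (poch q p (crd 1 z * crd 2 z * q ^+ k) l *
   (poch q p (crd 3 z * crd 0 z * q ^+ k) l *
   (poch q p (crd 3 z / crd 0 z * q ^+ k) l * (poch q p q l * 1)))))) * q ^+ l.
  apply/funext => z; rewrite /pullback /B_fun /thetas /pochs !big_cons !big_nil.
  by rewrite /coordq.
have qk : q ^+ k != 0 by rewrite expf_neq0.
have ql : q ^+ l != 0 by rewrite expf_neq0.
have qz : q ^ (k%:Z - l%:Z) != 0 by rewrite expfz_neq0.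
have c1 : poch q p (q ^+ k.+1) l != 0.
  apply: poch_neq0 => m ml; rewrite -exprD qn //; lia.
have c2 : poch q p q l != 0.
  apply: poch_neq0 => m ml; rewrite -exprS qn //; lia.
by theta_ratio; rewrite ?mulr1 ?oner_neq0.
Qed.

End Instances.

(** * The skew algebra *)

Section Algebra.
Context {R : realType}.
Local Notation C := (Cplx R).
Local Notation V := 'rV[C]_4.
Variables sigma tau : C.
Local Notation q := (nome sigma).
Local Notation pull := (pullback sigma).
Local Notation E := (ellE sigma tau).
Local Notation A := (XYalg sigma tau).
Local Notation cf := (@XYcoef R sigma tau).
Local Notation ell := (@ell R sigma tau).
Implicit Types (g h : V -> C) (e : E).

(** A bridge from classes to plain functions: [g] itself need not be elliptic, so identities in
    [ellE] reduce to generic pointwise ones. *)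
Definition represents g e : Prop :=
  exists2 f : ellfun sigma tau, e = ell_class f & generically [set z | f z = g z].

Lemma ell_class_eq (f g : ellfun sigma tau) :
  generically [set z | f z = g z] -> ell_class f = ell_class g :> E.
Proof.
move=> fg; have : f - g \in @Defs.negligible R sigma tau.
  apply/Defs.negligibleP; apply: (genericallyI fg fg) => z /= fz _.
  by rewrite !fctE fz subrr.
by rewrite Quotient.idealrBE => /eqP.
Qed.

Lemma represents_inj g h e e' : represents g e -> represents h e' ->
  generically [set z | g z = h z] -> e = e'.
Proof.
move=> [f1 -> H1] [f2 -> H2] gh; apply: ell_class_eq.
have H12 := genericallyI H1 H2 (fun z => @conj _ _).
by apply: (genericallyI H12 gh) => z [/= -> ->].
Qed.

Lemma represents_ell F : pull F \in elliptic sigma tau ->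
  represents (pull F) (ell F).
Proof.
move=> HF; exists (EllFun HF); last exact: generically_all.
rewrite /Defs.ell; congr (ell_class _); apply: val_inj.
by rewrite insubdK.
Qed.

Lemma represents1 : represents (fun=> 1) 1.
Proof.
exists 1; last exact: generically_all.
by rewrite /ell_class rmorph1.
Qed.

Lemma represents_mul g h e e' : represents g e -> represents h e' ->
  represents (fun z => g z * h z) (e * e').
Proof.
move=> [f1 -> H1] [f2 -> H2]; exists (f1 * f2); first by rewrite /ell_class rmorphM.
by apply: (genericallyI H1 H2) => z /= <- <-.
Qed.

Lemma represents_add g h e e' : represents g e -> represents h e' ->
  represents (fun z => g z + h z) (e + e').
Proof.
move=> [f1 -> H1] [f2 -> H2]; exists (f1 + f2); first by rewrite /ell_class rmorphD.
by apply: (genericallyI H1 H2) => z /= <- <-.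
Qed.

Lemma represents_prod n (G : nat -> V -> C) (e : nat -> E) :
  (forall i, represents (G i) (e i)) ->
  represents (fun z => \prod_(0 <= i < n) G i z) (\prod_(0 <= i < n) e i).
Proof.
move=> H; elim: n => [|n IH].
  rewrite big_nil; have -> : (fun z => \prod_(0 <= i < 0) G i z) = fun=> 1.
    by apply/funext => z; rewrite big_nil.
  exact: represents1.
rewrite big_nat_recr //=.
have -> : (fun z => \prod_(0 <= i < n.+1) G i z) =
    fun z => \prod_(0 <= i < n) G i z * G n z.
  by apply/funext => z; rewrite big_nat_recr.
exact: represents_mul.
Qed.

Definition argX (F : C -> C -> C -> C -> C) x a b c := F x (a * q) b (c * q).
Definition argY (F : C -> C -> C -> C -> C) x a b c := F x a (b * q) (c * q).

Lemma pull_argX F z : pull (argX F) z = pull F (z + (delta_mx 0 1 + delta_mx 0 3)).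
Proof.
have E i : nome (sigma * (z + (delta_mx 0 1 + delta_mx 0 3)) 0 i) =
    if (i == 1) || (i == 3) then nome (sigma * z 0 i) * q else nome (sigma * z 0 i).
  rewrite !mxE eqxx /= mulrDr nomeD.
  have [->|[->|[->|->]]] := ord4_cases i; rewrite ?eqxx ?ord4_neq /=;
    by rewrite ?addr0 ?add0r ?mulr0 ?mulr1 ?nome0 ?mulr1.
by rewrite /pullback /argX !E !ord4_neq !eqxx.
Qed.

Lemma pull_argY F z : pull (argY F) z = pull F (z + (delta_mx 0 2 + delta_mx 0 3)).
Proof.
have E i : nome (sigma * (z + (delta_mx 0 2 + delta_mx 0 3)) 0 i) =
    if (i == 2) || (i == 3) then nome (sigma * z 0 i) * q else nome (sigma * z 0 i).
  rewrite !mxE eqxx /= mulrDr nomeD.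
  have [->|[->|[->|->]]] := ord4_cases i; rewrite ?eqxx ?ord4_neq /=;
    by rewrite ?addr0 ?add0r ?mulr0 ?mulr1 ?nome0 ?mulr1.
by rewrite /pullback /argY !E !ord4_neq !eqxx.
Qed.

Lemma argX_elliptic F : pull F \in elliptic sigma tau ->
  pull (argX F) \in elliptic sigma tau.
Proof.
move=> HF; have -> : pull (argX F) =
    fun z => pull F (z + (delta_mx 0 1 + delta_mx 0 3)).
  by apply/funext => z; exact: pull_argX.
exact: (translate_elliptic _ (EllFun HF)).
Qed.

Lemma argY_elliptic F : pull F \in elliptic sigma tau ->
  pull (argY F) \in elliptic sigma tau.
Proof.
move=> HF; have -> : pull (argY F) =
    fun z => pull F (z + (delta_mx 0 2 + delta_mx 0 3)).
  by apply/funext => z; exact: pull_argY.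
exact: (translate_elliptic _ (EllFun HF)).
Qed.

Lemma ell_classE F (HF : pull F \in elliptic sigma tau) :
  ell F = ell_class (EllFun HF).
Proof.
by rewrite /Defs.ell; congr (ell_class _); apply: val_inj; rewrite insubdK.
Qed.

Local Notation X := (XYX sigma tau).
Local Notation Y := (XYY sigma tau).

Lemma X_ell F : pull F \in elliptic sigma tau ->
  X * cf (ell F) = cf (ell (argX F)) * X.
Proof.
move=> HF; rewrite ell_classE XYX_coef (ell_classE (argX_elliptic HF)).
congr (cf (ell_class _) * _); apply: val_inj; apply/funext => z /=.
by rewrite pull_argX.
Qed.

Lemma Y_ell F : pull F \in elliptic sigma tau ->
  Y * cf (ell F) = cf (ell (argY F)) * Y.
Proof.
move=> HF; rewrite ell_classE XYY_coef (ell_classE (argY_elliptic HF)).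
congr (cf (ell_class _) * _); apply: val_inj; apply/funext => z /=.
by rewrite pull_argY.
Qed.

Lemma skew_prod (W : A) n (e e' : nat -> E) :
  (forall i, W * cf (e i) = cf (e' i) * W) ->
  W * cf (\prod_(0 <= i < n) e i) = cf (\prod_(0 <= i < n) e' i) * W.
Proof.
move=> H; elim: n => [|n IH]; first by rewrite !big_nil !rmorph1 mulr1 mul1r.
by rewrite !big_nat_recr //= !rmorphM mulrA IH -mulrA H mulrA.
Qed.

(* KX and KY are the coefficients K moved past X and Y; H comes from moving Y
   past X. *)
Lemma skew_binomial (h : E) (H : nat -> E) (K KX KY : nat -> nat -> E) N :
  (forall k, Y * X ^+ k = cf (\prod_(0 <= i < k) H i) * X ^+ k * Y) ->
  (forall n k, (k <= n)%N -> (n < N)%N -> X * cf (K n k) = cf (KX n k) * X) ->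
  (forall n k, (k <= n)%N -> (n < N)%N -> Y * cf (K n k) = cf (KY n k) * Y) ->
  K 0%N 0%N = 1 ->
  (forall n, (n < N)%N -> K n.+1 0%N = h * KY n 0%N) ->
  (forall n, (n < N)%N -> K n.+1 n.+1 = KX n n) ->
  (forall n k, (k < n)%N -> (n < N)%N ->
     K n.+1 k.+1 = KX n k + h * KY n k.+1 * \prod_(0 <= i < k.+1) H i) ->
  forall n, (n <= N)%N -> (X + cf h * Y) ^+ n =
    \sum_(0 <= k < n.+1) cf (K n k) * X ^+ k * Y ^+ (n - k).
Proof.
move=> YX HX HY K00 K0 Kn Kr; elim=> [|n IH] nN.
  by rewrite expr0 big_nat1 K00 rmorph1 !expr0 !mulr1.
rewrite exprS IH; last exact: ltnW.
rewrite mulrDl !mulr_sumr.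
have TX : \sum_(0 <= k < n.+1) X * (cf (K n k) * X ^+ k * Y ^+ (n - k)) =
    \sum_(0 <= k < n.+1) cf (KX n k) * X ^+ k.+1 * Y ^+ (n - k).
  apply: eq_big_nat => k /andP[_ kn]; rewrite !mulrA HX //.
  by rewrite -(mulrA (cf _)) -exprS.
have TY : \sum_(0 <= k < n.+1) cf h * Y * (cf (K n k) * X ^+ k * Y ^+ (n - k)) =
    \sum_(0 <= k < n.+1) cf (h * KY n k * \prod_(0 <= i < k) H i) * X ^+ k *
      Y ^+ (n.+1 - k).
  apply: eq_big_nat => k /andP[_ kn]; rewrite -!mulrA (mulrA Y) HY // -!mulrA.
  rewrite (mulrA Y) YX !mulrA -!rmorphM -!mulrA -exprS subSn //.
rewrite TX TY.
(* The X-term of index k meets the Y-term of index k + 1; the last X-term and the first Y-term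
   remain as the two boundary coefficients. *)
rewrite [X in X + _]big_nat_recr //= [X in _ + X]big_nat_recl //=.
rewrite [RHS]big_nat_recl //= [X in _ = _ + X]big_nat_recr //=.
rewrite subnn big_nil mulr1 (K0 n nN) (Kn n nN) subnn.
rewrite addrCA; congr (_ + _); rewrite addrAC; congr (_ + _).
rewrite -big_split; apply: eq_big_nat => k /andP[_ kn] /=.
by rewrite Kr // rmorphD !mulrDl subSS.
Qed.

End Algebra.

(** * Assembling the coefficients in the skew algebra *)

Section BinomialTheorem.
Context {R : realType}.
Local Notation C := (Cplx R).
Local Notation V := 'rV[C]_4.
Variables sigma tau : C.
Variable N : nat.
Hypothesis sigma_neq0 : sigma != 0.
Hypothesis p_bound : 0 < nc (nome tau) < 1.
Hypothesis q_generic : forall m : nat, (0 < m <= N)%N ->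
  theta (nome tau) (nome sigma ^+ m) != 0.
Local Notation q := (nome sigma).
Local Notation p := (nome tau).
Local Notation th := (theta p).
Local Notation pull := (pullback sigma).
Local Notation cf := (@XYcoef R sigma tau).
Local Notation ell := (@ell R sigma tau).
Local Notation crd := (coordq sigma).
Local Notation elliptic := (elliptic sigma tau).
Local Notation X := (XYX sigma tau).
Local Notation Y := (XYY sigma tau).
Local Notation hs j := (fun x a b c => h_fun q p j 0 x b a c).
Local Notation Hs j := (fun x a b c => H_fun q p j 1 x b a c).

Let q0 : q != 0 := nome_neq0 sigma.

Lemma generically_at K (P : C -> C -> C -> C -> Prop) :
  (forall x a b c, good_point p q K x a b c -> P x a b c) ->
  generically [set z : V | P (crd 0 z) (crd 1 z) (crd 2 z) (crd 3 z)].
Proof.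
move=> H; have G := generically_good sigma_neq0 p_bound K.
by apply: (genericallyI G G) => z Gz _; exact: H.
Qed.

Lemma h_swap_elliptic i j : pull (fun x a b c => h_fun q p i j x b a c) \in elliptic.
Proof.
apply: pull_elliptic => //; first exact: h_swap_hol_ratio.
exact/p_invariant_swap/h_fun_p_invariant.
Qed.

Lemma H_elliptic i : pull (H_fun q p i 1) \in elliptic.
Proof.
apply: pull_elliptic => //.
  by apply: hol_ratio_div; exact: h_fun_hol_ratio.
by apply: p_invariant_div; exact: h_fun_p_invariant.
Qed.

Lemma Hs_elliptic i : pull (Hs i) \in elliptic.
Proof.
apply: pull_elliptic => //.
  by apply: hol_ratio_div; exact: h_swap_hol_ratio.
apply: (@p_invariant_swap _ _ (H_fun q p i 1)).
by apply: p_invariant_div; exact: h_fun_p_invariant.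
Qed.

Lemma B_elliptic k l : (k + l <= N)%N -> pull (B_fun q p k l) \in elliptic.
Proof.
move=> klN; apply: pull_elliptic => //; last exact: B_fun_p_invariant.
apply: B_fun_hol_ratio => // m /andP[m0 mkl]; apply: q_generic.
by rewrite m0 (leq_trans mkl).
Qed.

Lemma qpoch_neq0 m : (m <= N)%N -> poch q p q m != 0.
Proof.
move=> mN; apply: poch_neq0 => j jm; rewrite -exprS q_generic //=.
exact: leq_trans jm mN.
Qed.

Lemma ell_eq1 F K : pull F \in elliptic ->
  (forall x a b c, good_point p q K x a b c -> F x a b c = 1) -> ell F = 1.
Proof.
move=> HF H; apply: (represents_inj (represents_ell HF) (@represents1 _ sigma tau)).
exact: (@generically_at K (fun x a b c => F x a b c = 1)).
Qed.

Lemma B_fun_l0 K k x a b c : (k <= N)%N -> good_point p q K x a b c -> (k <= K)%N ->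
  B_fun q p k 0 x a b c = 1.
Proof.
move=> kN Hg kK; rewrite (B_funC p_bound q0 Hg) ?qpoch_neq0 //.
exact: (B_fun0l p_bound q0 (good_pointC Hg) kK (qpoch_neq0 kN)).
Qed.

Lemma ell_B0l l : (l <= N)%N -> ell (B_fun q p 0 l) = 1.
Proof.
move=> lN; apply: (@ell_eq1 _ l); first exact: B_elliptic.
by move=> x a b c Hg; apply: (B_fun0l p_bound q0 Hg) => //; exact: qpoch_neq0.
Qed.

Lemma ell_Bk0 k : (k <= N)%N -> ell (B_fun q p k 0) = 1.
Proof.
move=> kN; apply: (@ell_eq1 _ k); first by apply: B_elliptic; rewrite addn0.
by move=> x a b c Hg; exact: (B_fun_l0 kN Hg).
Qed.

Lemma ell_argY_B0l l : (l <= N)%N -> ell (argY sigma (B_fun q p 0 l)) = 1.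
Proof.
(* The extra 2 pays for [good_shift]. *)
move=> lN; apply: (@ell_eq1 _ l.+2); first exact/argY_elliptic/B_elliptic.
move=> x a b c /(good_shift q0) Hg; rewrite /argY.
by apply: (B_fun0l p_bound q0 Hg) => //; exact: qpoch_neq0.
Qed.

Lemma ell_argX_Bk0 k : (k <= N)%N -> ell (argX sigma (B_fun q p k 0)) = 1.
Proof.
move=> kN; apply: (@ell_eq1 _ k.+2).
  by apply: argX_elliptic; apply: B_elliptic; rewrite addn0.
(* The shift of a and c is that of b and c conjugated by a <-> b. *)
move=> x a b c /good_pointC/(good_shift q0)/good_pointC Hg; rewrite /argX.
exact: (B_fun_l0 kN Hg).
Qed.

(** With a and b exchanged, the shift by X raises the second index from 0 to 1, and h(j, 1) = h(j,
    0) H(j, 1) wherever h(j, 0) is nonzero, hence generically. *)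
Lemma ell_argX_hs j : ell (argX sigma (hs j)) = ell (hs j) * ell (Hs j).
Proof.
have hE := h_swap_elliptic j 0.
apply: (represents_inj (represents_ell (argX_elliptic hE))
  (represents_mul (represents_ell hE) (represents_ell (Hs_elliptic j)))).
have G1 := hol_ratio_neq0 (h_swap_hol_ratio sigma_neq0 p_bound j 0).
apply: (genericallyI G1 G1) => z /= hz _; rewrite /pullback /argX h_fun_shift0 ?nome_neq0 //.
by rewrite /H_fun mulrCA mulfV ?mulr1.
Qed.

Lemma ell_argY_hs j : ell (argY sigma (hs j)) = ell (hs j.+1).
Proof.
congr ell; do 4 (apply/funext => ?); rewrite /argY; exact: h_fun_shift.
Qed.

Lemma ell_argX_H i : ell (argX sigma (H_fun q p i 1)) = ell (H_fun q p i.+1 1).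
Proof.
congr ell; do 4 (apply/funext => ?); rewrite /argX; exact: H_fun_shift.
Qed.

Lemma Y_Xn k : Y * X ^+ k = cf (\prod_(0 <= i < k) H_ell sigma tau i 1) * X ^+ k * Y.
Proof.
elim: k => [|k IH]; first by rewrite big_nil rmorph1 expr0 !mul1r mulr1.
rewrite exprS mulrA XYYX -(mulrA (cf _)) -(mulrA X) IH !mulrA.
rewrite -(mulrA (cf _) X (cf _)).
rewrite (@skew_prod _ _ _ _ _ _ (fun i => H_ell sigma tau i.+1 1)); last first.
  by move=> i; rewrite X_ell ?ell_argX_H //; exact: H_elliptic.
by rewrite !mulrA -rmorphM big_nat_recl.
Qed.

Lemma binom_funE n k : (k <= n)%N -> binom_fun q p n k = B_fun q p k (n - k).
Proof. by move=> kn; do 4 (apply/funext => ?); rewrite /binom_fun kn. Qed.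

Lemma ell_B_recurrence k l : (k.+1 + l.+1 <= N)%N ->
  ell (B_fun q p k.+1 l.+1) =
  ell (argX sigma (B_fun q p k l.+1)) * \prod_(0 <= j < l.+1) ell (Hs j) +
  ell (argY sigma (B_fun q p k.+1 l)) * \prod_(0 <= j < k.+1) H_ell sigma tau j 1.
Proof.
move=> klN.
have H1 : represents (pull (B_fun q p k.+1 l.+1)) (ell (B_fun q p k.+1 l.+1)).
  by apply: represents_ell; exact: B_elliptic.
have H2 := represents_mul
  (represents_ell (argX_elliptic (B_elliptic (_ : (k + l.+1 <= N)%N))))
  (represents_prod l.+1 (fun j => represents_ell (Hs_elliptic j))).
have H3 := represents_mul
  (represents_ell (argY_elliptic (B_elliptic (_ : (k.+1 + l <= N)%N))))
  (represents_prod k.+1 (fun j => represents_ell (H_elliptic j))).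
have e1 : (k + l.+1 <= N)%N by lia.
have e2 : (k.+1 + l <= N)%N by lia.
apply: (represents_inj H1 (represents_add (H2 e1) (H3 e2))).
pose K := (k.+1 + l.+1).+1.
apply: (@generically_at K (fun x a b c => B_fun q p k.+1 l.+1 x a b c =
  B_fun q p k l.+1 x (a * q) b (c * q) *
    \prod_(0 <= j < l.+1) H_fun q p j 1 x b a c +
  B_fun q p k.+1 l x a (b * q) (c * q) *
    \prod_(0 <= j < k.+1) H_fun q p j 1 x a b c)).
move=> x a b c Hg; apply: (B_recurrence p_bound q0 Hg) => // m /andP[m0 mkl].
by apply: q_generic; rewrite m0 (leq_trans mkl).
Qed.

Lemma elliptic_binomial :
  (X + cf (hswap_ell sigma tau 0 0) * Y) ^+ N =
  \sum_(0 <= k < N.+1) cf (binom_ell sigma tau N k) *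
    cf (\prod_(0 <= j < N - k) hswap_ell sigma tau j 0) * X ^+ k * Y ^+ (N - k).
Proof.
pose hprod l := \prod_(0 <= j < l) ell (hs j).
pose K n k := ell (binom_fun q p n k) * hprod (n - k)%N.
pose KX n k := ell (argX sigma (binom_fun q p n k)) *
  \prod_(0 <= j < n - k) ell (argX sigma (hs j)).
pose KY n k := ell (argY sigma (binom_fun q p n k)) *
  \prod_(0 <= j < n - k) ell (argY sigma (hs j)).
(* Y raises the index of every h(j, 0) by one, and the coefficient h(0, 0) of Y fills the vacated
   place j = 0. This is how the product in the theorem builds up. *)
have hY l : hswap_ell sigma tau 0 0 * \prod_(0 <= j < l) ell (argY sigma (hs j)) =
    hprod l.+1.
  rewrite /hprod big_nat_recl //; congr (_ * _).
  by apply: eq_bigr => j _; rewrite ell_argY_hs.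
have := @skew_binomial _ sigma tau (hswap_ell sigma tau 0 0)
  (fun i => H_ell sigma tau i 1) K KX KY N Y_Xn.
move=> main; rewrite main //.
- by apply: eq_bigr => k _; rewrite rmorphM.
- move=> n k kn nN; rewrite rmorphM mulrA X_ell; last first.
    by rewrite binom_funE //; apply: B_elliptic; lia.
  rewrite -mulrA (@skew_prod _ _ _ _ _ _ (fun j => ell (argX sigma (hs j)))).
    by rewrite mulrA -rmorphM.
  by move=> j; apply: X_ell; exact: h_swap_elliptic.
- move=> n k kn nN; rewrite rmorphM mulrA Y_ell; last first.
    by rewrite binom_funE //; apply: B_elliptic; lia.
  rewrite -mulrA (@skew_prod _ _ _ _ _ _ (fun j => ell (argY sigma (hs j)))).
    by rewrite mulrA -rmorphM.
  by move=> j; apply: Y_ell; exact: h_swap_elliptic.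
- by rewrite /K /hprod binom_funE // big_nil mulr1 ell_B0l.
- move=> n nN; rewrite /K /KY !binom_funE // !subn0 ell_B0l // ell_argY_B0l ?mul1r ?hY //.
  exact: ltnW.
- move=> n nN; rewrite /K /KX /hprod !binom_funE // !subnn !big_nil !mulr1.
  by rewrite ell_Bk0 // ell_argX_Bk0 // ltnW.
move=> n k kn nN; have kn' := ltnW kn; rewrite /K /KX /KY !binom_funE //.
have [l nE] : exists l, (n - k)%N = l.+1 by exists (n - k).-1; lia.
have nE' : (n - k.+1)%N = l by lia.
rewrite subSS nE nE' ell_B_recurrence; last by lia.
(* The factors H(j, 1) released by moving X past the h(j, 0) are those of the first term of
   [ell_B_recurrence]. *)
rewrite mulrCA hY (eq_bigr _ (fun j _ => ell_argX_hs j)) big_split /= -/(hprod l.+1).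
rewrite mulrDl; congr (_ + _); last exact: mulrAC.
by rewrite -mulrA; congr (_ * _); exact: mulrC.
Qed.

End BinomialTheorem.

Theorem theorem5p7 (R : realType) (sigma tau : Cplx R) (n : nat)
  (sigma_neq0 : sigma != 0)
  (Im_tau_gt0 : 0 < complex.Im tau)
  (q_generic : forall m : nat, (0 < m <= n)%N ->
     theta (nome tau) (nome sigma ^+ m) != 0) :
  (XYX sigma tau + XYcoef (hswap_ell sigma tau 0 0) * XYY sigma tau) ^+ n =
  \sum_(0 <= k < n.+1)
    XYcoef (binom_ell sigma tau n k) *
    XYcoef (\prod_(0 <= j < n - k) hswap_ell sigma tau j 0) *
    XYX sigma tau ^+ k * XYY sigma tau ^+ (n - k).
Proof.
apply: elliptic_binomial => //.
(* |p| = exp(-2 pi Im tau), so |p| < 1 amounts to Im tau > 0. *)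
rewrite nc_nome expR_gt0 /= -expR0 ltr_expR oppr_lt0.
by rewrite !mulr_gt0 // pi_gt0.
Qed.
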